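(* Let $g$ be a model edge degenerate metric on an edge manifold $M$, let $\tilde g$ be a first-order perturbation of $g$, and let $\nabla^g,\nabla^{\tilde g}$ be their Levi-Civita connections (defined for $r\neq0$). Then, near $\partial M$, the connections $\varphi\nabla^g\varphi^{-1}$ and $\varphi\nabla^{\tilde g}\varphi^{-1}$ extend to smooth connections on $TM$ down to $r=0$. If moreover $\tilde g$ is a second-order perturbation of $g$, then the restrictions of these extended connections to $r=0$ coincide: $$\varphi\nabla^{\tilde g}\varphi^{-1}\big|_{r=0}=\varphi\nabla^{g}\varphi^{-1}\big|_{r=0}.$$
   Context: Edge manifold: a compact manifold $M$ with boundary $N=\partial M$, where $\pi:N\to B$ is a locally trivial fibration with an Ehresmann connection $TN=VN\oplus\pi^*TB$, $VN=\ker d\pi$. A boundary-defining function $r$ with values in $(-\epsilon,0]$ is fixed, together with a collar neighborhood $U$ of $N$ identified with $(-\epsilon,0]\times N$ so that $r$ is the first projection. Thus on $U$ (writing pull-backs to $U$ by the same symbols) $TM|_U=F\oplus F'$, with $F=VN$ and $F'=\mathbb R\partial_r\oplus\pi^*TB$. Let $\varphi$ be the endomorphism of $TM|_U$ given by $\varphi(v,w)=(rv,w)$ for $v\in F,\ w\in F'$; it is invertible on $U^c:=U\setminus N$. Model edge degenerate metric: $g=dr^2\oplus r^2g^V\oplus\pi^*g^B$ on $U^c$, with $g^V$ a Riemannian metric on the bundle $VN\to N$ and $g^B$ a Riemannian metric on $B$. For a metric $g'$ on $TM|_{U^c}$ put $g'^{\varphi}(\cdot,\cdot)=g'(\varphi^{-1}\cdot,\varphi^{-1}\cdot)$;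 then $g^\varphi=dr^2\oplus g^V\oplus\pi^*g^B$ extends smoothly to $U$. A first (resp. second) order perturbation of $g$ is a Riemannian metric $\tilde g$ on the interior of $M$ such that on $U$ one has $\tilde g^\varphi=g^\varphi+r^p\alpha$ with $p=1$ (resp. $p=2$), where $\alpha$ is a symmetric bilinear form on $TM|_U$, smooth down to $r=0$. $\varphi\nabla\varphi^{-1}$ denotes the connection $X\mapsto\varphi\circ\nabla_X\circ\varphi^{-1}$. *)

(* Defs.v *)
From HB Require Import structures.
From mathcomp Require Import all_boot all_order all_algebra.
From mathcomp Require Import all_classical all_reals all_analysis.

Set Implicit Arguments.
Unset Strict Implicit.
Unset Printing Implicit Defensive.

Import Order.TTheory GRing.Theory Num.Theory.
Import numFieldNormedType.Exports.
Local Open Scope classical_set_scope.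
Local Open Scope ring_scope.

(** * Smooth functions on R^n *)

Fixpoint Ck (R : realType) (n k : nat) (O : set 'rV[R]_n) (F : 'rV[R]_n -> R)
  : Prop :=
  if k is k'.+1 then
    (forall x, O x -> differentiable F x) /\
    (forall v : 'rV[R]_n, Ck k' O ('D_v F))
  else forall x, O x -> {for x, continuous F}.

Definition smooth_near (R : realType) (n : nat) (x : 'rV[R]_n)
    (F : 'rV[R]_n -> R) : Prop :=
  exists O : set 'rV[R]_n, [/\ open O, O x & forall k, Ck k O F].

Definition halfspace (R : realType) (n : nat) : set 'rV[R]_n.+1 :=
  [set x | x ord0 ord0 <= 0].
Arguments halfspace : clear implicits.

(** * Smooth manifolds, possibly with boundary *)

Record chart (R : realType) (M : topologicalType) (n : nat) := Chart {
  cdom : set M;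
  cmap : M -> 'rV[R]_n }.

Section Charts.
Context {R : realType} {M : topologicalType}.

(** [c] is a homeomorphism from an open set of [M] onto a relatively open
    subset of the model space [H]. *)
Definition is_chart (n : nat) (H : set 'rV[R]_n) (c : chart R M n) : Prop :=
  [/\ open (cdom c),
      forall p q, cdom c p -> cdom c q -> cmap c p = cmap c q -> p = q,
      forall p, cdom c p -> {for p, continuous (cmap c)} &
      forall W : set M, open W -> W `<=` cdom c ->
        exists2 O : set 'rV[R]_n, open O & cmap c @` W = O `&` H].

(** Near [p], [f] is [F \o c] for a smooth [F] on a full neighbourhood of [c p]
    in R^n: at a boundary point of a half-space, this is the usual smoothness
    up to the boundary. *)
Definition smooth_in_chart (n : nat) (c : chart R M n) (p : M) (f : M -> R)
  : Prop :=
  cdom c p /\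
  exists2 F : 'rV[R]_n -> R, smooth_near (cmap c p) F &
    \forall q \near p, f q = F (cmap c q).

Definition transition_smooth (m n : nat) (c : chart R M m) (d : chart R M n)
  : Prop :=
  forall p, cdom c p -> cdom d p ->
    forall j, smooth_in_chart c p (fun q => cmap d q ord0 j).

Definition pair_chart (N1 N2 : topologicalType) (m n : nat) (W : set M)
    (f : M -> N1) (c : chart R N1 m) (g : M -> N2) (d : chart R N2 n)
  : chart R M (m + n) :=
  Chart (W `&` f @^-1` cdom c `&` g @^-1` cdom d)
        (fun p => row_mx (cmap c (f p)) (cmap d (g p))).

End Charts.

Definition line_chart (R : realType) : chart R R 1 :=
  Chart setT (fun t => t%:M).
Arguments line_chart : clear implicits.

(** [H] is the whole of R^n (no boundary) or the half-space. *)
Record manifold (R : realType) (n : nat) (H : set 'rV[R]_n) := Manifold {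
  carrier :> topologicalType;
  atlas : set (chart R carrier n);
  manifold_hausdorff : hausdorff_space carrier;
  manifold_second_countable : @second_countable carrier;
  atlas_chart : forall c, atlas c -> is_chart H c;
  atlas_cover : forall p, exists2 c, atlas c & cdom c p;
  atlas_compatible : forall c d, atlas c -> atlas d -> transition_smooth c d }.
Arguments atlas {R n H} m.

Notation manifold_without_boundary R n := (@manifold R n [set: 'rV[R]_n]).
Notation manifold_with_boundary R n := (@manifold R n.+1 (halfspace R n)).

Definition boundary (R : realType) (n : nat) (M : manifold_with_boundary R n)
  : set M :=
  [set p | exists c, [/\ atlas M c, cdom c p & cmap c p ord0 ord0 = 0]].
Arguments boundary {R n} M.

(** [c] belongs to the maximal atlas of [M]. Its dimension [k] is not required
    to be syntactically that of [M]. *)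
Definition smooth_chart (R : realType) (n k : nat) (H : set 'rV[R]_n)
    (M : manifold H) (H' : set 'rV[R]_k) (c : chart R M k) : Prop :=
  is_chart H' c /\
  forall d, atlas M d -> transition_smooth c d /\ transition_smooth d c.

(** * Tangent vectors *)

(** Tangent vectors at [p] are operators on functions, depending only on germs
    of smooth functions. They take the value 0 on functions that are not
    smooth near [p], so that two tangent vectors are equal as soon as they
    agree on smooth germs. *)
Definition tvec (R : realType) (M : Type) : lmodType R := ((M -> R) -> R^o).

Section Tangent.
Context {R : realType} {n : nat} {H : set 'rV[R]_n} {M : manifold H}.

Definition smooth_at (p : M) (f : M -> R) : Prop :=
  exists2 c, atlas M c & smooth_in_chart c p f.

Definition on_germs (p : M) (v : tvec R M) : tvec R M :=
  fun f => if `[< smooth_at p f >] then v f else 0.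

(** The tangent space [T_p M]: derivatives along a vector [a] in a chart. At a
    boundary point, [a] may point in any direction. *)
Definition tangent (p : M) : set (tvec R M) :=
  [set v | (forall f, ~ smooth_at p f -> v f = 0) /\
     exists c, [/\ atlas M c, cdom c p &
       exists a : 'rV[R]_n, forall (f : M -> R) (F : 'rV[R]_n -> R),
         smooth_near (cmap c p) F ->
         (\forall q \near p, f q = F (cmap c q)) ->
         v f = 'D_a F (cmap c p)]].

(** [X] restricts to a smooth section of the subbundle [E] of [TM] on some
    neighbourhood of [p]. *)
Definition section_near (E : M -> set (tvec R M)) (p : M) (X : M -> tvec R M)
  : Prop :=
  \forall q \near p, E q (X q) /\
    forall f, smooth_at q f -> smooth_at q (fun q' => X q' f).

Definition vfield_near := section_near tangent.

Definition lie_bracket (X Y : M -> tvec R M) (p : M) : tvec R M :=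
  on_germs p (fun f => X p (fun q => Y q f) - Y p (fun q => X q f)).

(** * Symmetric forms and metrics on a subbundle [E] of [TM] over [O] *)

Definition symmetric_form (O : set M) (E : M -> set (tvec R M))
    (a : M -> tvec R M -> tvec R M -> R) : Prop :=
  [/\ forall p u v, O p -> E p u -> E p v -> a p u v = a p v u,
      forall p (k : R) u v w, O p -> E p u -> E p v -> E p w ->
        a p (k *: u + v) w = k * a p u w + a p v w &
      forall p X Y, O p -> section_near E p X -> section_near E p Y ->
        smooth_at p (fun q => a q (X q) (Y q))].

Definition bundle_metric (O : set M) (E : M -> set (tvec R M))
    (g : M -> tvec R M -> tvec R M -> R) : Prop :=
  symmetric_form O E g /\
  forall p v, O p -> E p v -> v <> 0 -> 0 < g p v v.

Definition riemannian_metric (O : set M) := bundle_metric O tangent.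

(** * Connections *)

(** [D p v Y] is the covariant derivative at [p] of the vector field [Y] along
    the tangent vector [v]. *)
Definition covariant_derivative : Type :=
  M -> tvec R M -> (M -> tvec R M) -> tvec R M.

(** [D] is a smooth connection on [TM] over the open set [O]. *)
Definition connection (O : set M) (D : covariant_derivative) : Prop :=
  [/\ forall p v Y Z, O p -> tangent p v ->
        vfield_near p Y -> (\forall q \near p, Y q = Z q) ->
        D p v Y = D p v Z,
      forall p (k : R) u v Y, O p -> tangent p u -> tangent p v ->
        vfield_near p Y -> D p (k *: u + v) Y = k *: D p u Y + D p v Y,
      forall p v Y Z, O p -> tangent p v ->
        vfield_near p Y -> vfield_near p Z ->
        D p v (fun q => Y q + Z q) = D p v Y + D p v Z,
      forall p v (f : M -> R) Y, O p -> tangent p v ->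
        smooth_at p f -> vfield_near p Y ->
        D p v (fun q => f q *: Y q) = v f *: Y p + f p *: D p v Y &
      forall p X Y, O p -> vfield_near p X -> vfield_near p Y ->
        vfield_near p (fun q => D q (X q) Y)].

Definition levi_civita (O : set M) (g : M -> tvec R M -> tvec R M -> R)
    (D : covariant_derivative) : Prop :=
  [/\ connection O D,
      forall p X Y, O p -> vfield_near p X -> vfield_near p Y ->
        D p (X p) Y - D p (Y p) X = lie_bracket X Y p &
      forall p v Y Z, O p -> tangent p v ->
        vfield_near p Y -> vfield_near p Z ->
        v (fun q => g q (Y q) (Z q)) = g p (D p v Y) (Z p) + g p (Y p) (D p v Z)].

End Tangent.
Arguments covariant_derivative {R n H} M.

Definition differential (R : realType) (m n : nat) (H : set 'rV[R]_m)
    (H' : set 'rV[R]_n) (M : manifold H) (N : manifold H') (f : M -> N) (p : M)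
    (v : tvec R M) : tvec R N :=
  on_germs (f p) (fun h => v (h \o f)).

(** * Edge manifolds *)

(** Over a neighbourhood [V] of each point, [(pi, tau)] is a diffeomorphism from
    [pi @^-1` V] onto [V * Z]: it is onto, and the product charts of [V * Z],
    composed with it, are smooth charts of [N] (in particular it is injective). *)
Definition locally_trivial_fibration (R : realType) (n b : nat)
    (N : manifold_without_boundary R n) (B : manifold_without_boundary R b)
    (pi : N -> B) : Prop :=
  forall b0 : B, exists V : set B, [/\ open V, V b0 &
    exists (k : nat) (Z : manifold_without_boundary R k) (tau : N -> Z),
      (forall b1 z, V b1 -> exists2 y, pi y = b1 & tau y = z) /\
      forall c d, atlas B c -> atlas Z d ->
        smooth_chart [set: 'rV[R]_(b + k)]
          (pair_chart (pi @^-1` V) pi c tau d)].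

Definition vertical_bundle (R : realType) (n b : nat)
    (N : manifold_without_boundary R n) (B : manifold_without_boundary R b)
    (pi : N -> B) (y : N) : set (tvec R N) :=
  [set v | tangent y v /\ differential pi y v = 0].

(** An Ehresmann connection, given by its vertical projection [P]: the splitting
    is [T_y N = V_y N (+) ker P_y], and [ker P] is isomorphic to [pi^* TB]
    through the differential of [pi]. *)
Definition ehresmann_connection (R : realType) (n b : nat)
    (N : manifold_without_boundary R n) (B : manifold_without_boundary R b)
    (pi : N -> B) (P : N -> tvec R N -> tvec R N) : Prop :=
  [/\ forall y v, tangent y v -> vertical_bundle pi y (P y v),
      forall y v, vertical_bundle pi y v -> P y v = v,
      forall y (k : R) u v, tangent y u -> tangent y v ->
        P y (k *: u + v) = k *: P y u + P y v &
      forall y X, vfield_near y X -> vfield_near y (fun q => P q (X q))].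

(** [N] is identified with the boundary of [M] through [kappa 0], and the collar
    [U] with [(-eps, 0] * N] through [kappa], of inverse [(r, rho)]; that this is
    a diffeomorphism is stated, as for fibrations, through product charts. The
    function [r] only matters on [U]. *)
Record edge_manifold (R : realType) (n b : nat) := EdgeManifold {
  em_M :> manifold_with_boundary R n;
  em_N : manifold_without_boundary R n;
  em_B : manifold_without_boundary R b;
  em_compact : compact [set: em_M];
  em_pi : em_N -> em_B;
  em_fibration : locally_trivial_fibration em_pi;
  em_P : em_N -> tvec R em_N -> tvec R em_N;
  em_ehresmann : ehresmann_connection em_pi em_P;
  em_eps : R;
  em_eps_gt0 : 0 < em_eps;
  em_kappa : R -> em_N -> em_M;
  em_r : em_M -> R;
  em_rho : em_M -> em_N;
  em_rK : forall t y, - em_eps < t <= 0 -> em_r (em_kappa t y) = t;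
  em_rhoK : forall t y, - em_eps < t <= 0 -> em_rho (em_kappa t y) = y;
  em_boundary : boundary em_M = range (em_kappa 0);
  em_collar_chart : forall c, atlas em_N c ->
    smooth_chart (halfspace R n)
      (pair_chart [set p | exists t y, - em_eps < t <= 0 /\ em_kappa t y = p]
         em_r (line_chart R) em_rho c) }.

Arguments em_pi {R n b} e.
Arguments em_P {R n b} e.
Arguments em_eps {R n b} e.
Arguments em_kappa {R n b} e.
Arguments em_r {R n b} e.
Arguments em_rho {R n b} e.

Section Edge.
Context {R : realType} {n b : nat} (E : edge_manifold R n b).

Definition collar : set E :=
  [set p | exists t y, - em_eps E < t <= 0 /\ em_kappa E t y = p].

Definition collar_interior : set E := collar `\` boundary E.

(** The component in [VN] of the image of [v] in [TN]. *)
Definition vert (p : E) (v : tvec R E) : tvec R (em_N E) :=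
  em_P E (em_rho E p) (differential (em_rho E) p v).

(** The component of [v] in [F], for the splitting [TM = F (+) F'] on the collar:
    [VN] is embedded in [TM] along the slices [r = const]. *)
Definition fpart (p : E) (v : tvec R E) : tvec R E :=
  differential (em_kappa E (em_r E p)) (em_rho E p) (vert p v).

Definition phi (p : E) (v : tvec R E) : tvec R E :=
  em_r E p *: fpart p v + (v - fpart p v).

Definition phi_inv (p : E) (v : tvec R E) : tvec R E :=
  (em_r E p)^-1 *: fpart p v + (v - fpart p v).

Definition phi_form (g : E -> tvec R E -> tvec R E -> R) (p : E)
    (v w : tvec R E) : R :=
  g p (phi_inv p v) (phi_inv p w).

Definition phi_conj (D : covariant_derivative E) : covariant_derivative E :=
  fun p v Y => phi p (D p v (fun q => phi_inv q (Y q))).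

(** [dr^2 + r^2 gV + pi^* gB]. *)
Definition model_metric
    (gV : em_N E -> tvec R (em_N E) -> tvec R (em_N E) -> R)
    (gB : em_B E -> tvec R (em_B E) -> tvec R (em_B E) -> R)
    (p : E) (v w : tvec R E) : R :=
  v (em_r E) * w (em_r E)
  + em_r E p ^+ 2 * gV (em_rho E p) (vert p v) (vert p w)
  + let dpi := differential (em_pi E \o em_rho E) p in
    gB (em_pi E (em_rho E p)) (dpi v) (dpi w).

Definition perturbation (k : nat) (g gt : E -> tvec R E -> tvec R E -> R)
  : Prop :=
  riemannian_metric (~` boundary E) gt /\
  exists2 alpha, symmetric_form collar tangent alpha &
    forall p v w, collar_interior p -> tangent p v -> tangent p w ->
      phi_form gt p v w = phi_form g p v w + em_r E p ^+ k * alpha p v w.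

(** [D] is a smooth connection over the whole collar extending [D0]. *)
Definition smooth_extension (D0 D : covariant_derivative E) : Prop :=
  connection collar D /\
  forall p v Y, collar_interior p -> tangent p v -> vfield_near p Y ->
    D p v Y = D0 p v Y.

End Edge.
Arguments collar {R n b} E.
Arguments collar_interior {R n b} E.

(* Main.v *)
(** In a local frame [e_i] of the collar, write [s_i = r] if [e_i] is vertical
    and [s_i = 1] otherwise, so that [phi e_i = s_i e_i]. The connection
    [phi nabla phi^-1] is compatible with [h = g^phi], and the Koszul formula for
    the fields [e_i / s_i] gives [2 h(phi nabla_(e_i) phi^-1 e_j, e_l)] as an
    expression [K(h)], linear in [h] and its first derivatives, whose
    coefficients have at most simple poles at [r = 0].

    Choose the frame adapted to the fibration: [d/dr], horizontal lifts of
    coordinate fields of [B], and vertical fields. All brackets are then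
    vertical, and the coefficients of the model metric vanish on mixed pairs and
    are killed by vertical derivatives on pairs of non-vertical fields. These
    facts make all poles of [K(h)] cancel for the model metric. A
    perturbation [r a] contributes [K(r a) = r K(a) + (terms in a)], which is
    smooth, and [r^2 a = r (r a)] contributes a multiple of [r], which vanishes
    on the boundary. Since [h] is nondegenerate up to [r = 0], the Christoffel
    symbols of [phi nabla phi^-1] have the same properties. *)

Require Import Defs.
From mathcomp Require Import all_boot all_order all_algebra.
From mathcomp Require Import all_classical all_reals all_analysis.
From mathcomp Require Import ring lra.

Set Implicit Arguments.
Unset Strict Implicit.
Unset Printing Implicit Defensive.

Import Order.TTheory GRing.Theory Num.Theory.
Import numFieldNormedType.Exports.
Local Open Scope classical_set_scope.
Local Open Scope ring_scope.

(** * Smooth functions on R^n *)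

(** The conjugated connections exist only off the boundary, so functions built from them are
    controlled only there: [regular] asks for a smooth function agreeing with the given one in the
    interior, and density of the interior makes its boundary values unambiguous. The extended
    connection is a limit, and its existence reduces to regularity of the Christoffel symbols in one
    adapted frame. Two facts about the normal field [e i0] control the poles: it is the only frame
    field along which [r] is not constant, and it is not vertical, so its scale is 1. Hence whenever
    a scale is differentiated, the inverse scale of the differentiating field is 1, which keeps all
    poles simple; and differentiating the factor [r] in [r a] creates no pole. The Christoffel
    symbols are not linear in the metric: those of [gt] come multiplied by the perturbed
    coefficients. For the second-order comparison they are already known to be regular from the
    first-order case, so their product with [r^2 a] is moved to the right-hand side, and the
    difference of the symbols is solved for with the model matrix alone. *)

Section Calculus.
Context {R : realType}.

Lemma near_eq_differentiable (V W : normedModType R) (f g : V -> W) (x : V) :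
  (\forall y \near x, f y = g y) -> differentiable f x -> differentiable g x.
Proof.
move=> fg df; have [dfc Hf] := (diff_locallyP x f).1 df.
have fgx : f x = g x by exact: nbhs_singleton fg.
have Hg : g \o shift x = cst (g x) + 'd f x +o_ 0 id.
  apply/eqaddoP => _/posnumP[e].
  have /eqaddoP/(_ _ (gt0 e)) := Hf.
  apply: filter_app.
  have : \forall h \near (0:V), f (h + x) = g (h + x).
    have := fg; rewrite (near_shift 0 x) /=; apply: filter_app; near=> h.
    by rewrite subr0.
  by apply: filter_app; near=> h => /= E H; move: H; rewrite !fctE /= E fgx.
apply/diff_locallyP.
have -> : 'd g x = 'd f x :> (V -> W) by exact: diff_unique.
by [].
Unshelve. all: by end_near. Qed.

Lemma row_coords (n : nat) (u : 'rV[R]_n) : u = \sum_j u ord0 j *: 'e_j.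
Proof. by rewrite [LHS]row_sum_delta. Qed.

Lemma cvg_rows (T : Type) (F : set_system T) (FF : Filter F) m
    (G : T -> 'rV[R]_m) (l : 'rV[R]_m) :
  (forall j, G y ord0 j @[y --> F] --> l ord0 j) -> G @ F --> l.
Proof.
move=> HG; rewrite [l in _ --> l]row_coords.
have -> : G = \sum_(j < m) (fun y => G y ord0 j *: 'e_j).
  by apply/funext => y; rewrite fct_sumE -row_coords.
apply: (big_ind2 (fun (f : T -> 'rV[R]_m) a => f @ F --> a)).
- exact: cvg_cst.
- by move=> f a g b Hf Hg; exact: cvgD.
- by move=> j _; apply: cvgZr_tmp; exact: HG.
Qed.

Lemma derive_linear_comb n (F : 'rV[R]_n -> R) x (u : 'rV[R]_n) :
  differentiable F x -> 'D_u F x = \sum_j u ord0 j * 'D_('e_j) F x.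
Proof.
move=> dF; rewrite deriveE // {1}(row_coords u) linear_sum; apply: eq_bigr => j _.
by rewrite linearZ /= deriveE.
Qed.

Lemma differentiable_rows m n (G : 'rV[R]_n -> 'rV[R]_m) x :
  (forall j, differentiable (fun y => G y ord0 j) x) -> differentiable G x.
Proof.
move=> dG.
have -> : G = \sum_(j < m) (fun y => G y ord0 j *: 'e_j).
  by apply/funext => y; rewrite fct_sumE -row_coords.
by apply: differentiable_sum => j; exact: differentiableZl.
Qed.

Lemma derive_coord n (x v : 'rV[R]_n) j :
  'D_v (fun y : 'rV[R]_n => y ord0 j) x = v ord0 j.
Proof.
rewrite deriveE; last exact: differentiable_coord.
have @f : {linear 'rV[R]_n -> R}.
  by exists (fun N : 'rV[R]_n => N ord0 j); do 2![eexists]; do ?[constructor];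
     rewrite ?mxE// => ? *; rewrite ?mxE//; move=> ?; rewrite !mxE.
rewrite (_ : (fun N : 'rV[R]_n => _) = f) // diff_lin //.
exact: coord_continuous.
Qed.

Lemma derive_rows m n (G : 'rV[R]_n -> 'rV[R]_m) x v j :
  (forall j, differentiable (fun y => G y ord0 j) x) ->
  ('D_v G x) ord0 j = 'D_v (fun y => G y ord0 j) x.
Proof.
move=> dG; have dGx := differentiable_rows dG.
have dc := @differentiable_coord R 1 m (G x) ord0 j.
rewrite deriveE // [RHS]deriveE //.
rewrite (@diff_comp R _ _ _ G (fun N : 'rV[R]_m => N ord0 j)) //=.
by rewrite -[RHS](deriveE _ dc) derive_coord.
Qed.

Lemma derive_comp_rows m n (F : 'rV[R]_m -> R) (G : 'rV[R]_n -> 'rV[R]_m) x v :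
  (forall j, differentiable (fun y => G y ord0 j) x) -> differentiable F (G x) ->
  differentiable (F \o G) x /\
  'D_v (F \o G) x = \sum_j 'D_v (fun y => G y ord0 j) x * 'D_('e_j) F (G x).
Proof.
move=> dG dF; have dGx := differentiable_rows dG.
have dFG : differentiable (F \o G) x by exact: differentiable_comp.
split=> //; rewrite deriveE // diff_comp //= -!deriveE //.
rewrite derive_linear_comb //; apply: eq_bigr => j _.
by rewrite derive_rows.
Qed.

Lemma Ck_cont n k (O : set 'rV[R]_n) F : Ck k O F ->
  forall x, O x -> {for x, continuous F}.
Proof.
case: k => [//|k] /= [dF _] x Ox; exact: differentiable_continuous (dF x Ox).
Qed.

Lemma CkW n k (O : set 'rV[R]_n) F : Ck k.+1 O F -> Ck k O F.
Proof.
elim: k F => [|k IH] F; first by move=> H x; exact: (Ck_cont H).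
by move=> [dF DF]; split=> // v; exact: IH.
Qed.

Lemma Ck_sub n k (O O' : set 'rV[R]_n) F : O' `<=` O -> Ck k O F -> Ck k O' F.
Proof.
move=> OO; elim: k F => [|k IH] F /=; first by move=> H x /OO; exact: H.
by move=> [dF DF]; split=> [x /OO|v]; [exact: dF|exact: IH].
Qed.

Lemma Ck_eq n k (O : set 'rV[R]_n) F G : open O ->
  (forall x, O x -> F x = G x) -> Ck k O F -> Ck k O G.
Proof.
move=> oO; elim: k F G => [|k IH] F G FG /=.
  move=> H x Ox; have FGx : \forall y \near x, F y = G y.
    by apply: filterS (open_nbhs_nbhs (conj oO Ox)) => y; exact: FG.
  rewrite /prop_for /continuous_at -(nbhs_singleton FGx).
  exact: cvg_trans (near_eq_cvg FGx) (H x Ox).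
move=> [dF DF]; split=> [x Ox|v].
  apply: near_eq_differentiable (dF x Ox).
  by apply: filterS (open_nbhs_nbhs (conj oO Ox)) => y; exact: FG.
apply: IH (DF v) => x Ox; apply: near_eq_derive.
by apply: filterS (open_nbhs_nbhs (conj oO Ox)) => y; exact: FG.
Qed.

Lemma Ck_cst n k (O : set 'rV[R]_n) (c : R) : Ck k O (cst c).
Proof.
elim: k c => [|k IH] c /=; first by move=> x _; exact: cst_continuous.
split=> [x _|v]; first exact: differentiable_cst.
have -> : 'D_v (cst c : 'rV[R]_n -> R) = cst 0.
  by apply/funext => x; exact: derive_cst.
exact: IH.
Qed.

Lemma CkD n k (O : set 'rV[R]_n) F G : open O ->
  Ck k O F -> Ck k O G -> Ck k O (fun x => F x + G x).
Proof.
move=> oO; elim: k F G => [|k IH] F G /=.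
  by move=> H K x Ox; exact: (cvgD (H x Ox) (K x Ox)).
move=> [dF DF] [dG DG]; split=> [x Ox|v].
  by apply: differentiableD; [exact: dF|exact: dG].
apply: Ck_eq (IH _ _ (DF v) (DG v)) => // x Ox.
by rewrite -deriveD //; apply: diff_derivable; [exact: dF|exact: dG].
Qed.

Lemma CkM n k (O : set 'rV[R]_n) F G : open O ->
  Ck k O F -> Ck k O G -> Ck k O (fun x => F x * G x).
Proof.
move=> oO; elim: k F G => [|k IH] F G.
  by move=> /= H K x Ox; exact: (cvgM (H x Ox) (K x Ox)).
move=> HF HG; have HF' := CkW HF; have HG' := CkW HG.
case: HF => dF DF; case: HG => dG DG; split=> [x Ox|v].
  by apply: differentiableM; [exact: dF|exact: dG].
apply: Ck_eq (CkD oO (IH _ _ HF' (DG v)) (IH _ _ HG' (DF v))) => // x Ox.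
by rewrite [RHS](@deriveM _ _ F G) //;
  apply: diff_derivable; [exact: dF|exact: dG].
Qed.

(** The derivative is [- F' / F^2], in which [1 / F] is needed one order lower only, so the
    induction on [k] closes. *)
Lemma CkV n k (O : set 'rV[R]_n) F : open O -> (forall x, O x -> F x != 0) ->
  Ck k O F -> Ck k O (fun x => (F x)^-1).
Proof.
move=> oO F0; elim: k => [|k IH].
  by move=> /= H x Ox; exact: (cvgV (F0 x Ox) (H x Ox)).
move=> HF; have HF' := CkW HF; have HI := IH HF'.
case: HF => dF DF; split=> [x Ox|v].
  by apply: differentiableV; [exact: dF|exact: F0].
apply: Ck_eq (CkM oO (Ck_cst _ O (-1)) (CkM oO (CkM oO HI HI) (DF v))) => // x Ox.
rewrite [RHS](@deriveV _ _ F) /=; last 2 first.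
- exact: F0.
- by apply: diff_derivable; exact: dF.
by rewrite /GRing.scale /= -exprVn expr2; ring.
Qed.

Lemma Ck_sum n k (O : set 'rV[R]_n) (I : finType) (F : I -> 'rV[R]_n -> R) :
  open O -> (forall i, Ck k O (F i)) -> Ck k O (fun x => \sum_i F i x).
Proof.
move=> oO HF.
have -> : (fun x => \sum_i F i x) = \sum_i F i.
  by apply/funext => x; rewrite fct_sumE.
elim/big_ind : _ => //; first exact: Ck_cst.
by move=> f g; exact: CkD.
Qed.

Lemma Ck_proj n k (O : set 'rV[R]_n) j : Ck k O (fun x => x ord0 j).
Proof.
case: k => [|k] /=; first by move=> x _; exact: coord_continuous.
split=> [x _|v]; first exact: differentiable_coord.
have -> : 'D_v (fun x : 'rV[R]_n => x ord0 j) = cst (v ord0 j).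
  by apply/funext => x; exact: derive_coord.
exact: Ck_cst.
Qed.

(** By the chain rule the derivative is a sum of products of a derivative of [G] with a partial
    derivative of [F] composed with [G]. The induction is over all [F], so that it applies to these
    partial derivatives. *)
Lemma Ck_comp m n k (O : set 'rV[R]_n) (O' : set 'rV[R]_m) F
    (G : 'rV[R]_n -> 'rV[R]_m) : open O ->
  (forall x, O x -> O' (G x)) -> Ck k O' F ->
  (forall j, Ck k O (fun x => G x ord0 j)) -> Ck k O (F \o G).
Proof.
move=> oO OO; elim: k F => [|k IH] F.
  move=> /= HF HG x Ox.
  have cG : {for x, continuous G}.
    by apply: (@cvg_rows _ (nbhs x)) => j; exact: HG.
  apply: continuous_comp => //; exact: HF (OO _ Ox).
move=> HF HG; have HG' j := CkW (HG j); case: (HF) => dF DF.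
split=> [x Ox|v].
  by apply: (derive_comp_rows 0 (fun j => (HG j).1 x Ox) _).1; exact/dF/OO.
pose S x := \sum_j 'D_v (fun y => G y ord0 j) x * ('D_('e_j) F \o G) x.
have : Ck k O S.
  by apply: Ck_sum => // j; apply: CkM => //;
    [exact: (HG j).2|exact: IH (DF _) HG'].
apply: Ck_eq => // x Ox; rewrite /S.
rewrite (derive_comp_rows v (fun j => (HG j).1 x Ox) _).2 //.
exact/dF/OO.
Qed.


Section SmoothNear.
Context {n : nat}.
Implicit Types (x : 'rV[R]_n) (F G : 'rV[R]_n -> R).

Lemma smooth_near_cst x c : smooth_near x (cst c).
Proof. by exists setT; split=> // [|k]; [exact: openT|exact: Ck_cst]. Qed.

Lemma smooth_near_proj x j : smooth_near x (fun y => y ord0 j).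
Proof. by exists setT; split=> // [|k]; [exact: openT|exact: Ck_proj]. Qed.

Lemma smooth_nearD x F G : smooth_near x F -> smooth_near x G ->
  smooth_near x (fun y => F y + G y).
Proof.
move=> [ O [oO Ox HF]] [ O' [oO' O'x HG]]; exists (O `&` O').
split=> [|//|k]; first exact: openI.
by apply: CkD; [exact: openI|exact: Ck_sub (HF k)|exact: Ck_sub (HG k)].
Qed.

Lemma smooth_nearM x F G : smooth_near x F -> smooth_near x G ->
  smooth_near x (fun y => F y * G y).
Proof.
move=> [ O [oO Ox HF]] [ O' [oO' O'x HG]]; exists (O `&` O').
split=> [|//|k]; first exact: openI.
by apply: CkM; [exact: openI|exact: Ck_sub (HF k)|exact: Ck_sub (HG k)].
Qed.

Lemma smooth_near_open x F : smooth_near x F ->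
  \forall y \near x, smooth_near y F.
Proof.
move=> [ O [oO Ox HF]]; apply: filterS (open_nbhs_nbhs (conj oO Ox)) => y Oy.
by exists O.
Qed.

Lemma smooth_near_diff x F : smooth_near x F -> differentiable F x.
Proof. by move=> [ O [oO Ox /(_ 1)[dF _]]]; exact: dF. Qed.

Lemma smooth_near_cont x F : smooth_near x F -> {for x, continuous F}.
Proof. by move=> /smooth_near_diff; exact: differentiable_continuous. Qed.

Lemma smooth_near_derive x v F : smooth_near x F -> smooth_near x ('D_v F).
Proof. by move=> [ O [oO Ox HF]]; exists O; split=> // k; exact: (HF k.+1).2. Qed.

Lemma smooth_nearV x F : F x != 0 -> smooth_near x F ->
  smooth_near x (fun y => (F y)^-1).
Proof.
move=> F0 sF; have cF := smooth_near_cont sF.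
have : \forall y \near x, F y != 0.
  exact: (cF _ (open_nbhs_nbhs (conj (@open_neq R 0) F0))).
move: sF => [ O [oO Ox HF]] nF0.
(* Outside [O] the function [F] is arbitrary, so the set where it does not vanish need not be open;
   its interior still contains [x]. *)
have oF0 : open [set y | F y != 0]^° by exact: open_interior.
exists (O `&` [set y | F y != 0]^°); split=> [|//|k]; first exact: openI.
apply: CkV; first exact: openI.
  by move=> y [_ /interior_subset].
exact: Ck_sub (HF k).
Qed.

Lemma smooth_near_comp m x (F : 'rV[R]_m -> R) (G : 'rV[R]_n -> 'rV[R]_m) :
  (forall j, smooth_near x (fun y => G y ord0 j)) -> smooth_near (G x) F ->
  smooth_near x (F \o G).
Proof.
move=> sG [ O' [oO' O'x HF]].
have /choice[ O HO] : forall j, exists O, [/\ open O, O x & forall k, Ck k O (fun y => G y ord0 j)].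
  by move=> j; exact: sG.
pose Oj := [set y | O' (G y) /\ forall j, O j y].
have Oj_near : \forall y \near x, Oj y.
  apply: filterI.
    have cG : {for x, continuous G}.
      by apply: (@cvg_rows _ (nbhs x)) => j; exact: smooth_near_cont (sG j).
    exact: cG _ (open_nbhs_nbhs (conj oO' O'x)).
  have : \forall y \near x, forall j, O j y; last by [].
  apply: (@filter_forall _ _ (fun j => O j) (nbhs x)) => j; have [oOj Ojx _] := HO j.
  exact: open_nbhs_nbhs.
exists Oj^°; split=> // [|k]; first exact: open_interior.
apply: (@Ck_comp _ _ _ _ O') => //; first exact: open_interior.
  by move=> y /interior_subset[].
move=> j; have [_ _ HOj] := HO j; apply: Ck_sub (HOj k).
by move=> y /interior_subset[].
Qed.

End SmoothNear.

(** * First derivatives at points of the model space *)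

Section Solid.

(** Ensures that first derivatives at points of [H] only depend on values in [H]. *)
Definition solid n (H : set 'rV[R]_n) := forall x a, H x ->
  exists2 s : R, s != 0 & forall t, 0 <= t -> H ((t * s) *: a + x).

Lemma solidT n : solid [set: 'rV[R]_n].
Proof. by move=> x a _; exists 1 => //; exact: oner_neq0. Qed.

(** One of the two rays from [x] along [a] and [-a] stays in the half-space; [s] is the sign that
    selects it. *)
Lemma solid_halfspace n : solid (halfspace R n).
Proof.
move=> x a; rewrite /halfspace /= => Hx.
have [a0|a0] := leP (a ord0 ord0) 0.
  exists 1 => // t t0; rewrite !mxE mulr1; have := mulr_ge0_le0 t0 a0; lra.
exists (-1) => [|t t0]; first by rewrite oppr_eq0 oner_eq0.
rewrite !mxE mulrN1 mulNr; have := mulr_ge0 t0 (ltW a0); lra.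
Qed.

(** Along the ray that stays in [H] the difference quotients vanish near 0, so the right-hand limit
    computes the derivative along [s *: a] as 0. Linearity in the direction then removes [s]. *)
Lemma solid_derive_eq0 n (H : set 'rV[R]_n) x a (F : 'rV[R]_n -> R) :
  solid H -> H x -> differentiable F x ->
  (\forall y \near x, H y -> F y = 0) -> 'D_a F x = 0.
Proof.
move=> sH Hx dF F0; have [s s0 Hs] := sH x a Hx.
have D0 : 'D_(s *: a) F x = 0.
  have : derivable F x (s *: a) by exact: diff_derivable.
  rewrite /derivable /derive => /cvg_at_rightE ->.
  apply: cvg_lim => //; apply: (@cvg_trans _ ((fun _ : R => 0) @ 0^'+)).
    apply: near_eq_cvg.
    have nF : \forall h \near (0:R), H (h *: (s *: a) + x) -> F (h *: (s *: a) + x) = 0.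
      have c : (h *: (s *: a) + x) @[h --> (0:R)] --> x.
        rewrite -{2}(add0r x) -(scale0r (s *: a)); apply: cvgD; last exact: cvg_cst.
        by apply: cvgZr_tmp; exact: cvg_id.
      exact: c _ F0.
    have Fx : F x = 0 by exact: nbhs_singleton F0 Hx.
    near=> h; rewrite /= Fx subr0.
    suff -> : F (h *: (s *: a) + x) = 0 by rewrite scaler0.
    by near: h; move: nF; apply: filterS => h Hh h0; apply: Hh; rewrite scalerA; apply: Hs; exact: ltW.
  exact: cvg_cst.
have /eqP := D0; rewrite deriveE // linearZ /= -deriveE // scaler_eq0 (negbTE s0).
by move=> /eqP.
Unshelve. all: by end_near. Qed.

End Solid.
End Calculus.

(** * Smooth functions on manifolds *)

Section Manifolds.
Context {R : realType} {n : nat} {H : set 'rV[R]_n} {M : manifold H}.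
Implicit Types (p q : M) (f g : M -> R).

Lemma atlas_smooth_chart c : atlas M c -> smooth_chart H c.
Proof.
move=> Mc; split=> [|d Md]; first exact: atlas_chart Mc.
by split; exact: atlas_compatible.
Qed.

Lemma smooth_in_chart_rows k (c : chart R M k) p m (x : M -> 'rV[R]_m) :
  (forall j, smooth_in_chart c p (fun q => x q ord0 j)) ->
  exists2 G : 'rV[R]_k -> 'rV[R]_m,
    forall j, smooth_near (cmap c p) (fun y => G y ord0 j) &
    \forall q \near p, x q = G (cmap c q).
Proof.
move=> sx.
have /choice[X HX] : forall j, exists X, smooth_near (cmap c p) X /\
    \forall q \near p, x q ord0 j = X (cmap c q).
  by move=> j; have [_ [X ? ?]] := sx j; exists X.
exists (fun y => \row_j X j y).
  by move=> j; under eq_fun do rewrite mxE; exact: (HX j).1.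
have : \forall q \near p, forall j, x q ord0 j = X j (cmap c q).
  apply: (@filter_forall _ _ (fun j q => x q ord0 j = X j (cmap c q)) (nbhs p)).
  by move=> j; exact: (HX j).2.
by apply: filterS => q Hq; apply/rowP => j; rewrite Hq mxE.
Qed.

Lemma smooth_in_chart_comp k (c : chart R M k) p m (x : M -> 'rV[R]_m) F f :
  cdom c p ->
  (forall j, smooth_in_chart c p (fun q => x q ord0 j)) ->
  smooth_near (x p) F -> (\forall q \near p, f q = F (x q)) ->
  smooth_in_chart c p f.
Proof.
move=> cp /smooth_in_chart_rows[G sG xG] sF fF; split=> //; exists (F \o G).
  by apply: smooth_near_comp => //; rewrite -(nbhs_singleton xG).
by apply: filterS2 fF xG => q -> ->.
Qed.

Section SmoothChart.
Context {k : nat} {H' : set 'rV[R]_k} {c : chart R M k}.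
Hypothesis sc : smooth_chart H' c.

Lemma smooth_at_chart p f : cdom c p -> smooth_at p f -> smooth_in_chart c p f.
Proof.
move=> cp [d Md [dp [F sF fF]]].
apply: smooth_in_chart_comp sF fF => // j; exact: (sc.2 d Md).1.
Qed.

Lemma smooth_chart_at p f : smooth_in_chart c p f -> smooth_at p f.
Proof.
move=> [cp [F sF fF]]; have [d Md dp] := atlas_cover p; exists d => //.
apply: smooth_in_chart_comp sF fF => // j; exact: (sc.2 d Md).2.
Qed.

Lemma smooth_at_coord p j : cdom c p -> smooth_at p (fun q => cmap c q ord0 j).
Proof.
move=> cp; apply: smooth_chart_at; split=> //.
exists (fun y => y ord0 j); first exact: smooth_near_proj.
by near=> q.
Unshelve. all: by end_near. Qed.

Lemma chart_cont p : cdom c p -> {for p, continuous (cmap c)}.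
Proof. by have [_ _ + _] := sc.1; apply. Qed.

Lemma chart_dom_near p : cdom c p -> \forall q \near p, cdom c q.
Proof. by have [oc _ _ _] := sc.1 => cp; exact: open_nbhs_nbhs. Qed.

(** Transfers what holds near [p] in [M] to coordinates near [cmap c p]. The restriction to [H' y]
    is essential at the boundary, where the image of a chart is open only relative to the model
    space. *)
Lemma chart_image_near p (W : set M) : cdom c p -> nbhs p W ->
  \forall y \near cmap c p, H' y -> exists q, [/\ W q, cdom c q & cmap c q = y].
Proof.
move=> cp /nbhs_interior nW; have [oc inj _ im] := sc.1.
have oWc : open (W^° `&` cdom c) by apply: openI => //; exact: open_interior.
have [U oU cU] := im _ oWc (@subIsetr _ _ _).
have Up : U (cmap c p).
  have : (cmap c @` (W^° `&` cdom c)) (cmap c p).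
    by exists p => //; split=> //; exact: nbhs_singleton nW.
  by rewrite cU => -[].
apply: filterS (open_nbhs_nbhs (conj oU Up)) => y Uy Hy.
have : (U `&` H') y by [].
by rewrite -cU => -[q [/interior_subset Wq cq] <-]; exists q.
Qed.

Lemma chart_model p : cdom c p -> H' (cmap c p).
Proof.
move=> cp; have [oc _ _ im] := sc.1.
have [U oU cU] := im _ oc (@subset_refl _ _).
have : (cmap c @` cdom c) (cmap c p) by exists p.
by rewrite cU => -[].
Qed.

(** Continuity of the inverse chart: injectivity identifies [f t] with the point of [W] that
    [chart_image_near] provides over its coordinates. *)
Lemma chart_cvg (T : Type) (F : set_system T) (FF : Filter F) (f : T -> M) p :
  cdom c p -> (\forall t \near F, cdom c (f t)) ->
  cmap c (f t) @[t --> F] --> cmap c p -> f @ F --> p.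
Proof.
move=> cp cf fc W nW; have [_ inj _ _] := sc.1.
have := chart_image_near cp nW => nim.
apply: filterS2 cf (fc _ nim) => t cft /= [|q [Wq cq /inj e]].
  exact: chart_model.
by rewrite /preimage /= -(e cq cft).
Qed.

End SmoothChart.

Lemma smooth_at_comp p m (x : M -> 'rV[R]_m) F f :
  (forall j, smooth_at p (fun q => x q ord0 j)) ->
  smooth_near (x p) F -> (\forall q \near p, f q = F (x q)) -> smooth_at p f.
Proof.
move=> sx sF fF; have [c Mc cp] := atlas_cover p; exists c => //.
apply: smooth_in_chart_comp sF fF => // j.
exact: smooth_at_chart (atlas_smooth_chart Mc) _ _ cp (sx j).
Qed.

Lemma smooth_at_eq p f g : (\forall q \near p, f q = g q) ->
  smooth_at p f -> smooth_at p g.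
Proof.
move=> fg [c Mc [cp [F sF fF]]]; exists c => //; split=> //; exists F => //.
by apply: filterS2 fg fF => q ->.
Qed.

Lemma smooth_at_cst p (a : R) : smooth_at p (fun=> a).
Proof.
have [c Mc cp] := atlas_cover p; exists c => //; split=> //.
by exists (cst a); [exact: smooth_near_cst|near=> q].
Unshelve. all: by end_near. Qed.

Lemma smooth_at2 p f g : smooth_at p f -> smooth_at p g ->
  exists c, [/\ atlas M c, cdom c p & exists F G,
    [/\ smooth_near (cmap c p) F, smooth_near (cmap c p) G,
     \forall q \near p, f q = F (cmap c q) & \forall q \near p, g q = G (cmap c q)]].
Proof.
move=> [c Mc [cp [F sF fF]]] sg; exists c; split=> //.
have [_ [G sG gG]] := smooth_at_chart (atlas_smooth_chart Mc) cp sg.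
by exists F, G.
Qed.

Lemma smooth_atD p f g : smooth_at p f -> smooth_at p g ->
  smooth_at p (fun q => f q + g q).
Proof.
move=> sf sg; have [c [Mc cp [F [G [sF sG fF gG]]]]] := smooth_at2 sf sg.
exists c => //; split=> //; exists (fun y => F y + G y); first exact: smooth_nearD.
by apply: filterS2 fF gG => q -> ->.
Qed.

Lemma smooth_atM p f g : smooth_at p f -> smooth_at p g ->
  smooth_at p (fun q => f q * g q).
Proof.
move=> sf sg; have [c [Mc cp [F [G [sF sG fF gG]]]]] := smooth_at2 sf sg.
exists c => //; split=> //; exists (fun y => F y * G y); first exact: smooth_nearM.
by apply: filterS2 fF gG => q -> ->.
Qed.

Lemma smooth_atN p f : smooth_at p f -> smooth_at p (fun q => - f q).
Proof.
move=> sf; apply: smooth_at_eq (smooth_atM (smooth_at_cst p (-1)) sf).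
by near=> q; rewrite mulN1r.
Unshelve. all: by end_near. Qed.

Lemma smooth_atB p f g : smooth_at p f -> smooth_at p g ->
  smooth_at p (fun q => f q - g q).
Proof. by move=> sf sg; apply: smooth_atD => //; exact: smooth_atN. Qed.

Lemma smooth_atV p f : f p != 0 -> smooth_at p f ->
  smooth_at p (fun q => (f q)^-1).
Proof.
move=> f0 [c Mc [cp [F sF fF]]]; exists c => //; split=> //.
exists (fun y => (F y)^-1).
  by apply: smooth_nearV => //; rewrite -(nbhs_singleton fF).
by apply: filterS fF => q ->.
Qed.

Lemma smooth_at_sum p (I : Type) (r : seq I) (P : pred I) (F : I -> M -> R) :
  (forall i, P i -> smooth_at p (F i)) ->
  smooth_at p (fun q => \sum_(i <- r | P i) F i q).
Proof.
move=> HF; have -> : (fun x => \sum_(i <- r | P i) F i x) = \sum_(i <- r | P i) F i.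
  by apply/funext => y; rewrite fct_sumE.
elim/big_ind : _ => //; first exact: smooth_at_cst.
by move=> f g; exact: smooth_atD.
Qed.

Lemma smooth_at_prod p (I : Type) (r : seq I) (P : pred I) (F : I -> M -> R) :
  (forall i, P i -> smooth_at p (F i)) ->
  smooth_at p (fun q => \prod_(i <- r | P i) F i q).
Proof.
move=> HF; elim: r => [|i r IH].
  apply: smooth_at_eq (smooth_at_cst p 1).
  by near=> q; rewrite big_nil.
case Pi : (P i).
  apply: smooth_at_eq (smooth_atM (HF i Pi) IH).
  by near=> q; rewrite big_cons Pi.
apply: smooth_at_eq IH.
by near=> q; rewrite big_cons Pi.
Unshelve. all: by end_near.
Qed.

Lemma smooth_at_near p f : smooth_at p f -> \forall q \near p, smooth_at q f.
Proof.
move=> [c Mc [cp [F sF fF]]]; have sc := atlas_smooth_chart Mc.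
have := chart_cont sc cp (smooth_near_open sF).
have := chart_dom_near sc cp; have := nbhs_interior fF.
apply: filterS3 => q /= fFq cq sFq; exists c => //; split=> //.
by exists F.
Qed.

Lemma smooth_at_near2 p (I J : finType) (h : I -> J -> M -> R) :
  (forall i j, smooth_at p (h i j)) ->
  \forall q \near p, forall i j, smooth_at q (h i j).
Proof.
move=> sh.
apply: (@filter_forall _ _ (fun i q => forall j, smooth_at q (h i j)) (nbhs p)) => i.
apply: (@filter_forall _ _ (fun j q => smooth_at q (h i j)) (nbhs p)) => j.
exact: smooth_at_near.
Qed.

Lemma smooth_at_cont p f : smooth_at p f -> {for p, continuous f}.
Proof.
move=> [c Mc [cp [F sF fF]]]; have sc := atlas_smooth_chart Mc.
have fFp := nbhs_singleton fF.
rewrite /prop_for /continuous_at fFp.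
apply: (@cvg_trans _ ((F \o cmap c) @ p)).
  by apply: near_eq_cvg; apply: filterS fF => q ->.
exact: (continuous_comp (chart_cont sc cp) (smooth_near_cont sF)).
Qed.

Lemma smooth_at_neq0 p f : smooth_at p f -> f p != 0 -> \forall q \near p, f q != 0.
Proof.
move=> /smooth_at_cont cf f0.
exact: (cf _ (open_nbhs_nbhs (conj (@open_neq R 0) f0))).
Qed.

(** * Tangent vectors *)

Lemma tangent0 p v f : tangent p v -> ~ smooth_at p f -> v f = 0.
Proof. by move=> [v0 _]; exact: v0. Qed.

Lemma tangent_comp p v m (x : M -> 'rV[R]_m) F f : tangent p v ->
  (forall j, smooth_at p (fun q => x q ord0 j)) -> smooth_near (x p) F ->
  (\forall q \near p, f q = F (x q)) ->
  v f = \sum_j v (fun q => x q ord0 j) * 'D_('e_j) F (x p).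
Proof.
move=> [_ [c [Mc cp [a Ha]]]] sx sF fF.
have sc := atlas_smooth_chart Mc.
have [G sG xG] := smooth_in_chart_rows (fun j => smooth_at_chart sc cp (sx j)).
have xGp := nbhs_singleton xG; have dG j := smooth_near_diff (sG j).
rewrite (Ha f (F \o G)); last 2 first.
- by apply: smooth_near_comp => //; rewrite -xGp.
- by apply: filterS2 fF xG => q -> ->.
rewrite (derive_comp_rows a dG _).2; last first.
  by apply: smooth_near_diff; rewrite -xGp.
apply: eq_bigr => j _; rewrite -xGp; congr (_ * _).
by apply/esym; apply: Ha => //; apply: filterS xG => q ->.
Qed.

Section TangentChart.
Context {k : nat} {H' : set 'rV[R]_k} {c : chart R M k}.
Hypothesis sc : smooth_chart H' c.

(** By [tangent_comp] a tangent vector is determined by its values on coordinates, so the atlas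
    chart in the definition can be exchanged for any smooth chart. This is what allows the product
    charts of the collar and of the fibration to be used. *)
Lemma tangentP p v : cdom c p -> tangent p v <->
  (forall f, ~ smooth_at p f -> v f = 0) /\
  exists a : 'rV[R]_k, forall f F, smooth_near (cmap c p) F ->
         (\forall q \near p, f q = F (cmap c q)) -> v f = 'D_a F (cmap c p).
Proof.
move=> cp; split=> [tv|[v0 [a Ha]]].
  split=> [f|]; first exact: tangent0.
  exists (\row_j v (fun q => cmap c q ord0 j)) => f F sF fF.
  rewrite (tangent_comp tv _ sF fF) => [|j]; last exact: (smooth_at_coord sc).
  rewrite derive_linear_comb; last exact: smooth_near_diff.
  by apply: eq_bigr => j _; rewrite mxE.
split=> //; have [d Md dp] := atlas_cover p; exists d; split=> //.
have sd := atlas_smooth_chart Md.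
have [G sG xG] := smooth_in_chart_rows
  (fun j => smooth_at_chart sc cp (smooth_at_coord sd j dp)).
have xGp := nbhs_singleton xG; have dG j := smooth_near_diff (sG j).
exists (\row_j 'D_a (fun y => G y ord0 j) (cmap c p)) => f F sF fF.
rewrite (Ha f (F \o G)); last 2 first.
- by apply: smooth_near_comp => //; rewrite -xGp.
- by apply: filterS2 fF xG => q -> ->.
rewrite (derive_comp_rows a dG _).2; last first.
  by apply: smooth_near_diff; rewrite -xGp.
rewrite derive_linear_comb; last exact: smooth_near_diff.
by apply: eq_bigr => j _; rewrite -xGp mxE.
Qed.

Lemma tangent_ext p v w : cdom c p -> tangent p v -> tangent p w ->
  (forall j, v (fun q => cmap c q ord0 j) = w (fun q => cmap c q ord0 j)) ->
  v = w.
Proof.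
move=> cp tv tw vw; apply/funext => f.
have [sf|nsf] := pselect (smooth_at p f); last by rewrite !(tangent0 _ nsf).
have [_ [F sF fF]] := smooth_at_chart sc cp sf.
rewrite (tangent_comp tv _ sF fF) => [|j]; last exact: (smooth_at_coord sc).
rewrite (tangent_comp tw _ sF fF) => [|j]; last exact: (smooth_at_coord sc).
by apply: eq_bigr => j _; rewrite vw.
Qed.

End TangentChart.

Lemma tangent_linear p (a : R) v w : tangent p v -> tangent p w ->
  tangent p (a *: v + w).
Proof.
have [c Mc cp] := atlas_cover p; have sc := atlas_smooth_chart Mc.
move=> /(tangentP sc _ cp)[v0 [d Hd]] /(tangentP sc _ cp)[w0 [e He]].
apply/(tangentP sc _ cp); split=> [f sf|].
  by rewrite !fctE /= v0 // w0 // scaler0 addr0.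
exists (a *: d + e) => f F sF fF.
rewrite !fctE /= (Hd f F) // (He f F) // !deriveE; try exact: smooth_near_diff.
by rewrite linearP.
Qed.

Lemma tangent_zero p : tangent p 0.
Proof.
have [c Mc cp] := atlas_cover p; have sc := atlas_smooth_chart Mc.
apply/(tangentP sc _ cp); split=> //.
by exists 0 => f F sF fF; rewrite derive0.
Qed.

Lemma tangentZ p (a : R) v : tangent p v -> tangent p (a *: v).
Proof.
by move=> tv; rewrite -[_ *: _]addr0; apply: tangent_linear => //; exact: tangent_zero.
Qed.

Lemma tangentD p v w : tangent p v -> tangent p w -> tangent p (v + w).
Proof. by rewrite -[v in v + w]scale1r; exact: tangent_linear. Qed.

Lemma tangentN p v : tangent p v -> tangent p (- v).
Proof. by rewrite -scaleN1r; exact: tangentZ. Qed.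

Lemma tangentB p v w : tangent p v -> tangent p w -> tangent p (v - w).
Proof. by move=> tv /tangentN; exact: tangentD. Qed.

Lemma tangent_sum p (I : Type) (r : seq I) (P : pred I) (v : I -> tvec R M) :
  (forall i, P i -> tangent p (v i)) -> tangent p (\sum_(i <- r | P i) v i).
Proof.
move=> tv; elim/big_ind : _ => //; first exact: tangent_zero.
by move=> *; exact: tangentD.
Qed.

(** The convention that tangent vectors vanish on non-smooth germs lets this rule hold without any
    smoothness assumption. *)
Lemma tangent_eq p v f g : tangent p v -> (\forall q \near p, f q = g q) ->
  v f = v g.
Proof.
move=> tv fg; have [sf|nsf] := pselect (smooth_at p f); last first.
  rewrite !(tangent0 tv) // => sg; apply: nsf; apply: smooth_at_eq sg.
  by apply: filterS fg => q.
have [c Mc cp] := atlas_cover p; have sc := atlas_smooth_chart Mc.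
have [_ [F sF fF]] := smooth_at_chart sc cp sf.
have [_ [a Ha]] := (tangentP sc v cp).1 tv.
rewrite (Ha f F) // (Ha g F) //; by apply: filterS2 fF fg => q -> ->.
Qed.

Lemma tangent_add p v f g : tangent p v -> smooth_at p f -> smooth_at p g ->
  v (fun q => f q + g q) = v f + v g.
Proof.
move=> tv sf sg; have [c [Mc cp [F [G [sF sG fF gG]]]]] := smooth_at2 sf sg.
have [_ [a Ha]] := (tangentP (atlas_smooth_chart Mc) v cp).1 tv.
rewrite (Ha _ (F + G)); last 2 first.
- exact: smooth_nearD.
- by apply: filterS2 fF gG => q -> ->.
rewrite (Ha f F) // (Ha g G) // deriveD //; apply: diff_derivable;
  exact: smooth_near_diff.
Qed.

Lemma tangent_mul p v f g : tangent p v -> smooth_at p f -> smooth_at p g ->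
  v (fun q => f q * g q) = f p * v g + v f * g p.
Proof.
move=> tv sf sg; have [c [Mc cp [F [G [sF sG fF gG]]]]] := smooth_at2 sf sg.
have [_ [a Ha]] := (tangentP (atlas_smooth_chart Mc) v cp).1 tv.
rewrite (Ha _ (F * G)); last 2 first.
- exact: smooth_nearM.
- by apply: filterS2 fF gG => q -> ->.
rewrite (Ha f F) // (Ha g G) // deriveM //; last 2 first.
- by apply: diff_derivable; exact: smooth_near_diff.
- by apply: diff_derivable; exact: smooth_near_diff.
by rewrite (nbhs_singleton fF) (nbhs_singleton gG) /GRing.scale /= [X in _ + X]mulrC.
Qed.

Lemma tangent_cst p v (a : R) : tangent p v -> v (fun=> a) = 0.
Proof.
move=> tv; have [c Mc cp] := atlas_cover p.
have [_ [b Hb]] := (tangentP (atlas_smooth_chart Mc) v cp).1 tv.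
rewrite (Hb _ (cst a)); first exact: derive_cst.
- exact: smooth_near_cst.
- by near=> q.
Unshelve. all: by end_near. Qed.

Lemma tangent_inv p v f : tangent p v -> smooth_at p f -> f p != 0 ->
  v (fun q => (f q)^-1) = - (f p)^-1 ^+ 2 * v f.
Proof.
move=> tv sf f0.
have : v (fun q => f q * (f q)^-1) = 0.
  rewrite (@tangent_eq _ _ _ (fun=> 1) tv) ?(tangent_cst _ tv) //.
  by apply: filterS (smooth_at_neq0 sf f0) => q fq; rewrite mulfV.
rewrite (tangent_mul tv sf (smooth_atV f0 sf)) => /eqP; rewrite addr_eq0 => /eqP e.
apply: (mulfI f0); rewrite e; field.
exact: f0.
Qed.

End Manifolds.

(** * Vector fields and smooth maps *)

Section Fields.
Context {R : realType} {n : nat} {H : set 'rV[R]_n} {M : manifold H}.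
Implicit Types (p q : M) (f g : M -> R) (X Y : M -> tvec R M).

Lemma section_near_near (E : M -> set (tvec R M)) p X : section_near E p X ->
  \forall q \near p, section_near E q X.
Proof. exact: near_join. Qed.

Lemma section_near_eq (E : M -> set (tvec R M)) p X Y :
  (\forall q \near p, X q = Y q) -> section_near E p X -> section_near E p Y.
Proof.
move=> /near_join XY; apply: filterS2 XY => q XYq [EX sX].
rewrite -(nbhs_singleton XYq); split=> // f /sX; apply: smooth_at_eq.
by apply: filterS XYq => q' ->.
Qed.

Lemma vfield_tangent p X : vfield_near p X -> tangent p (X p).
Proof. by move=> /nbhs_singleton[]. Qed.

Lemma vfield_tangent_near p X : vfield_near p X -> \forall q \near p, tangent q (X q).
Proof. by apply: filterS => q []. Qed.

Lemma vfield_smooth p X f : vfield_near p X -> smooth_at p f ->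
  smooth_at p (fun q => X q f).
Proof. by move=> /nbhs_singleton[_]; apply. Qed.

Lemma vfieldD p X Y : vfield_near p X -> vfield_near p Y ->
  vfield_near p (fun q => X q + Y q).
Proof.
apply: filterS2 => q [tX sX] [tY sY]; split; first exact: tangentD.
by move=> f sf; apply: smooth_atD; [exact: sX|exact: sY].
Qed.

Lemma vfieldZ p f X : smooth_at p f -> vfield_near p X ->
  vfield_near p (fun q => f q *: X q).
Proof.
move=> /smooth_at_near; apply: filterS2 => q sf [tX sX].
split; first exact: tangentZ.
by move=> g sg; apply: smooth_atM => //; exact: sX.
Qed.

Lemma vfield0 p : vfield_near p (fun _ : M => 0 : tvec R M).
Proof.
near=> q; split; first exact: tangent_zero.
by move=> f _; exact: smooth_at_cst.
Unshelve. all: by end_near. Qed.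

Lemma vfield_sum p (I : Type) (r : seq I) (P : pred I) (X : I -> M -> tvec R M) :
  (forall i, P i -> vfield_near p (X i)) ->
  vfield_near p (fun q => \sum_(i <- r | P i) X i q).
Proof.
move=> HX; elim: r => [|i r IH].
  apply: section_near_eq (vfield0 p).
  by near=> q; rewrite big_nil.
case Pi : (P i).
  apply: section_near_eq (vfieldD (HX i Pi) IH).
  by near=> q; rewrite big_cons Pi.
apply: section_near_eq IH.
by near=> q; rewrite big_cons Pi.
Unshelve. all: by end_near. Qed.

Lemma vfieldB p X Y : vfield_near p X -> vfield_near p Y ->
  vfield_near p (fun q => X q - Y q).
Proof.
move=> vX vY; apply: section_near_eq (vfieldD vX (vfieldZ (smooth_at_cst p (-1)) vY)).
by near=> q; rewrite scaleN1r.
Unshelve. all: by end_near. Qed.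

(** [d/dx_i] in the chart [c]; well defined up to the boundary because the
    first derivatives of a smooth function are determined by its values on
    the model space. *)
Definition coord_field k (c : chart R M k) (i : 'I_k) (p : M) : tvec R M :=
  on_germs p (fun f =>
    'D_('e_i) (xget (cst 0) [set F | smooth_near (cmap c p) F /\
                   \forall q \near p, f q = F (cmap c q)]) (cmap c p)).

Section Coord.
Context {k : nat} {H' : set 'rV[R]_k} {c : chart R M k}.
Hypotheses (sc : smooth_chart H' c) (sH : solid H').

Lemma coord_fieldE p i f F : cdom c p -> smooth_near (cmap c p) F ->
  (\forall q \near p, f q = F (cmap c q)) ->
  coord_field c i p f = 'D_('e_i) F (cmap c p).
Proof.
move=> cp sF fF; rewrite /coord_field /on_germs.
case: asboolP => [_|]; last first.
  by case; apply: (smooth_chart_at sc); split=> //; exists F.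
case: xgetP => [G _ [sG fG]|/(_ F)]; last by case.
have dF := smooth_near_diff sF; have dG := smooth_near_diff sG.
apply/eqP; rewrite -subr_eq0 -deriveB; last 2 first.
- exact: diff_derivable.
- exact: diff_derivable.
apply/eqP; apply: (solid_derive_eq0 _ sH); first exact: (chart_model sc).
  exact: differentiableB.
have FG : \forall q \near p, F (cmap c q) = G (cmap c q).
  by apply: filterS2 fF fG => q <- <-.
apply: filterS (chart_image_near sc cp FG) => y Hy /Hy[q [FGq _ <-]].
by rewrite !fctE FGq subrr.
Qed.

Lemma coord_field_coord p i j : cdom c p ->
  coord_field c i p (fun q => cmap c q ord0 j) = (j == i)%:R.
Proof.
move=> cp; rewrite (@coord_fieldE _ _ _ (fun y => y ord0 j)) //.
- by rewrite derive_coord mxE eqxx.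
- exact: smooth_near_proj.
- by near=> q.
Unshelve. all: by end_near. Qed.

Lemma coord_field_tangent p i : cdom c p -> tangent p (coord_field c i p).
Proof.
move=> cp; apply/(tangentP sc _ cp); split.
  by move=> f nsf; rewrite /coord_field /on_germs; case: asboolP.
by exists 'e_i => f F sF fF; exact: coord_fieldE.
Qed.

Lemma coord_field_vfield p i : cdom c p -> vfield_near p (coord_field c i).
Proof.
move=> /(chart_dom_near sc); apply: filterS => q cq.
split=> [|f sf]; first exact: coord_field_tangent.
have [_ [F sF fF]] := smooth_at_chart sc cq sf.
apply: (smooth_chart_at sc); split=> //; exists ('D_('e_i) F).
  exact: smooth_near_derive.
have := chart_cont sc cq (smooth_near_open sF).
have := chart_dom_near sc cq; have /near_join := fF.
apply: filterS3 => q' fF' cq' sF'; exact: coord_fieldE.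
Qed.

Lemma tangent_coords p v : cdom c p -> tangent p v ->
  v = \sum_i v (fun q => cmap c q ord0 i) *: coord_field c i p.
Proof.
move=> cp tv; apply: (tangent_ext sc cp tv).
  by apply: tangent_sum => i _; apply: tangentZ; exact: coord_field_tangent.
move=> j; rewrite fct_sumE (bigD1 j) //= big1 => [|i ij].
  by rewrite fctE coord_field_coord // eqxx addr0 /GRing.scale /= mulr1.
by rewrite fctE coord_field_coord // eq_sym (negbTE ij) scaler0.
Qed.

Lemma vfield_extend p v : cdom c p -> tangent p v ->
  exists2 X, vfield_near p X & X p = v.
Proof.
move=> cp tv.
exists (fun q => \sum_i v (fun q => cmap c q ord0 i) *: coord_field c i q).
  apply: vfield_sum => i _; apply: vfieldZ; last exact: coord_field_vfield.
  exact: smooth_at_cst.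
by rewrite -tangent_coords.
Qed.

End Coord.

Lemma tangent_extend : solid H -> forall p v, tangent p v ->
  exists2 X, vfield_near p X & X p = v.
Proof.
move=> sH p v tv; have [c Mc cp] := atlas_cover p.
exact: (vfield_extend (atlas_smooth_chart Mc) sH cp).
Qed.

End Fields.

Section Maps.
Context {R : realType} {m n : nat} {H : set 'rV[R]_m} {H' : set 'rV[R]_n}
  {M : manifold H} {N : manifold H'}.
Implicit Types (f : M -> N) (p : M).

(** Continuity is a separate clause because it is what pulls statements near [f p] back to
    statements near [p]. *)
Definition smooth_map f p := {for p, continuous f} /\
  forall h, smooth_at (f p) h -> smooth_at p (h \o f).

Lemma smooth_map_near f p (P : set N) : smooth_map f p ->
  (\forall y \near f p, P y) -> \forall q \near p, P (f q).
Proof. by move=> [cf _]; exact: cf. Qed.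

Lemma smooth_map_chart k (K : set 'rV[R]_k) (c : chart R N k) f p :
  smooth_chart K c -> (\forall q \near p, cdom c (f q)) ->
  (forall j, smooth_at p (fun q => cmap c (f q) ord0 j)) -> smooth_map f p.
Proof.
move=> sc cf sf; have cp := nbhs_singleton cf.
have cont : {for p, continuous f}.
  apply: (@chart_cvg _ _ _ _ _ _ _ sc _ (nbhs p)) => //.
  apply: cvg_rows => j; exact: smooth_at_cont (sf j).
split=> // h /(smooth_at_chart sc cp)[_ [F sF hF]].
apply: (@smooth_at_comp _ _ _ _ p _ (fun q => cmap c (f q)) F) => //.
exact: cont _ hF.
Qed.

Lemma differential_smooth f p v h : smooth_at (f p) h ->
  differential f p v h = v (h \o f).
Proof. by move=> sh; rewrite /differential /on_germs; case: asboolP. Qed.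

Lemma differential_linear f p (a : R) v w :
  differential f p (a *: v + w) = a *: differential f p v + differential f p w.
Proof.
apply/funext => h; rewrite !fctE /differential /on_germs.
by case: asboolP => // _; rewrite scaler0 addr0.
Qed.

Lemma differential0 f p : differential f p 0 = 0.
Proof. by apply/funext => h; rewrite /differential /on_germs; case: asboolP. Qed.

Lemma differentialZ f p (k : R) v :
  differential f p (k *: v) = k *: differential f p v.
Proof. by rewrite -[k *: v]addr0 differential_linear differential0 addr0. Qed.

Lemma differentialD f p v w :
  differential f p (v + w) = differential f p v + differential f p w.
Proof. by rewrite -[v in LHS]scale1r differential_linear scale1r. Qed.

Lemma differentialB f p v w :
  differential f p (v - w) = differential f p v - differential f p w.
Proof. by rewrite differentialD -scaleN1r differentialZ scaleN1r. Qed.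

Lemma differential_sum f p (I : finType) (a : I -> R) (v : I -> tvec R M) :
  differential f p (\sum_i a i *: v i) = \sum_i a i *: differential f p (v i).
Proof.
apply: (big_ind2 (fun x y => differential f p x = y)) => //.
- exact: differential0.
- by move=> x1 x2 y1 y2 <- <-; exact: differentialD.
- by move=> i _; exact: differentialZ.
Qed.

Lemma differential_tangent f p v : smooth_map f p -> tangent p v ->
  tangent (f p) (differential f p v).
Proof.
move=> [cf sf] tv; have [c Nc cp] := atlas_cover (f p).
have sc := atlas_smooth_chart Nc.
apply/(tangentP sc _ cp); split.
  by move=> h nsh; rewrite /differential /on_germs; case: asboolP.
exists (\row_j v (fun q => cmap c (f q) ord0 j)) => h F sF hF.
have sx j : smooth_at p (fun q => cmap c (f q) ord0 j).
  exact: (sf _ (smooth_at_coord sc j cp)).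
rewrite differential_smooth; last by apply: (smooth_chart_at sc); split=> //; exists F.
rewrite (tangent_comp tv sx sF (cf _ hF)).
rewrite derive_linear_comb; last exact: smooth_near_diff.
by apply: eq_bigr => j _; rewrite mxE.
Qed.

End Maps.

Lemma smooth_map_comp (R : realType) (m n k : nat) (H : set 'rV[R]_m)
  (H' : set 'rV[R]_n) (H'' : set 'rV[R]_k) (M : manifold H) (N : manifold H')
  (B : manifold H'') (f : M -> N) (g : N -> B) p :
  smooth_map f p -> smooth_map g (f p) -> smooth_map (g \o f) p.
Proof.
move=> [cf sf] [cg sg]; split; first exact: continuous_comp.
by move=> h sh; apply: (sf (h \o g)); exact: sg.
Qed.

Lemma differential_comp (R : realType) (m n k : nat) (H : set 'rV[R]_m)
  (H' : set 'rV[R]_n) (H'' : set 'rV[R]_k) (M : manifold H) (N : manifold H')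
  (B : manifold H'') (f : M -> N) (g : N -> B) p v :
  smooth_map g (f p) ->
  differential (g \o f) p v = differential g (f p) (differential f p v).
Proof.
move=> [cg sg]; apply/funext => h.
have [sh|nsh] := pselect (smooth_at (g (f p)) h); last first.
  by rewrite /differential /on_germs; case: asboolP => //; case: asboolP.
rewrite !differential_smooth //; exact: sg.
Qed.

(** * The collar of an edge manifold *)

Section EdgeMaps.
Context {R : realType} {n b : nat} {E : edge_manifold R n b}.
Implicit Types (p q : E) (y : em_N E).

Let r := em_r E.
Let rho := em_rho E.
Let kappa := em_kappa E.

Lemma collar_kappa t y : - em_eps E < t <= 0 -> collar E (kappa t y).
Proof. by move=> ht; exists t, y. Qed.

Lemma collar_r p : collar E p -> - em_eps E < r p <= 0.
Proof. by move=> [t [y [ht <-]]]; rewrite /r em_rK. Qed.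

Lemma kappaK p : collar E p -> kappa (r p) (rho p) = p.
Proof. by move=> [t [y [ht <-]]]; rewrite /r /rho em_rK // em_rhoK. Qed.

Lemma boundaryP p : boundary E p <-> collar E p /\ r p = 0.
Proof.
have h0 : - em_eps E < 0 <= (0 : R) by apply/andP; split=> //; rewrite oppr_lt0 em_eps_gt0.
rewrite em_boundary; split=> [[y _ <-]|[cp rp]].
  by split; [exact: collar_kappa|rewrite /r em_rK].
by exists (rho p) => //; rewrite -/kappa -rp kappaK.
Qed.

Lemma collar_interiorP p : collar_interior E p <-> collar E p /\ r p < 0.
Proof.
split=> [[cp nb]|[cp rp]].
  split=> //; have /andP[_] := collar_r cp.
  by rewrite le_eqVlt => /orP[/eqP rp|//]; case: nb; apply/boundaryP.
by split=> // /boundaryP[_ rp0]; move: rp; rewrite rp0 ltxx.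
Qed.

Definition collar_chart (c : chart R (em_N E) n) : chart R E (1 + n) :=
  pair_chart [set p | exists t y, - em_eps E < t <= 0 /\ em_kappa E t y = p]
         (em_r E) (line_chart R) (em_rho E) c.

Lemma collar_chart_smooth c : atlas (em_N E) c ->
  smooth_chart (halfspace R n) (collar_chart c).
Proof. exact: em_collar_chart. Qed.

Lemma collar_chart_r c q : cmap (collar_chart c) q ord0 (lshift n ord0) = r q.
Proof. by rewrite /= row_mxEl mxE eqxx mulr1n. Qed.

Lemma collar_chart_rho c q j :
  cmap (collar_chart c) q ord0 (rshift 1 j) = cmap c (rho q) ord0 j.
Proof. by rewrite /= row_mxEr. Qed.

Lemma collar_chart_ex p : collar E p -> exists2 c, atlas (em_N E) c &
  cdom c (rho p) /\ cdom (collar_chart c) p.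
Proof.
by move=> cp; have [c Nc cy] := atlas_cover (rho p); exists c.
Qed.

Lemma collar_near p : collar E p -> \forall q \near p, collar E q.
Proof.
move=> cp; have [c Nc [_ dp]] := collar_chart_ex cp.
by apply: filterS (chart_dom_near (collar_chart_smooth Nc) dp) => q [[]].
Qed.

Lemma r_smooth p : collar E p -> smooth_at p r.
Proof.
move=> cp; have [c Nc [_ dp]] := collar_chart_ex cp.
apply: smooth_at_eq (smooth_at_coord (collar_chart_smooth Nc) (lshift n ord0 : 'I_(1 + n)) dp).
by near=> q; rewrite collar_chart_r.
Unshelve. all: by end_near. Qed.

Lemma rho_smooth p : collar E p -> smooth_map (rho : E -> em_N E) p.
Proof.
move=> cp; have [c Nc [cy dp]] := collar_chart_ex cp.
have sc := collar_chart_smooth Nc.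
apply: (smooth_map_chart (atlas_smooth_chart Nc)).
  by apply: filterS (chart_dom_near sc dp) => q [].
move=> j; apply: smooth_at_eq (smooth_at_coord sc (rshift 1 j : 'I_(1 + n)) dp).
by near=> q; rewrite collar_chart_rho.
Unshelve. all: by end_near. Qed.

Lemma rho_kappa t y : - em_eps E < t <= 0 -> rho (kappa t y) = y.
Proof. exact: em_rhoK. Qed.

Lemma kappa_smooth t y : - em_eps E < t <= 0 -> smooth_map (kappa t : em_N E -> E) y.
Proof.
move=> ht; have ck y' := collar_kappa y' ht.
have [c Nc cy] := atlas_cover y.
have sc := atlas_smooth_chart Nc.
apply: (smooth_map_chart (collar_chart_smooth Nc)).
  apply: filterS (chart_dom_near sc cy) => y' cy'; split; first by split=> //; exact: ck.
  by rewrite /preimage /= em_rhoK.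
move=> j; case: (@split_ordP 1 n j) => [i ->|i ->].
  rewrite (ord1 i); apply: smooth_at_eq (smooth_at_cst y t).
  by near=> y'; rewrite collar_chart_r /r em_rK.
apply: smooth_at_eq (smooth_at_coord sc i cy).
by near=> y'; rewrite collar_chart_rho rho_kappa.
Unshelve. all: by end_near. Qed.

Lemma collar_interior_near p : collar_interior E p ->
  \forall q \near p, collar_interior E q.
Proof.
move=> /collar_interiorP[cp rp].
have cr := smooth_at_cont (r_smooth cp).
have := cr _ (open_nbhs_nbhs (conj (@open_lt R 0) rp)).
by apply: filterS2 (collar_near cp) => q cq rq; apply/collar_interiorP.
Qed.

(** A boundary point [p] is the limit of the interior points [kappa t (rho p)] as [t] tends to 0
    from the left, and both functions are continuous at [p]. *)
Lemma boundary_dense p (f g : E -> R) : collar E p ->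
  smooth_at p f -> smooth_at p g ->
  (\forall q \near p, collar_interior E q -> f q = g q) -> f p = g p.
Proof.
move=> cp sf sg fg.
have [rp0|rp0] := ltP (r p) 0.
  by apply: (nbhs_singleton fg); apply/collar_interiorP.
have rp : r p = 0.
  by apply/eqP; rewrite eq_le rp0; have /andP[_ ->] := collar_r cp.
have [c Nc [cy dp]] := collar_chart_ex cp.
have eps0 := em_eps_gt0 E.
have nt : \forall t \near (0:R)^'-, - em_eps E < t <= 0.
  near=> t; apply/andP; split; last exact: ltW.
  by near: t; apply: nbhs_left_gt; rewrite oppr_lt0.
have kc : kappa t (rho p) @[t --> (0:R)^'-] --> p.
  apply: (chart_cvg (collar_chart_smooth Nc) _ dp).
    apply: filterS nt => t ht; split; first by split=> //; exact: collar_kappa.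
    by rewrite /preimage /= em_rhoK.
  apply: cvg_rows => j; case: (@split_ordP 1 n j) => [i ->|i ->].
    rewrite (ord1 i) collar_chart_r rp.
    apply: (@cvg_trans _ (t @[t --> (0:R)^'-])).
      apply: near_eq_cvg; apply: filterS nt => t ht.
      by rewrite collar_chart_r /r em_rK.
    by apply: cvg_at_left_filter; exact: cvg_id.
  rewrite collar_chart_rho.
  apply: (@cvg_trans _ (cmap c (rho p) ord0 i @[t --> (0:R)^'-])).
    apply: near_eq_cvg; apply: filterS nt => t ht.
    by rewrite collar_chart_rho rho_kappa.
  exact: cvg_cst.
have cfk : f (kappa t (rho p)) @[t --> (0:R)^'-] --> f p.
  exact: (cvg_comp _ _ kc (smooth_at_cont sf)).
have cgk : g (kappa t (rho p)) @[t --> (0:R)^'-] --> g p.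
  exact: (cvg_comp _ _ kc (smooth_at_cont sg)).
apply: (cvg_unique _ cfk) => //.
apply: cvg_trans cgk; apply: near_eq_cvg.
have nk := kc _ fg; have nl : \forall t \near (0:R)^'-, t < 0 by exact: nbhs_left_lt.
apply: filterS3 nt nl nk => t ht lt /= -> //.
apply/collar_interiorP; split; first exact: collar_kappa.
by rewrite /r em_rK.
Unshelve. all: by end_near. Qed.

(** [r] and the coordinates of [N] pulled back by [rho] make up a chart of the collar, and a vector
    is determined by its values on coordinates. *)
Lemma collar_tangent_ext p v w : collar E p -> tangent p v -> tangent p w ->
  v r = w r -> differential (rho : E -> em_N E) p v = differential (rho : E -> em_N E) p w -> v = w.
Proof.
move=> cp tv tw vwr vwrho; have [c Nc [cy dp]] := collar_chart_ex cp.
apply: (tangent_ext (collar_chart_smooth Nc) dp tv tw) => j.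
case: (@split_ordP 1 n j) => [i ->|i ->].
  rewrite (ord1 i); under eq_fun do rewrite collar_chart_r.
  by rewrite vwr; congr (w _); apply/funext => q; rewrite collar_chart_r.
have sy := smooth_at_coord (atlas_smooth_chart Nc) i cy.
have /(congr1 (fun d => d (fun y => cmap c y ord0 i))) := vwrho.
rewrite !differential_smooth // => e.
under eq_fun do rewrite collar_chart_rho.
by rewrite [LHS]e; congr (w _); apply/funext => q; rewrite collar_chart_rho.
Qed.

(** In a product chart the lift has the coefficients of [Y] pulled back by [rho] and no normal
    component. It carries frames of [N] over to the collar. *)
Lemma collar_lift p (Y : em_N E -> tvec R (em_N E)) : collar E p ->
  vfield_near (rho p) Y -> exists X : E -> tvec R E, vfield_near p X /\
  \forall q \near p, X q r = 0 /\ differential (rho : E -> em_N E) q (X q) = Y (rho q).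
Proof.
move=> cp vY; have [c Nc [cy dp]] := collar_chart_ex cp.
have sD := collar_chart_smooth Nc; have sc := atlas_smooth_chart Nc.
have hD := @solid_halfspace R n.
have [crho srho] := rho_smooth cp.
exists (fun q => \sum_l Y (rho q) (fun y => cmap c y ord0 l) *:
  coord_field (collar_chart c) (rshift 1 l) q); split.
  apply: vfield_sum => l _; apply: vfieldZ; last exact: (coord_field_vfield sD hD).
  apply: (srho (fun y => Y y (fun y => cmap c y ord0 l))).
  by apply: vfield_smooth => //; exact: (smooth_at_coord sc).
have nY : \forall q \near p, tangent (rho q) (Y (rho q)).
  by apply: filterS (smooth_map_near (rho_smooth cp) vY) => q [].
apply: filterS3 nY (chart_dom_near sD dp) (collar_near cp) => q tY dq cq.
have cyq : cdom c (rho q) by case: dq.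
have tX : tangent q (\sum_l Y (rho q) (fun y => cmap c y ord0 l) *:
  coord_field (collar_chart c) (rshift 1 l) q).
  by apply: tangent_sum => l _; apply: tangentZ; exact: (coord_field_tangent sD hD).
split.
  rewrite fct_sumE big1 // => l _; rewrite fctE.
  have -> : r = (fun q => cmap (collar_chart c) q ord0 (lshift n ord0)).
    by apply/funext => q'; rewrite collar_chart_r.
  by rewrite (coord_field_coord sD hD) //; case: eqP => [/(congr1 val)//|]; rewrite scaler0.
apply: (tangent_ext sc cyq) => //.
  apply: differential_tangent => //; exact: rho_smooth.
move=> j; rewrite differential_smooth; last exact: (smooth_at_coord sc).
have cf l : coord_field (collar_chart c) (rshift 1 l) q
    (fun q' => cmap c (rho q') ord0 j) = (j == l)%:R.
  under eq_fun do rewrite -collar_chart_rho.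
  by rewrite (coord_field_coord sD hD).
rewrite fct_sumE (eq_bigr (fun l =>
  Y (rho q) (fun y => cmap c y ord0 l) * (j == l)%:R)) => [|l _]; last first.
  by rewrite -cf.
rewrite (bigD1 j) //= big1 => [|l lj]; first by rewrite eqxx addr0 mulr1.
by rewrite eq_sym (negbTE lj) mulr0.
Qed.

Lemma collar_normal p : collar E p ->
  exists X : E -> tvec R E, vfield_near p X /\
  \forall q \near p, X q r = 1 /\ differential (rho : E -> em_N E) q (X q) = 0.
Proof.
move=> cp; have [c Nc [cy dp]] := collar_chart_ex cp.
have sD := collar_chart_smooth Nc; have sc := atlas_smooth_chart Nc.
have hD := @solid_halfspace R n.
exists (coord_field (collar_chart c) (lshift n ord0)); split.
  exact: (coord_field_vfield sD hD).
apply: filterS2 (chart_dom_near sD dp) (collar_near cp) => q dq cq; split.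
  have -> : r = (fun q => cmap (collar_chart c) q ord0 (lshift n ord0)).
    by apply/funext => q'; rewrite collar_chart_r.
  by rewrite (coord_field_coord sD hD) // eqxx.
have cyq : cdom c (rho q) by case: dq.
have tX := coord_field_tangent sD hD (lshift n ord0 : 'I_(1 + n)) dq.
apply: (tangent_ext sc cyq).
- apply: differential_tangent => //; exact: rho_smooth.
- exact: tangent_zero.
move=> j; rewrite differential_smooth; last exact: (smooth_at_coord sc).
have -> : ((fun y => cmap c y ord0 j) \o rho) = (fun q => cmap (collar_chart c) q ord0 (rshift 1 j)).
  by apply/funext => q'; rewrite collar_chart_rho.
by rewrite (coord_field_coord sD hD) //; case: eqP => [/(congr1 val)//|].
Qed.

(** These are the product charts of a local trivialization. In them [pi] is a coordinate projection,
    so the coordinate fields in the last [k] directions are vertical. *)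
Lemma fibred_chart y : exists (k : nat) (c : chart R (em_B E) b)
    (u : chart R (em_N E) (b + k)),
  [/\ atlas (em_B E) c, smooth_chart setT u, cdom u y,
      forall y', cdom u y' -> cdom c (em_pi E y') &
      forall y' i, cmap u y' ord0 (lshift k i) = cmap c (em_pi E y') ord0 i].
Proof.
have [V [oV Vb [k [Z [tau [_ HV]]]]]] := @em_fibration _ _ _ E (em_pi E y).
have [c Bc cy] := atlas_cover (em_pi E y).
have [d Zd dy] := atlas_cover (tau y).
exists k, c, (pair_chart (em_pi E @^-1` V) (em_pi E) c tau d); split=> //.
- exact: HV.
- by move=> y' [[]].
- by move=> y' i; rewrite /= row_mxEl.
Qed.

Lemma pi_smooth y : smooth_map (em_pi E) y.
Proof.
have [k [c [u [Bc su uy uc ui]]]] := fibred_chart y.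
apply: (smooth_map_chart (atlas_smooth_chart Bc)).
  by apply: filterS (chart_dom_near su uy); exact: uc.
move=> j; apply: smooth_at_eq (smooth_at_coord su (lshift k j) uy).
by near=> y'; rewrite ui.
Unshelve. all: by end_near. Qed.

End EdgeMaps.

(** * Connections and their extension to the boundary *)

Section Connections.
Context {R : realType} {n : nat} {H : set 'rV[R]_n} {M : manifold H}.
Variables (O : set M) (D : covariant_derivative M).
Hypothesis cD : connection O D.
Implicit Types (p q : M) (Y : M -> tvec R M).

Lemma connection_eq p v Y Z : O p -> tangent p v -> vfield_near p Y ->
  (\forall q \near p, Y q = Z q) -> D p v Y = D p v Z.
Proof. by case: cD => + _ _ _ _; apply. Qed.

Lemma connection_linear p a u v Y : O p -> tangent p u -> tangent p v ->
  vfield_near p Y -> D p (a *: u + v) Y = a *: D p u Y + D p v Y.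
Proof. by case: cD => _ + _ _ _; apply. Qed.

Lemma connection_add p v Y Z : O p -> tangent p v -> vfield_near p Y ->
  vfield_near p Z -> D p v (fun q => Y q + Z q) = D p v Y + D p v Z.
Proof. by case: cD => _ _ + _ _; apply. Qed.

Lemma connection_leibniz p v f Y : O p -> tangent p v -> smooth_at p f ->
  vfield_near p Y ->
  D p v (fun q => f q *: Y q) = v f *: Y p + f p *: D p v Y.
Proof. by case: cD => _ _ _ + _; apply. Qed.

Lemma connection_vfield p X Y : O p -> vfield_near p X -> vfield_near p Y ->
  vfield_near p (fun q => D q (X q) Y).
Proof. by case: cD => _ _ _ _ +; apply. Qed.

Lemma connection0l p Y : O p -> vfield_near p Y -> D p 0 Y = 0.
Proof.
move=> Op vY; have t0 := tangent_zero p.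
have := connection_linear 1 Op t0 t0 vY.
by rewrite !scale1r addr0 => /eqP; rewrite -subr_eq subrr eq_sym => /eqP.
Qed.

Lemma connection0r p v : O p -> tangent p v -> D p v (fun=> 0) = 0.
Proof.
move=> Op tv; have v0 := @vfield0 _ _ _ _ p.
have := connection_add Op tv v0 v0; rewrite (_ : (fun _ => 0 + 0) = (fun=> 0)).
  by move=> /eqP; rewrite -subr_eq subrr eq_sym => /eqP.
by apply/funext => q; rewrite addr0.
Qed.

Lemma connectionZl p a v Y : O p -> tangent p v -> vfield_near p Y ->
  D p (a *: v) Y = a *: D p v Y.
Proof.
move=> Op tv vY; rewrite -[a *: v]addr0 connection_linear //.
  by rewrite connection0l // addr0.
exact: tangent_zero.
Qed.

Lemma connection_suml (I : finType) p (a : I -> R) (v : I -> tvec R M) Y :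
  O p -> (forall i, tangent p (v i)) -> vfield_near p Y ->
  D p (\sum_i a i *: v i) Y = \sum_i a i *: D p (v i) Y.
Proof.
move=> Op tv vY.
suff [//] : D p (\sum_i a i *: v i) Y = \sum_i a i *: D p (v i) Y /\
  tangent p (\sum_i a i *: v i).
apply: (big_ind2 (fun x y => D p x Y = y /\ tangent p x)).
- by split; [exact: connection0l|exact: tangent_zero].
- move=> x1 x2 y1 y2 [<- tx] [<- ty]; split; last exact: tangentD.
  by rewrite -[x1 in LHS]scale1r connection_linear // scale1r.
- by move=> i _; split; [exact: connectionZl|exact: tangentZ].
Qed.

Lemma connection_sumr (I : Type) (r : seq I) p v (f : I -> M -> R) (Y : I -> M -> tvec R M) :
  O p -> tangent p v -> (forall i, smooth_at p (f i)) ->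
  (forall i, vfield_near p (Y i)) ->
  D p v (fun q => \sum_(i <- r) f i q *: Y i q) =
  \sum_(i <- r) (v (f i) *: Y i p + f i p *: D p v (Y i)).
Proof.
move=> Op tv sf vY; elim: r => [|i r IH].
  rewrite big_nil -[RHS](connection0r Op tv).
  by congr (D p v _); apply/funext => q; rewrite big_nil.
rewrite big_cons -IH -connection_leibniz // -connection_add //.
- by congr (D p v _); apply/funext => q; rewrite big_cons.
- exact: vfieldZ.
- by apply: vfield_sum => j _; exact: vfieldZ.
Qed.

Lemma connection_tangent p v Y : solid H -> O p -> tangent p v ->
  vfield_near p Y -> tangent p (D p v Y).
Proof.
move=> sH Op tv vY; have [X vX <-] := tangent_extend sH tv.
exact: vfield_tangent (connection_vfield Op vX vY).
Qed.

End Connections.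

(** * Functions that extend smoothly from the interior *)

Section Regular.
Context {R : realType} {n b : nat} {E : edge_manifold R n b}.
Implicit Types (p q : E) (F G : E -> R).

(** The values of [G] on the boundary are irrelevant. *)
Definition regular p G := exists2 F, smooth_at p F &
  \forall q \near p, collar_interior E q -> G q = F q.

Lemma regular_smooth p G : smooth_at p G -> regular p G.
Proof. by move=> sG; exists G => //; near=> q. Unshelve. all: by end_near. Qed.

Lemma regular_eq p F G :
  (\forall q \near p, collar_interior E q -> F q = G q) ->
  regular p F -> regular p G.
Proof.
move=> FG [F' sF FF]; exists F' => //.
by apply: filterS2 FG FF => q Fq Fq' iq; rewrite -Fq // Fq'.
Qed.

Lemma regularD p F G : regular p F -> regular p G ->
  regular p (fun q => F q + G q).
Proof.
move=> [F' sF FF] [G' sG GG]; exists (fun q => F' q + G' q).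
  exact: smooth_atD.
by apply: filterS2 FF GG => q Fq Gq iq; rewrite Fq // Gq.
Qed.

Lemma regularM p F G : regular p F -> regular p G ->
  regular p (fun q => F q * G q).
Proof.
move=> [F' sF FF] [G' sG GG]; exists (fun q => F' q * G' q).
  exact: smooth_atM.
by apply: filterS2 FF GG => q Fq Gq iq; rewrite Fq // Gq.
Qed.

Lemma regularN p F : regular p F -> regular p (fun q => - F q).
Proof.
move=> [F' sF FF]; exists (fun q => - F' q); first exact: smooth_atN.
by apply: filterS FF => q Fq iq; rewrite Fq.
Qed.

Lemma regularB p F G : regular p F -> regular p G ->
  regular p (fun q => F q - G q).
Proof. by move=> rF rG; apply: regularD => //; exact: regularN. Qed.

Lemma regular_sum p (I : Type) (r : seq I) (P : pred I) (F : I -> E -> R) :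
  (forall i, P i -> regular p (F i)) ->
  regular p (fun q => \sum_(i <- r | P i) F i q).
Proof.
move=> HF; have -> : (fun x => \sum_(i <- r | P i) F i x) = \sum_(i <- r | P i) F i.
  by apply/funext => y; rewrite fct_sumE.
elim/big_ind : _ => //; first exact/regular_smooth/smooth_at_cst.
by move=> f g; exact: regularD.
Qed.

End Regular.

(** * Extending a connection to the boundary by continuity *)

Section Extension.
Context {R : realType} {n b : nat} (E : edge_manifold R n b).
Variable D0 : covariant_derivative E.
Hypothesis cD0 : connection (collar_interior E) D0.
Hypothesis rD0 : forall (p : E) X Y f, boundary E p -> vfield_near p X ->
  vfield_near p Y -> smooth_at p f -> regular p (fun q => D0 q (X q) Y f).
Implicit Types (p q : E) (X Y : E -> tvec R E).

(** [D0] extended by continuity: the value at [p] of a smooth function that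
    agrees in the interior with the covariant derivative along some field
    through [v]. *)
Definition extension : covariant_derivative E := fun p v Y =>
  on_germs p (fun f => xget 0 [set a | exists X F, [/\ vfield_near p X, X p = v,
     smooth_at p F,
     \forall q \near p, collar_interior E q -> D0 q (X q) Y f = F q & a = F p]]).

Let sH := @solid_halfspace R n.

Lemma regular_connection p X Y f : collar E p -> vfield_near p X ->
  vfield_near p Y -> smooth_at p f -> regular p (fun q => D0 q (X q) Y f).
Proof.
move=> cp vX vY sf; have [bp|nbp] := pselect (boundary E p); first exact: rD0.
have ip : collar_interior E p by [].
exact: regular_smooth (vfield_smooth (connection_vfield cD0 ip vX vY) sf).
Qed.

(** The limit depends on [X] only through [X p]. In coordinate fields, the identity
    [F = \sum_i xi i * G i] holds in the interior, hence at [p] by density, and there all [xi i]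
    vanish. *)
Lemma regular_connection0 p X Y f F : collar E p -> vfield_near p X ->
  vfield_near p Y -> smooth_at p f -> X p = 0 -> smooth_at p F ->
  (\forall q \near p, collar_interior E q -> D0 q (X q) Y f = F q) -> F p = 0.
Proof.
move=> cp vX vY sf X0 sF FX.
have [c Mc dp] := atlas_cover p; have sc := atlas_smooth_chart Mc.
have vc i := coord_field_vfield sc sH i dp.
have /choice[G HG] : forall i, exists G, smooth_at p G /\ \forall q \near p,
    collar_interior E q -> D0 q (coord_field c i q) Y f = G q.
  by move=> i; have [G ? ?] := regular_connection cp (vc i) vY sf; exists G.
pose xi i q := X q (fun q => cmap c q ord0 i).
have sxi i : smooth_at p (xi i).
  by apply: vfield_smooth => //; exact: (smooth_at_coord sc).
rewrite (@boundary_dense _ _ _ _ p F (fun q => \sum_i xi i q * G i q)) //.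
- by rewrite big1 // => i _; rewrite /xi X0 mul0r.
- by apply: smooth_at_sum => i _; apply: smooth_atM => //; exact: (HG i).1.
have HG' : \forall q \near p, forall i, collar_interior E q ->
    D0 q (coord_field c i q) Y f = G i q.
  apply: (@filter_forall _ _ (fun i q => collar_interior E q ->
    D0 q (coord_field c i q) Y f = G i q) (nbhs p)) => i; exact: (HG i).2.
have XT := vfield_tangent_near vX.
near=> q => iq.
have dq : cdom c q by near: q; exact: (chart_dom_near sc).
have tq : tangent q (X q) by near: q.
rewrite -(near FX q) // (tangent_coords sc sH dq tq).
rewrite (connection_suml cD0) //; last 2 first.
- by move=> i; exact: (coord_field_tangent sc sH).
- by near: q; exact: section_near_near.
rewrite fct_sumE; apply: eq_bigr => i _; rewrite !fctE /=.
by rewrite (near HG' q).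
Unshelve. all: by end_near. Qed.

(** Any other field and limit function chosen in [extension] differ from [X] and [F] by a field
    vanishing at [p] and a function to which [regular_connection0] applies, so the choice does not
    matter. *)
Lemma extensionE p X Y f F : collar E p -> vfield_near p X ->
  vfield_near p Y -> smooth_at p f -> smooth_at p F ->
  (\forall q \near p, collar_interior E q -> D0 q (X q) Y f = F q) ->
  extension p (X p) Y f = F p.
Proof.
move=> cp vX vY sf sF FX; rewrite /extension /on_germs.
case: asboolP => // _; case: xgetP => [a _ [X' [F' [vX' X'p sF' FX' ->]]]|]; last first.
  by move=> /(_ (F p)) []; exists X, F.
apply/eqP; rewrite -subr_eq0; apply/eqP.
apply: (@regular_connection0 p (fun q => X' q - X q) Y f (fun q => F' q - F q)) => //.
- exact: vfieldB.
- by rewrite X'p subrr.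
- exact: smooth_atB.
have XT := vfield_tangent_near vX.
have XT' := vfield_tangent_near vX'.
near=> q => iq.
rewrite -(near FX q) // -(near FX' q) //.
have -> : X' q - X q = (-1) *: X q + X' q by rewrite scaleN1r addrC.
rewrite (connection_linear cD0) //.
- by rewrite !fctE /= scaleN1r addrC.
- by near: q.
- by near: q.
- by near: q; exact: section_near_near.
Unshelve. all: by end_near. Qed.

Lemma extension_interior p v Y : collar_interior E p -> tangent p v ->
  vfield_near p Y -> extension p v Y = D0 p v Y.
Proof.
move=> ip tv vY; have [X vX Xp] := tangent_extend sH tv.
have cp : collar E p by case: ip.
apply/funext => f; have [sf|nsf] := pselect (smooth_at p f); last first.
  rewrite (tangent0 (connection_tangent cD0 sH ip tv vY) nsf).
  by rewrite /extension /on_germs; case: asboolP.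
rewrite -Xp (@extensionE p X Y f (fun q => D0 q (X q) Y f)) //.
- exact: vfield_smooth (connection_vfield cD0 ip vX vY) sf.
- by near=> q.
Unshelve. all: by end_near. Qed.

(** Every property of a connection passes to the limit at the boundary. *)
Lemma extension_connection : connection (collar E) extension.
Proof.
(* An equality of tangent vectors can be tested on one smooth germ at a time, where each side is a
   boundary value of a smooth function. *)
have ext_eq p v w Y (K : tvec R E) : (forall f, ~ smooth_at p f -> K f = 0) ->
    (forall f, smooth_at p f -> extension p v Y f = K f) -> extension p v Y = K.
  move=> K0 HK; apply/funext => f; have [sf|nsf] := pselect (smooth_at p f).
    exact: HK.
  by rewrite K0 // /extension /on_germs; case: asboolP.
have ext0 p v Y f : ~ smooth_at p f -> extension p v Y f = 0.
  by move=> nsf; rewrite /extension /on_germs; case: asboolP.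
split.
- move=> p v Y Z cp tv vY YZ; have [X vX Xp] := tangent_extend sH tv.
  apply: ext_eq => // [f|f sf]; first exact: ext0.
  have vZ := section_near_eq YZ vY.
  have [F sF FX] := regular_connection cp vX vY sf.
  rewrite -Xp !(@extensionE p X _ f F) //.
  have XT := vfield_tangent_near vX.
  have /near_join YZ' := YZ.
  near=> q => iq; rewrite -(near FX q) //.
  rewrite (@connection_eq _ _ _ _ _ _ cD0 q (X q) Y Z) //.
  + by near: q.
  + by near: q; exact: section_near_near.
  + by near: q.
- move=> p a u v Y cp tu tv vY.
  have [X vX Xp] := tangent_extend sH tu.
  have [Z vZ Zp] := tangent_extend sH tv.
  apply: ext_eq => // [f nsf|f sf]; first by rewrite !fctE /= !ext0 // scaler0 addr0.
  have [F sF FX] := regular_connection cp vX vY sf.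
  have [G sG GZ] := regular_connection cp vZ vY sf.
  rewrite -[RHS]/(a * extension p u Y f + extension p v Y f).
  rewrite -[in RHS]Xp -[in RHS]Zp (@extensionE p X _ f F) // (@extensionE p Z _ f G) //.
  have -> : a *: u + v = (fun q => a *: X q + Z q) p by rewrite Xp Zp.
  apply: (@extensionE _ (fun q => a *: X q + Z q) _ _ (fun q => a * F q + G q)) => //.
  + by apply: vfieldD => //; apply: vfieldZ => //; exact: smooth_at_cst.
  + by apply: smooth_atD => //; apply: smooth_atM => //; exact: smooth_at_cst.
  have XT := vfield_tangent_near vX.
  have ZT := vfield_tangent_near vZ.
  near=> q => iq; rewrite -(near FX q) // -(near GZ q) // (connection_linear cD0) //.
  + by near: q.
  + by near: q.
  + by near: q; exact: section_near_near.
- move=> p v Y Z cp tv vY vZ; have [X vX Xp] := tangent_extend sH tv.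
  apply: ext_eq => // [f nsf|f sf]; first by rewrite !fctE /= !ext0 // addr0.
  have [F sF FX] := regular_connection cp vX vY sf.
  have [G sG GX] := regular_connection cp vX vZ sf.
  rewrite -[RHS]/(extension p v Y f + extension p v Z f).
  rewrite -Xp (@extensionE p X Y f F) // (@extensionE p X Z f G) //.
  apply: (@extensionE _ X _ _ (fun q => F q + G q)) => //.
  + exact: vfieldD.
  + exact: smooth_atD.
  have XT := vfield_tangent_near vX.
  near=> q => iq; rewrite -(near FX q) // -(near GX q) // (connection_add cD0) //.
  + by near: q.
  + by near: q; exact: section_near_near.
  + by near: q; exact: section_near_near.
- move=> p v f Y cp tv sf vY; have [X vX Xp] := tangent_extend sH tv.
  have tY := vfield_tangent vY.
  apply: ext_eq => // [g nsg|g sg].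
    by rewrite !fctE /= ext0 // (tangent0 tY) // !scaler0 addr0.
  have [F sF FX] := regular_connection cp vX vY sg.
  rewrite -[RHS]/(v f * Y p g + f p * extension p v Y g).
  rewrite -Xp (@extensionE p X Y g F) //.
  rewrite (@extensionE _ X _ _ (fun q => X q f * Y q g + f q * F q)) //.
  + exact: vfieldZ.
  + apply: smooth_atD; last exact: smooth_atM.
    exact: smooth_atM (vfield_smooth vX sf) (vfield_smooth vY sg).
  have XT := vfield_tangent_near vX.
  near=> q => iq; rewrite -(near FX q) // (connection_leibniz cD0) //.
  + by near: q.
  + by near: q; exact: smooth_at_near.
  + by near: q; exact: section_near_near.
- move=> p X Y cp vX vY.
  have vX' := section_near_near vX; have vY' := section_near_near vY.
  apply: filterS3 (collar_near cp) vX' vY' => q cq {cp vX vY}vX vY.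
  (* The same [F] computes the extension at all points near [q]; this gives smoothness of the
     extended derivative. *)
  have extF f : smooth_at q f -> exists2 F, smooth_at q F &
      \forall q' \near q, extension q' (X q') Y f = F q'.
    move=> sf; have [F sF FX] := regular_connection cq vX vY sf.
    exists F => //; have /near_join FX' := FX.
    have c1 := collar_near cq; have c2 := section_near_near vX.
    have c3 := section_near_near vY; have c4 := smooth_at_near sf.
    have c5 := smooth_at_near sF.
    near=> q'; apply: extensionE => //; by near: q'.
  split; last first.
    by move=> f /extF[F sF FX]; apply: smooth_at_eq sF; apply: filterS FX => q' ->.
  have [c Mc dq] := atlas_cover q; have sc := atlas_smooth_chart Mc.
  (* Tangency is itself a limit: in the interior the derivative is a combination of coordinate
     fields whose coefficients, its values on the coordinates, extend smoothly. *)
  suff -> : extension q (X q) Y =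
    \sum_i extension q (X q) Y (fun q => cmap c q ord0 i) *: coord_field c i q.
    by apply: tangent_sum => i _; apply: tangentZ; exact: (coord_field_tangent sc sH).
  have tc i := coord_field_tangent sc sH i dq.
  apply: ext_eq => // [f nsf|f sf].
    rewrite fct_sumE big1 // => i _.
    by rewrite !fctE (tangent0 (tc i)) // scaler0.
  have /choice[G HG] : forall i, exists G, smooth_at q G /\ \forall q' \near q,
      collar_interior E q' -> D0 q' (X q') Y (fun q => cmap c q ord0 i) = G q'.
    move=> i; have [G ? ?] := regular_connection cq vX vY (smooth_at_coord sc i dq).
    by exists G.
  rewrite fct_sumE (eq_bigr (fun i => G i q * coord_field c i q f)) => [|i _]; last first.
    by rewrite !fctE (@extensionE q X Y _ (G i)) //; [exact: (smooth_at_coord sc)|exact: (HG i).1|exact: (HG i).2].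
  apply: (@extensionE _ X Y f (fun q => \sum_i G i q * coord_field c i q f)) => //.
    apply: smooth_at_sum => i _; apply: smooth_atM; first exact: (HG i).1.
    exact: vfield_smooth (coord_field_vfield sc sH i dq) sf.
  have HG' : \forall q' \near q, forall i, collar_interior E q' ->
      D0 q' (X q') Y (fun q => cmap c q ord0 i) = G i q'.
    apply: (@filter_forall _ _ (fun i q' => collar_interior E q' ->
      D0 q' (X q') Y (fun q => cmap c q ord0 i) = G i q') (nbhs q)) => i; exact: (HG i).2.
  have XT := vfield_tangent_near vX.
  near=> q' => iq.
  have dq' : cdom c q' by near: q'; exact: (chart_dom_near sc).
  have tX : tangent q' (X q') by near: q'.
  have vYq : vfield_near q' Y by near: q'; exact: section_near_near.
  have tD : tangent q' (D0 q' (X q') Y) by exact: (connection_tangent cD0).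
  rewrite {1}(tangent_coords sc sH dq' tD) fct_sumE.
  by apply: eq_bigr => i _; rewrite !fctE /= (near HG' q').
Unshelve. all: by end_near. Qed.

Lemma extension_smooth : smooth_extension D0 extension.
Proof. by split; [exact: extension_connection|exact: extension_interior]. Qed.

End Extension.

(** * The splitting of the tangent bundle and adapted frames *)

Section SymmetricForms.
Context {R : realType} {V : lmodType R} (S : set V) (a : V -> V -> R).
Hypotheses (S0 : S 0) (SL : forall k u v, S u -> S v -> S (k *: u + v)).
Hypothesis aC : forall u v, S u -> S v -> a u v = a v u.
Hypothesis aL : forall (k : R) u v w, S u -> S v -> S w ->
  a (k *: u + v) w = k * a u w + a v w.

Lemma form0l w : S w -> a 0 w = 0.
Proof.
move=> Sw; have := aL 1 S0 S0 Sw.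
by rewrite scaler0 addr0 mul1r => /eqP; rewrite -subr_eq subrr eq_sym => /eqP.
Qed.

Lemma form0r w : S w -> a w 0 = 0.
Proof. by move=> Sw; rewrite aC // form0l. Qed.

Lemma formDl u v w : S u -> S v -> S w -> a (u + v) w = a u w + a v w.
Proof. by move=> *; rewrite -[u in LHS]scale1r aL // mul1r. Qed.

Lemma formZl k u w : S u -> S w -> a (k *: u) w = k * a u w.
Proof. by move=> *; rewrite -[_ *: _]addr0 aL // form0l // addr0. Qed.

Lemma formL k u v w : S u -> S v -> S w -> a w (k *: u + v) = k * a w u + a w v.
Proof. by move=> Su Sv Sw; rewrite aC ?aL ?[a w _]aC //; exact: SL. Qed.

Lemma formZr k u w : S u -> S w -> a w (k *: u) = k * a w u.
Proof. by move=> *; rewrite -[_ *: _]addr0 formL // form0r // addr0. Qed.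

Lemma form_suml (I : finType) (P : pred I) (k : I -> R) (u : I -> V) w :
  (forall i, S (u i)) -> S w ->
  a (\sum_(i | P i) k i *: u i) w = \sum_(i | P i) k i * a (u i) w.
Proof.
move=> Su Sw.
suff [] : a (\sum_(i | P i) k i *: u i) w = \sum_(i | P i) k i * a (u i) w /\
  S (\sum_(i | P i) k i *: u i) by [].
apply: (big_ind2 (fun x y => a x w = y /\ S x)).
- by split=> //; exact: form0l.
- move=> x1 x2 y1 y2 [<- S1] [<- S2]; split; first exact: formDl.
  by rewrite -[x1]scale1r; exact: SL.
- move=> i _; split; first exact: formZl.
  by rewrite -[_ *: _]addr0; exact: SL.
Qed.

End SymmetricForms.

(** * The projection onto [F] and rescaling along it *)

Section EdgeSplitting.
Context {R : realType} {n b : nat} {E : edge_manifold R n b}.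
Implicit Types (p q : E) (y : em_N E).

Local Notation r := (em_r E).
Local Notation rho := (em_rho E).
Local Notation kappa := (em_kappa E).
Local Notation pi := (em_pi E).
Local Notation P := (em_P E).
Let sH := @solid_halfspace R n.

Lemma vertical_bundle0 y : vertical_bundle pi y 0.
Proof. by split; [exact: tangent_zero|exact: differential0]. Qed.

Lemma vertical_bundle_linear y (k : R) u v : vertical_bundle pi y u ->
  vertical_bundle pi y v -> vertical_bundle pi y (k *: u + v).
Proof.
move=> [tu du] [tv dv]; split; first exact: tangent_linear.
by rewrite differential_linear du dv scaler0 addr0.
Qed.

Lemma P_vertical y u : tangent y u -> vertical_bundle pi y (P y u).
Proof. by have [+ _ _ _] := @em_ehresmann _ _ _ E; apply. Qed.

Lemma P_id y u : vertical_bundle pi y u -> P y u = u.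
Proof. by have [_ + _ _] := @em_ehresmann _ _ _ E; apply. Qed.

Lemma P_linear y (k : R) u v : tangent y u -> tangent y v ->
  P y (k *: u + v) = k *: P y u + P y v.
Proof. by have [_ _ + _] := @em_ehresmann _ _ _ E; apply. Qed.

Lemma P_vfield y X : vfield_near y X -> vfield_near y (fun y' => P y' (X y')).
Proof. by have [_ _ _ +] := @em_ehresmann _ _ _ E; apply. Qed.

Lemma rho_tangent p v : collar E p -> tangent p v ->
  tangent (rho p) (differential rho p v).
Proof. by move=> cp; apply: differential_tangent; exact: rho_smooth. Qed.

Lemma vert_vertical p v : collar E p -> tangent p v ->
  vertical_bundle pi (rho p) (vert p v).
Proof. by move=> cp tv; apply: P_vertical; exact: rho_tangent. Qed.

Lemma vert_linear p (k : R) u v : collar E p -> tangent p u -> tangent p v ->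
  vert p (k *: u + v) = k *: vert p u + vert p v.
Proof.
by move=> cp tu tv; rewrite /vert differential_linear; apply: P_linear; exact: rho_tangent.
Qed.

Lemma fpart_tangent p v : collar E p -> tangent p v -> tangent p (fpart p v).
Proof.
move=> cp tv; have [tw _] := vert_vertical cp tv.
have := differential_tangent (kappa_smooth (rho p) (collar_r cp)) tw.
by rewrite (kappaK cp).
Qed.

Lemma fpart_linear p (k : R) u v : collar E p -> tangent p u -> tangent p v ->
  fpart p (k *: u + v) = k *: fpart p u + fpart p v.
Proof. by move=> cp tu tv; rewrite /fpart vert_linear // differential_linear. Qed.

Lemma fpart_r p v : collar E p -> tangent p v -> fpart p v r = 0.
Proof.
move=> cp tv; have [tw _] := vert_vertical cp tv.
have cr := collar_r cp.
rewrite /fpart differential_smooth.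
  rewrite (_ : _ \o _ = fun=> r p); first exact: (tangent_cst _ tw).
  by apply/funext => y; rewrite /= em_rK.
by rewrite (kappaK cp); exact: r_smooth.
Qed.

(** [rho] is a left inverse of the slice embedding [kappa (r p)], so its differential undoes the
    embedding that defines [fpart]. *)
Lemma fpart_rho p v : collar E p -> tangent p v ->
  differential rho p (fpart p v) = vert p v.
Proof.
move=> cp tv; have [tw _] := vert_vertical cp tv; have cr := collar_r cp.
have : differential (rho \o (kappa (r p))) (rho p) (vert p v) =
  differential rho p (fpart p v).
  rewrite differential_comp.
    by rewrite /fpart (kappaK cp).
  by rewrite (kappaK cp); exact: rho_smooth.
move=> <-; have rk : rho \o kappa (r p) = id.
  by apply/funext => y; rewrite /= rho_kappa.
apply/funext => h; rewrite rk /differential /on_germs.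
by case: asboolP => // nsh; rewrite (tangent0 tw).
Qed.

Lemma fpart_eq0 p v : collar E p -> vert p v = 0 -> fpart p v = 0.
Proof. by move=> cp v0; rewrite /fpart v0 differential0. Qed.

Lemma fpart_id p v : collar E p -> tangent p v -> v r = 0 ->
  vertical_bundle pi (rho p) (differential rho p v) -> fpart p v = v.
Proof.
move=> cp tv vr vb; apply: (collar_tangent_ext cp) => //.
- exact: fpart_tangent.
- by rewrite fpart_r.
- by rewrite fpart_rho //; exact: P_id.
Qed.

Lemma vert_fpart p v : collar E p -> tangent p v -> vert p (fpart p v) = vert p v.
Proof.
move=> cp tv; rewrite {1}/vert fpart_rho //; apply: P_id; exact: vert_vertical.
Qed.

Lemma fpartK p v : collar E p -> tangent p v -> fpart p (fpart p v) = fpart p v.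
Proof. by move=> cp tv; rewrite {1}/fpart vert_fpart. Qed.

(** Scales the component in [F] by [s]; [phi] and its inverse are the cases
    [s = r] and [s = 1/r]. *)
Definition fscale (s : R) p v := s *: fpart p v + (v - fpart p v).

Lemma fscale_tangent s p v : collar E p -> tangent p v -> tangent p (fscale s p v).
Proof.
move=> cp tv; have tf := fpart_tangent cp tv.
by apply: tangent_linear => //; exact: tangentB.
Qed.

Lemma fscale_linear s p (k : R) u v : collar E p -> tangent p u -> tangent p v ->
  fscale s p (k *: u + v) = k *: fscale s p u + fscale s p v.
Proof.
move=> cp tu tv; rewrite /fscale fpart_linear //.
by apply/funext => f; rewrite !fctE /GRing.scale /=; ring.
Qed.

Lemma fpart_fscale s p v : collar E p -> tangent p v ->
  fpart p (fscale s p v) = s *: fpart p v.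
Proof.
move=> cp tv; have tf := fpart_tangent cp tv.
rewrite /fscale fpart_linear // ?fpartK //; last exact: tangentB.
have -> : v - fpart p v = (-1) *: fpart p v + v by rewrite scaleN1r addrC.
by rewrite fpart_linear // fpartK // scaleN1r addNr addr0.
Qed.

Lemma fscaleK s p v : collar E p -> tangent p v -> s != 0 ->
  fscale s p (fscale s^-1 p v) = v.
Proof.
move=> cp tv s0; rewrite {1}/fscale fpart_fscale // scalerA mulfV // scale1r.
by rewrite /fscale [_ *: _ + _]addrC addrK addrC subrK.
Qed.

Lemma phiE p v : phi p v = fscale (r p) p v.
Proof. by []. Qed.

Lemma phi_invE p v : phi_inv p v = fscale (r p)^-1 p v.
Proof. by []. Qed.

Lemma phi_invK p v : collar_interior E p -> tangent p v -> phi p (phi_inv p v) = v.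
Proof.
move=> /collar_interiorP[cp rp] tv; rewrite phiE phi_invE fscaleK //.
by rewrite lt_eqF.
Qed.

End EdgeSplitting.

(** * A frame of [N] adapted to the fibration *)

Section FibredFrame.
Context {R : realType} {n b : nat} {E : edge_manifold R n b}.
Local Notation N := (em_N E).
Local Notation pi := (em_pi E).
Local Notation P := (em_P E).
Variables (k : nat) (c : chart R (em_B E) b) (u : chart R N (b + k)).
Hypotheses (Bc : atlas (em_B E) c) (su : smooth_chart setT u).
Hypothesis uc : forall y : N, cdom u y -> cdom c (pi y).
Hypothesis ui : forall (y : N) i,
  cmap u y ord0 (lshift k i) = cmap c (pi y) ord0 i.
Implicit Types (y : N) (w : tvec R N).

Let ST m := @solidT R m.
Let sc := atlas_smooth_chart Bc.
Local Notation dl i := (coord_field u (lshift k i)).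
Local Notation dr j := (coord_field u (rshift b j)).
Local Notation ul i := (fun y => cmap u y ord0 (lshift k i)).
Local Notation ur j := (fun y => cmap u y ord0 (rshift b j)).

Lemma ulE i : ul i = (fun z => cmap c z ord0 i) \o pi.
Proof. by apply/funext => y; rewrite ui. Qed.

Lemma differential_pi_coord y w i : cdom u y ->
  differential pi y w (fun z => cmap c z ord0 i) = w (ul i).
Proof.
move=> uy; rewrite differential_smooth -?ulE //.
exact: (smooth_at_coord sc _ (uc uy)).
Qed.

Lemma dl_tangent y i : cdom u y -> tangent y (dl i y).
Proof. exact: (coord_field_tangent su (@ST _)). Qed.

Lemma dr_vertical y j : cdom u y -> vertical_bundle pi y (dr j y).
Proof.
move=> uy; have td := coord_field_tangent su (@ST _) (rshift b j) uy.
split=> //; apply: (tangent_ext sc (uc uy)).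
- by apply: differential_tangent => //; exact: pi_smooth.
- exact: tangent_zero.
- move=> i; rewrite differential_pi_coord //.
  by rewrite (coord_field_coord su (@ST _)) // eq_lrshift.
Qed.

(** The [inl] part consists of the horizontal lifts of the coordinate fields of the base for the
    Ehresmann connection. *)
Definition fibred_frame (s : 'I_b + 'I_k) y : tvec R N :=
  match s with
  | inl i => dl i y - P y (dl i y)
  | inr j => dr j y
  end.

(** Start from the expansion of [w] in coordinate fields. Replacing each [dl i] by its horizontal
    lift leaves [w (ul i)] times [P (dl i)] over, which is vertical and is redistributed among the
    fibre coefficients. *)
Definition fibred_coef (s : 'I_b + 'I_k) y w : R :=
  match s with
  | inl i => w (ul i)
  | inr j => w (ur j) + \sum_i P y (dl i y) (ur j) * w (ul i)
  end.

Lemma fibred_frame_tangent s y : cdom u y -> tangent y (fibred_frame s y).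
Proof.
case: s => [i|j] uy; last by case: (dr_vertical j uy).
apply: tangentB; first exact: dl_tangent.
by case: (P_vertical (dl_tangent i uy)).
Qed.

Lemma fibred_frame_vfield s y : cdom u y -> vfield_near y (fibred_frame s).
Proof.
case: s => [i|j] uy; last exact: (coord_field_vfield su (@ST _)).
apply: vfieldB; first exact: (coord_field_vfield su (@ST _)).
by apply: P_vfield; exact: (coord_field_vfield su (@ST _)).
Qed.

Lemma P_fibred_frame s y : cdom u y -> P y (fibred_frame s y) =
  if s is inr _ then fibred_frame s y else 0.
Proof.
case: s => [i|j] uy /=; last by apply: P_id; exact: dr_vertical.
have td := dl_tangent i uy; have Pv := P_vertical td; have tP := Pv.1.
have -> : dl i y - P y (dl i y) = (-1) *: P y (dl i y) + dl i y.
  by rewrite scaleN1r addrC.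
by rewrite P_linear // (P_id Pv) scaleN1r addNr.
Qed.

Lemma differential_pi_frame s y : cdom u y ->
  differential pi y (fibred_frame s y) =
  if s is inl i then coord_field c i (pi y) else 0.
Proof.
case: s => [i|j] uy /=; last by case: (dr_vertical j uy).
have td := dl_tangent i uy; have Pv := P_vertical td.
rewrite differentialB Pv.2 subr0.
apply: (tangent_ext sc (uc uy)).
- by apply: differential_tangent => //; exact: pi_smooth.
- exact: (coord_field_tangent sc (@ST _) _ (uc uy)).
move=> l; rewrite differential_pi_coord //.
rewrite (coord_field_coord su (@ST _)) //.
rewrite (coord_field_coord sc (@ST _)); last exact: uc.
by have [->|li] := eqVneq l i; rewrite ?eqxx // eq_lshift (negbTE li).
Qed.

(** [ul i] is pulled back from the base, so the vertical correction in the horizontal lift does not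
    affect this value. *)
Lemma fibred_frame_ul s y i : cdom u y ->
  fibred_frame s y (ul i) = (s == inl i)%:R.
Proof.
move=> uy; rewrite -(differential_pi_coord _ i uy) differential_pi_frame //.
case: s => [l|j] //=; rewrite (coord_field_coord sc (@ST _)); last exact: uc.
by rewrite eq_sym.
Qed.

Lemma fibred_frame_ur s y j : cdom u y -> fibred_frame s y (ur j) =
  match s with inl i => - P y (dl i y) (ur j) | inr l => (l == j)%:R end.
Proof.
case: s => [i|l] uy /=.
  rewrite -[LHS]/(dl i y (ur j) - P y (dl i y) (ur j)).
  by rewrite (coord_field_coord su (@ST _)) // eq_rlshift add0r.
by rewrite (coord_field_coord su (@ST _)) // eq_rshift eq_sym.
Qed.

Lemma fibred_frame_decomp y w : cdom u y -> tangent y w ->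
  w = \sum_s fibred_coef s y w *: fibred_frame s y.
Proof.
move=> uy tw; apply: (tangent_ext su uy tw).
  by apply: tangent_sum => s _; apply: tangentZ; exact: fibred_frame_tangent.
move=> l; have [i ->|j ->] := split_ordP l.
- rewrite fct_sumE (eq_bigr (fun s => fibred_coef s y w * (s == inl i)%:R)).
    by rewrite (bigD1 (inl i)) //= big1 ?eqxx ?mulr1 ?addr0 // => s /negbTE ->; rewrite mulr0.
  by move=> s _; rewrite -(fibred_frame_ul s i uy).
- rewrite fct_sumE big_sumType /=.
  rewrite (eq_bigr (fun i => - (P y (dl i y) (ur j) * w (ul i)))); last first.
    move=> i _; rewrite -[LHS]/(w (ul i) * fibred_frame (inl i) y (ur j)).
    by rewrite (fibred_frame_ur _ j uy) mulrN mulrC.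
  rewrite [X in _ = _ + X](eq_bigr (fun m => fibred_coef (inr m) y w * (m == j)%:R)).
    rewrite [X in _ = _ + X](bigD1 j) //= [X in _ = _ + (_ + X)]big1.
      by rewrite eqxx mulr1 addr0 sumrN addrC addrK.
    by move=> m /negbTE ->; rewrite mulr0.
  by move=> m _; rewrite -(fibred_frame_ur (inr m) j uy).
Qed.

End FibredFrame.

(** * The model metric and its conjugate by [phi] *)

Section ModelMetric.
Context {R : realType} {n b : nat} {E : edge_manifold R n b}.
Variables (gV : em_N E -> tvec R (em_N E) -> tvec R (em_N E) -> R)
  (gB : em_B E -> tvec R (em_B E) -> tvec R (em_B E) -> R).
Hypotheses (hgV : bundle_metric setT (vertical_bundle (em_pi E)) gV)
  (hgB : riemannian_metric setT gB).
Local Notation r := (em_r E).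
Local Notation rho := (em_rho E).
Local Notation pi := (em_pi E).
Implicit Types (p q : E).

(** [g^phi] for the model metric [g]; it makes sense up to the boundary. *)
Definition model_phi p (v w : tvec R E) : R :=
  v r * w r + gV (rho p) (vert p v) (vert p w)
  + gB (pi (rho p)) (differential (pi \o rho) p v) (differential (pi \o rho) p w).

Let gVC y := let: conj (And3 h _ _) _ := hgV in fun u v => h y u v I.
Let gVL y := let: conj (And3 _ h _) _ := hgV in fun k u v w => h y k u v w I.
Let gBC y := let: conj (And3 h _ _) _ := hgB in fun u v => h y u v I.
Let gBL y := let: conj (And3 _ h _) _ := hgB in fun k u v w => h y k u v w I.
Let V0 y := @vertical_bundle0 _ _ _ E y.
Let VL y := @vertical_bundle_linear _ _ _ E y.
Let B0 z := @tangent_zero _ _ _ (em_B E) z.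

Lemma pirho_smooth p : collar E p -> smooth_map (pi \o rho) p.
Proof. by move=> cp; exact: (smooth_map_comp (rho_smooth cp) (pi_smooth _)). Qed.

Lemma pirho_tangent p v : collar E p -> tangent p v ->
  tangent (pi (rho p)) (differential (pi \o rho) p v).
Proof. by move=> cp tv; exact: (differential_tangent (pirho_smooth cp) tv). Qed.

Lemma pirhoE p v : differential (pi \o rho) p v =
  differential pi (rho p) (differential rho p v).
Proof. by apply: differential_comp; exact: pi_smooth. Qed.

Lemma pirho_fpart p v : collar E p -> tangent p v ->
  differential (pi \o rho) p (fpart p v) = 0.
Proof.
by move=> cp tv; rewrite pirhoE fpart_rho //; case: (vert_vertical cp tv).
Qed.

Lemma model_phiC p v w : collar E p -> tangent p v -> tangent p w ->
  model_phi p v w = model_phi p w v.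
Proof.
move=> cp tv tw; rewrite /model_phi mulrC gVC; last 2 first.
- exact: vert_vertical.
- exact: vert_vertical.
by rewrite gBC //; exact: pirho_tangent.
Qed.

Lemma model_phiL p k u v w : collar E p -> tangent p u -> tangent p v ->
  tangent p w -> model_phi p (k *: u + v) w = k * model_phi p u w + model_phi p v w.
Proof.
move=> cp tu tv tw; rewrite /model_phi vert_linear // differential_linear.
rewrite gVL; try exact: vert_vertical.
rewrite gBL; try exact: pirho_tangent.
rewrite -[(k *: u + v) r]/(k * u r + v r).
ring.
Qed.

Lemma model_metricC p v w : collar E p -> tangent p v -> tangent p w ->
  model_metric gV gB p v w = model_metric gV gB p w v.
Proof.
move=> cp tv tw; rewrite /model_metric /= mulrC gVC; last 2 first.
- exact: vert_vertical.
- exact: vert_vertical.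
by rewrite gBC //; exact: pirho_tangent.
Qed.

Lemma model_metricL p k u v w : collar E p -> tangent p u -> tangent p v ->
  tangent p w -> model_metric gV gB p (k *: u + v) w =
  k * model_metric gV gB p u w + model_metric gV gB p v w.
Proof.
move=> cp tu tv tw; rewrite /model_metric /= vert_linear // differential_linear.
rewrite gVL; try exact: vert_vertical.
rewrite gBL; try exact: pirho_tangent.
rewrite -[(k *: u + v) r]/(k * u r + v r).
ring.
Qed.

(** The three summands are nonnegative, so all vanish. Then [v] has no normal component, and its
    image in [TN] is killed by the differential of [pi], hence equals its own vertical part, which
    is 0. The factor [r^2] being absent, this also works on the boundary. *)
Lemma model_phi_eq0 p v : collar E p -> tangent p v -> model_phi p v v = 0 -> v = 0.
Proof.
move=> cp tv; have vv := vert_vertical cp tv; have pv := pirho_tangent cp tv.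
have gV0 : vert p v <> 0 -> 0 < gV (rho p) (vert p v) (vert p v).
  by case: hgV => _; apply.
have gB0 : differential (pi \o rho) p v <> 0 ->
    0 < gB (pi (rho p)) (differential (pi \o rho) p v) (differential (pi \o rho) p v).
  by case: hgB => _; apply.
have gV1 : 0 <= gV (rho p) (vert p v) (vert p v).
  have [->|/gV0/ltW //] := pselect (vert p v = 0).
  by rewrite (form0l (@V0 _) (gVL (y := _))) //; exact: V0.
have gB1 : 0 <= gB (pi (rho p)) (differential (pi \o rho) p v) (differential (pi \o rho) p v).
  have [->|/gB0/ltW //] := pselect (differential (pi \o rho) p v = 0).
  by rewrite (form0l (@B0 _) (gBL (y := _))) //; exact: B0.
rewrite /model_phi; move: gV0 gV1 gB0 gB1.
move: (gV _ _ _) (gB _ _ _) => x y gV0 gV1 gB0 gB1 m0.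
have [vr0 vv0 dv0] : [/\ v r = 0, vert p v = 0 & differential (pi \o rho) p v = 0].
  move: m0; set z : R := v r => m0; have z0 : 0 <= z * z by exact: sqr_ge0.
  have {}m0 : z * z + x + y = 0 := m0.
  split.
  - have /eqP : z * z = 0 by lra.
    by rewrite mulf_eq0 => /orP[]/eqP.
  - by have [//|/gV0 ?] := pselect (vert p v = 0); exfalso; lra.
  - by have [//|/gB0 ?] := pselect (differential (pi \o rho) p v = 0); exfalso; lra.
apply: (collar_tangent_ext cp tv) => //; first exact: tangent_zero.
rewrite differential0 -vv0 /vert; apply/esym/P_id; split; first exact: rho_tangent.
by rewrite -pirhoE.
Qed.

(** [phi_inv] multiplies the vertical component by [1 / r], which cancels the factor [r^2], and
    leaves the normal and base components unchanged. *)
Lemma phi_form_model p v w : collar_interior E p -> tangent p v -> tangent p w ->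
  phi_form (model_metric gV gB) p v w = model_phi p v w.
Proof.
move=> /collar_interiorP[cp rp] tv tw; have r0 : r p != 0 by rewrite lt_eqF.
have hr x : tangent p x -> phi_inv p x r = x r.
  move=> tx; rewrite phi_invE.
  rewrite -[LHS]/((r p)^-1 * fpart p x r + (x r - fpart p x r)).
  by rewrite fpart_r // mulr0 subr0 add0r.
have hv x : tangent p x -> vert p (phi_inv p x) = (r p)^-1 *: vert p x.
  move=> tx; have tf := fpart_tangent cp tx.
  rewrite phi_invE /fscale vert_linear //; last exact: tangentB.
  have -> : x - fpart p x = (-1) *: fpart p x + x by rewrite scaleN1r addrC.
  by rewrite vert_linear // vert_fpart // scaleN1r addNr addr0.
have hp x : tangent p x -> differential (pi \o rho) p (phi_inv p x) = differential (pi \o rho) p x.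
  move=> tx; rewrite phi_invE /fscale differential_linear differentialB.
  by rewrite pirho_fpart // scaler0 subr0 add0r.
rewrite /phi_form /model_metric /= !hr // !hv // !hp //.
have vv := vert_vertical cp tv; have vw := vert_vertical cp tw.
rewrite (formZl (@V0 _) (gVL (y := _))) //; last first.
  by rewrite -[_ *: _]addr0; apply: VL => //; exact: V0.
rewrite (formZr (@V0 _) (@VL _) (gVC (y := _)) (gVL (y := _))) //.
rewrite /model_phi; congr (_ + _ + _).
by field.
Qed.

End ModelMetric.

(** * Construction of adapted frames on the collar *)

Section AdaptedFrame.
Context {R : realType} {n b : nat} {E : edge_manifold R n b}.
Variables (gV : em_N E -> tvec R (em_N E) -> tvec R (em_N E) -> R)
  (gB : em_B E -> tvec R (em_B E) -> tvec R (em_B E) -> R).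
Local Notation r := (em_r E).
Local Notation rho := (em_rho E).
Local Notation pi := (em_pi E).
Local Notation P := (em_P E).
Implicit Types (p q : E).

(** A frame near [p] made of a normal field [e i0], of vertical fields and of
    fields projecting to coordinate fields of the base. All its brackets are
    vertical, and vertical derivatives annihilate the model metric on
    non-vertical vectors. *)
Record adapted_frame (p : E) (I : finType) (i0 : I) (vt : pred I)
    (e : I -> E -> tvec R E) (th : I -> E -> tvec R E -> R)
    (c : I -> I -> I -> E -> R) : Prop := AdaptedFrame {
  af_vfield : forall i, vfield_near p (e i);
  af_decomp : \forall q \near p, forall v, tangent q v ->
    v = \sum_i th i q v *: e i q;
  af_coef : forall X i, vfield_near p X -> smooth_at p (fun q => th i q (X q));
  af_free : forall a : I -> R, \sum_i a i *: e i p = 0 -> forall i, a i = 0;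
  af_r : \forall q \near p, forall i, e i q r = (i == i0)%:R;
  af_i0 : ~~ vt i0;
  af_fpart : \forall q \near p, forall i,
    fpart q (e i q) = if vt i then e i q else 0;
  af_c_smooth : forall i j k, smooth_at p (c i j k);
  af_bracket : \forall q \near p, forall i j,
    tangent q (lie_bracket (e i) (e j) q) ->
    lie_bracket (e i) (e j) q = \sum_(k | vt k) c i j k q *: e k q;
  af_h_smooth : forall i j,
    smooth_at p (fun q => model_phi gV gB q (e i q) (e j q));
  af_h_mixed : \forall q \near p, forall i j, vt i -> ~~ vt j ->
    model_phi gV gB q (e i q) (e j q) = 0;
  af_h_vert : \forall q \near p, forall i j l, vt j -> ~~ vt i -> ~~ vt l ->
    e j q (fun q' => model_phi gV gB q' (e i q') (e l q')) = 0 }.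

Hypotheses (hgV : bundle_metric setT (vertical_bundle (em_pi E)) gV)
  (hgB : riemannian_metric setT gB).

Let gVC y := let: conj (And3 h _ _) _ := hgV in fun u v => h y u v I.
Let gVL y := let: conj (And3 _ h _) _ := hgV in fun k u v w => h y k u v w I.
Let gVS y := let: conj (And3 _ _ h) _ := hgV in fun X Y => h y X Y I.
Let gBC y := let: conj (And3 h _ _) _ := hgB in fun u v => h y u v I.
Let gBL y := let: conj (And3 _ h _) _ := hgB in fun k u v w => h y k u v w I.
Let gBS y := let: conj (And3 _ _ h) _ := hgB in fun X Y => h y X Y I.
Let V0 y := @vertical_bundle0 _ _ _ E y.
Let VL y := @vertical_bundle_linear _ _ _ E y.
Let B0 z := @tangent_zero _ _ _ (em_B E) z.

Section Build.
Variables (k : nat) (c : chart R (em_B E) b) (u : chart R (em_N E) (b + k)).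
Hypotheses (Bc : atlas (em_B E) c) (su : smooth_chart setT u).
Hypothesis uc : forall y : em_N E, cdom u y -> cdom c (pi y).
Hypothesis ui : forall (y : em_N E) i,
  cmap u y ord0 (lshift k i) = cmap c (pi y) ord0 i.
Variable p : E.
Hypotheses (cp : collar E p) (up : cdom u (rho p)).
Variable e0 : E -> tvec R E.
Hypotheses (ve0 : vfield_near p e0)
  (He0 : \forall q \near p, e0 q r = 1 /\ differential rho q (e0 q) = 0).
Local Notation I0 := ('I_b + 'I_k)%type.
Local Notation f := (@fibred_frame R n b E k u).
Variable es : I0 -> E -> tvec R E.
Hypotheses (ves : forall s, vfield_near p (es s))
  (Hes : forall s, \forall q \near p,
     es s q r = 0 /\ differential rho q (es s q) = f s (rho q)).

Let I := option I0.
Let vt : pred I := fun i => if i is Some (inr _) then true else false.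
Let e (i : I) := if i is Some s then es s else e0.
Let th (i : I) q v := if i is Some s then
  @fibred_coef R n b E k u s (rho q) (differential rho q v) else v r.
Let x (i : I) : E -> R := fun q => match i with
  | None => r q
  | Some (inl j) => cmap u (rho q) ord0 (lshift k j)
  | Some (inr j) => cmap u (rho q) ord0 (rshift b j) end.
(** The value of the bracket of [e i] and [e j] on the coordinate [x l]. For a vector that kills all
    non-vertical coordinates, its component along a vertical [e l] is its value on [x l], so these
    are the structure functions. *)
Let cc (i j l : I) : E -> R := fun q => e i q (fun q => e j q (x l)) - e j q (fun q => e i q (x l)).

Let sc := atlas_smooth_chart Bc.
Let urho : \forall q \near p, cdom u (rho q).
Proof. exact: smooth_map_near (rho_smooth cp) (chart_dom_near su up). Qed.

Let ve i : vfield_near p (e i).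
Proof. by case: i => [s|] /=; [exact: ves|exact: ve0]. Qed.

Let He : \forall q \near p, forall i, e i q r = (i == None)%:R /\
  differential rho q (e i q) = if i is Some s then f s (rho q) else 0.
Proof.
apply: (@filter_forall _ _ (fun i q => e i q r = (i == None)%:R /\
  differential rho q (e i q) = if i is Some s then f s (rho q) else 0) (nbhs p)).
by case=> [s|] /=; [exact: Hes|exact: He0].
Qed.

Let te : \forall q \near p, forall i, tangent q (e i q).
Proof.
apply: (@filter_forall _ _ (fun i q => tangent q (e i q)) (nbhs p)) => i.
exact: vfield_tangent_near.
Qed.

Let sx : \forall q \near p, forall i, smooth_at q (x i).
Proof.
apply: filterS2 (collar_near cp) urho => q cq uq [[j|j]|] /=.
- exact: ((rho_smooth cq).2 _ (smooth_at_coord su _ uq)).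
- exact: ((rho_smooth cq).2 _ (smooth_at_coord su _ uq)).
- exact: r_smooth.
Qed.

Let th_x : \forall q \near p, forall v i, th i q v = if i is Some (inr j)
  then v (x i) + \sum_l P (rho q) (coord_field u (lshift k l) (rho q))
     (fun y => cmap u y ord0 (rshift b j)) * v (x (Some (inl l)))
  else v (x i).
Proof.
apply: filterS2 (collar_near cp) urho => q cq uq v [[j|j]|] //=.
- rewrite differential_smooth //; exact: (smooth_at_coord su).
- rewrite differential_smooth; last exact: (smooth_at_coord su).
  congr (_ + _); apply: eq_bigr => l _.
  rewrite differential_smooth //; exact: (smooth_at_coord su).
Qed.

(** This is what makes all brackets of the frame vertical. *)
Let e_x : \forall q \near p, forall i l, ~~ vt l -> e i q (x l) = (i == l)%:R.
Proof.
apply: filterS3 (collar_near cp) urho He => q cq uq H i [[j|//]|] _ //=.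
  have [_] := H i => Hi.
  have : differential rho q (e i q) (fun y => cmap u y ord0 (lshift k j)) = (i == Some (inl j))%:R.
    rewrite Hi; case: i {Hi} => [s|] //=.
    by rewrite (fibred_frame_ul Bc su uc ui).
  rewrite differential_smooth //; exact: (smooth_at_coord su).
by have [] := H i.
Qed.

Let decomp : \forall q \near p, forall v, tangent q v -> v = \sum_i th i q v *: e i q.
Proof.
have h1 := collar_near cp; have h2 := urho; have h3 := te; have h4 := He.
near=> q => v tv.
have cq : collar E q by near: q.
have uq : cdom u (rho q) by near: q.
have tq i : tangent q (e i q) by move: i; near: q.
have [Hr Hd] : (forall i, e i q r = (i == None)%:R) /\ forall i,
    differential rho q (e i q) = if i is Some s then f s (rho q) else 0.
  by have H := near h4 q; split=> i; case: (H _ i).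
apply: (collar_tangent_ext cq) => //.
- by apply: tangent_sum => i _; exact: tangentZ.
- rewrite fct_sumE (eq_bigr (fun i => th i q v * (i == None)%:R)) => [|i _]; last first.
    by rewrite -Hr.
  rewrite (bigD1 None) //= big1 ?addr0 ?mulr1 // => -[s|//] _.
  by rewrite mulr0.
- rewrite differential_sum {1}(fibred_frame_decomp Bc su uc ui uq (rho_tangent cq tv)).
  have E0 : th None q v *: differential rho q (e None q) = 0 by rewrite Hd scaler0.
  rewrite [RHS](bigD1 None) // E0 /= add0r.
  rewrite (reindex_omap Some id) => [|[s|]] //=.
  apply: eq_big => s; first by rewrite eqxx.
  by move=> _; have /= -> := Hd (Some s).
Unshelve. all: by end_near. Qed.

Lemma adapted_frame_build : adapted_frame p None vt e th cc.
Proof.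
have h1 := collar_near cp; have h2 := urho; have h3 := te; have h4 := He.
have vertE : \forall q \near p, forall i, vert q (e i q) =
    if i is Some (inr j) then f (inr j) (rho q) else 0.
  apply: filterS3 h1 h2 h4 => q cq uq H i.
  rewrite /vert; have [_ ->] := H i; case: i => [s|] //=.
    by rewrite (P_fibred_frame Bc su uc ui s uq); case: s.
  have := P_id (@vertical_bundle0 _ _ _ E (rho q)).
  by [].
have dpirho : \forall q \near p, forall i, differential (pi \o rho) q (e i q) =
    if i is Some (inl j) then coord_field c j (pi (rho q)) else 0.
  apply: filterS3 h1 h2 h4 => q cq uq H i.
  rewrite pirhoE; have [_ ->] := H i; case: i => [s|] //=; last exact: differential0.
  by rewrite (differential_pi_frame Bc su uc ui s uq); case: s.
(* The Gram matrix is block diagonal: a unit normal field, a block pulled back from [B], and a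
   vertical block pulled back from [N]. The three properties of the model coefficients in the record
   are read off from this table. *)
pose hv (i j : I) q := match i, j with
  | None, None => 1
  | Some (inl i), Some (inl j) =>
     gB (pi (rho q)) (coord_field c i (pi (rho q))) (coord_field c j (pi (rho q)))
  | Some (inr i), Some (inr j) => gV (rho q) (f (inr i) (rho q)) (f (inr j) (rho q))
  | _, _ => 0 end.
have hE : \forall q \near p, forall i j, model_phi gV gB q (e i q) (e j q) = hv i j q.
  near=> q => i j.
  have cq : collar E q by near: q.
  have uq : cdom u (rho q) by near: q.
  have tq i' : tangent q (e i' q) by move: i'; near: q.
  have Hr i' : e i' q r = (i' == None)%:R by have H := near h4 q; case: (H _ i').
  rewrite /model_phi (near vertE q) // (near dpirho q) //.
  rewrite (near vertE q) // (near dpirho q) // !Hr.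
  have fv l : vertical_bundle pi (rho q) (f (inr l) (rho q)).
    exact: (dr_vertical Bc su uc ui).
  have ct l : tangent (pi (rho q)) (coord_field c l (pi (rho q))).
    by apply: (coord_field_tangent sc (@solidT _ _)); exact: uc.
  have gV00 : gV (rho q) 0 0 = 0.
    exact: (form0l (@V0 _) (gVL (y := _)) (V0 _)).
  have gB00 : gB (pi (rho q)) 0 0 = 0.
    exact: (form0l (@B0 _) (gBL (y := _)) (B0 _)).
  have gV0r l : gV (rho q) (f (inr l) (rho q)) 0 = 0.
    exact: (form0r (@V0 _) (gVC (y := _)) (gVL (y := _)) (fv l)).
  have gV0l l : gV (rho q) 0 (f (inr l) (rho q)) = 0.
    exact: (form0l (@V0 _) (gVL (y := _)) (fv l)).
  have gB0r l : gB (pi (rho q)) (coord_field c l (pi (rho q))) 0 = 0.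
    exact: (form0r (@B0 _) (gBC (y := _)) (gBL (y := _)) (ct l)).
  have gB0l l : gB (pi (rho q)) 0 (coord_field c l (pi (rho q))) = 0.
    exact: (form0l (@B0 _) (gBL (y := _)) (ct l)).
  case: i => [[i|i]|]; case: j => [[j|j]|] //=;
    by rewrite ?gV00 ?gB00 ?gV0l ?gV0r ?gB0l ?gB0r ?mulr0 ?mul0r ?mulr1 ?addr0 ?add0r.
have cdc : cdom c (pi (rho p)) by exact: uc.
have sgB i j : smooth_at (pi (rho p)) (fun z => gB z (coord_field c i z) (coord_field c j z)).
  by apply: gBS; exact: (coord_field_vfield sc (@solidT _ _)).
have sgV i j : smooth_at (rho p) (fun y => gV y (f (inr i) y) (f (inr j) y)).
  have sv l : section_near (vertical_bundle pi) (rho p) (f (inr l)).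
    apply: filterS2 (chart_dom_near su up) (fibred_frame_vfield su (inr l) up).
    move=> y uy [_ sy]; split=> //; exact: (dr_vertical Bc su uc ui).
  by apply: gVS.
split.
- exact: ve.
- exact: decomp.
- move=> X i vX.
  have sX f' : smooth_at p f' -> smooth_at p (fun q => X q f') by exact: vfield_smooth.
  have sxp := nbhs_singleton sx.
  case: i => [[j|j]|].
  + apply: smooth_at_eq (sX _ (sxp (Some (inl j)))).
    by apply: filterS th_x => q ->.
  + apply: smooth_at_eq (smooth_atD (sX _ (sxp (Some (inr j))))
      (smooth_at_sum (index_enum 'I_b) (P := xpredT) (F := fun l q =>
        P (rho q) (coord_field u (lshift k l) (rho q))
     (fun y => cmap u y ord0 (rshift b j)) * X q (x (Some (inl l)))) _)).
      by apply: filterS th_x => q ->.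
    move=> l _; apply: smooth_atM; last exact: sX (sxp (Some (inl l))).
    apply: ((rho_smooth cp).2 (fun y => P y (coord_field u (lshift k l) y) (fun y => cmap u y ord0 (rshift b j)))).
    apply: vfield_smooth (P_vfield _) (smooth_at_coord su _ up).
    exact: (coord_field_vfield su (@solidT _ _)).
  + exact: sX (r_smooth cp).
- move=> a a0.
  have up' := up; have H := nbhs_singleton He.
  have aN : a None = 0.
    have := congr1 (fun v => v r) a0; rewrite fct_sumE.
    rewrite (eq_bigr (fun i => a i * (i == None)%:R)) => [|i _]; last by rewrite -(H i).1.
    by rewrite (bigD1 None) //= big1 ?addr0 ?mulr1 // => -[s|//] _; rewrite mulr0.
  have aS : \sum_s a (Some s) *: f s (rho p) = 0.
    have := congr1 (differential rho p) a0.
    have E0 : a None *: differential rho p (e None p) = 0 by rewrite (H None).2 scaler0.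
    rewrite differential_sum differential0 (bigD1 None) // E0 /= add0r => h0.
    rewrite -[RHS]h0.
    rewrite [RHS](reindex_omap Some id) => [|[s|]] //=.
    apply: eq_big => s; first by rewrite eqxx.
    by move=> _; have /= -> := (H (Some s)).2.
  have al i : a (Some (inl i)) = 0.
    have := congr1 (fun w => w (fun y => cmap u y ord0 (lshift k i))) aS.
    rewrite fct_sumE (eq_bigr (fun s => a (Some s) * (s == inl i)%:R)) => [|s _]; last first.
      by rewrite -(fibred_frame_ul Bc su uc ui s i up).
    by rewrite (bigD1 (inl i)) //= big1 ?eqxx ?mulr1 ?addr0 // => s /negbTE ->; rewrite mulr0.
  (* Horizontal lifts also have fibre components, so the base coefficients must be known to vanish
     before the fibre coordinates are applied. *)
  have ar j : a (Some (inr j)) = 0.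
    have := congr1 (fun w => w (fun y => cmap u y ord0 (rshift b j))) aS.
    rewrite big_sumType /= [X in X + _]big1 ?add0r => [|i _]; last by rewrite al scale0r.
    rewrite fct_sumE (eq_bigr (fun m => a (Some (inr m)) * (m == j)%:R)) => [|m _]; last first.
      by rewrite -(fibred_frame_ur su (inr m) j up).
    by rewrite (bigD1 j) //= big1 ?eqxx ?mulr1 ?addr0 // => s /negbTE ->; rewrite mulr0.
  by case=> [[i|j]|].
- by apply: filterS h4 => q H i; case: (H i).
- by [].
- near=> q => i.
  have cq : collar E q by near: q.
  have uq : cdom u (rho q) by near: q.
  have tq : tangent q (e i q) by move: i; near: q.
  have Hr : e i q r = (i == None)%:R by have H := near h4 q; case: (H _ i).
  have Hd : differential rho q (e i q) = if i is Some s then f s (rho q) else 0.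
    by have H := near h4 q; case: (H _ i).
  have vq := near vertE q.
  case vi : (vt i); last first.
    apply: fpart_eq0 => //; rewrite vq //.
    by case: i vi {tq Hr Hd} => [[]|].
  apply: fpart_id => //; first by rewrite Hr; case: i vi {tq Hr Hd}.
  rewrite Hd; case: i vi {tq Hr Hd} => [[//|j]|//] _.
  exact: (dr_vertical Bc su uc ui).
- move=> i j l; have sxp := nbhs_singleton sx.
  apply: smooth_atB; apply: vfield_smooth => //; exact: vfield_smooth.
- have e_x' : \forall q \near p, \forall q' \near q, forall i l, ~~ vt l -> e i q' (x l) = (i == l)%:R.
    exact: near_join.
  near=> q => i j tb.
  have tq i' : tangent q (e i' q) by move: i'; near: q.
  have exq := near e_x' q.
  have sxq l : smooth_at q (x l) by move: l; near: q.
  have bx l : lie_bracket (e i) (e j) q (x l) = cc i j l q.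
    by rewrite /lie_bracket /on_germs; case: asboolP.
  (* On non-vertical coordinates the frame fields take constant values, and the bracket
     differentiates these constants. *)
  have c0 l : ~~ vt l -> cc i j l q = 0.
    move=> nl; rewrite /cc.
    rewrite (@tangent_eq _ _ _ _ _ _ _ (fun=> (j == l)%:R) (tq i)); last first.
      by apply: filterS (exq _) => // q' ->.
    rewrite (@tangent_eq _ _ _ _ _ _ _ (fun=> (i == l)%:R) (tq j)); last first.
      by apply: filterS (exq _) => // q' ->.
    by rewrite (tangent_cst _ (tq i)) (tangent_cst _ (tq j)) subrr.
  rewrite {1}(near decomp q _ _ tb) // [RHS]big_mkcond /=.
  apply: eq_bigr => l _; rewrite (near th_x q) //.
  case: l => [[l|l]|]; rewrite /= !bx.
  + by rewrite c0 // scale0r.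
  + by rewrite big1 ?addr0 // => m _; rewrite bx c0 // mulr0.
  + by rewrite c0 // scale0r.
- move=> i j; apply: (@smooth_at_eq _ _ _ _ p (hv i j)).
    by apply: filterS hE => q ->.
  case: i => [[i|i]|]; case: j => [[j|j]|]; try exact: smooth_at_cst.
    exact: ((pirho_smooth cp).2 _ (sgB i j)).
  exact: ((rho_smooth cp).2 _ (sgV i j)).
- by apply: filterS hE => q H i j; rewrite H; case: i j => [[i|i]|] [[j|j]|].
- have hE' : \forall q \near p, \forall q' \near q, forall i j, model_phi gV gB q' (e i q') (e j q') = hv i j q' := near_join hE.
  have sB : \forall q \near p, forall i j, smooth_at (pi (rho q)) (fun z => gB z (coord_field c i z) (coord_field c j z)).
    apply: (@filter_forall _ _ (fun i q => forall j, smooth_at (pi (rho q)) (fun z => gB z (coord_field c i z) (coord_field c j z))) (nbhs p)) => i.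
    apply: (@filter_forall _ _ (fun j q => smooth_at (pi (rho q)) (fun z => gB z (coord_field c i z) (coord_field c j z))) (nbhs p)) => j.
    exact: (smooth_map_near (pirho_smooth cp) (smooth_at_near (sgB i j))).
  near=> q => i j l vj nvi nvl.
  have tq i' : tangent q (e i' q) by move: i'; near: q.
  have hEq : \forall q' \near q, model_phi gV gB q' (e i q') (e l q') = hv i l q'.
    apply: filterS (near hE' q _) => // q' H; exact: H.
  rewrite (tangent_eq (tq j) hEq).
  (* The coefficients on non-vertical pairs are constants or functions pulled back by [pi \o rho],
     whose differential kills the vertical field [e j]. *)
  have dj : differential (pi \o rho) q (e j q) = 0.
    by rewrite (near dpirho q) //; case: j vj {tq} => [[]|].
  case: i l nvi nvl {hEq} => [[i|//]|] [[l|//]|] _ _; try exact: tangent_cst (tq j).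
  have sBq : smooth_at (pi (rho q)) (fun z => gB z (coord_field c i z) (coord_field c l z)).
    by move: i l; near: q.
  rewrite -[LHS](differential_smooth (f := pi \o rho) (p := q) (e j q) sBq).
  by rewrite dj.
Unshelve. all: by end_near. Qed.

End Build.

Lemma adapted_frame_exists p : collar E p -> exists I i0 vt e th c,
  @adapted_frame p I i0 vt e th c.
Proof.
move=> cp; have [k [c [u [Bc su up uc ui]]]] := fibred_chart (em_rho E p).
have [e0 [ve0 He0]] := collar_normal cp.
have /choice[es Hes] : forall s, exists X : E -> tvec R E, vfield_near p X /\
    \forall q \near p, X q r = 0 /\ differential rho q (X q) = @fibred_frame R n b E k u s (rho q).
  by move=> s; apply: collar_lift => //; exact: fibred_frame_vfield.
have := adapted_frame_build Bc su uc ui cp up ve0 He0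
  (fun s => (Hes s).1) (fun s => (Hes s).2).
set e := (X in adapted_frame _ _ _ X _ _).
by move=> H; do 6 eexists; exact: H.
Qed.

End AdaptedFrame.

(** * The Koszul formula in an adapted frame *)

Section SmoothMatrices.
Context {R : realType} {n : nat} {H : set 'rV[R]_n} {M : manifold H}.
Implicit Types (p : M).

Lemma smooth_at_det p m (A : M -> 'M[R]_m) :
  (forall i j, smooth_at p (fun q => A q i j)) -> smooth_at p (fun q => \det (A q)).
Proof.
move=> sA; apply: smooth_at_sum => s _.
apply: smooth_atM; first exact: smooth_at_cst.
by apply: smooth_at_prod => i _; exact: sA.
Qed.

Lemma smooth_at_adj p m (A : M -> 'M[R]_m) i j :
  (forall i j, smooth_at p (fun q => A q i j)) ->
  smooth_at p (fun q => (\adj (A q)) i j).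
Proof.
move=> sA; apply: (@smooth_at_eq _ _ _ _ _ (fun q => cofactor (A q) j i)).
  by near=> q; rewrite mxE.
apply: smooth_atM; first exact: smooth_at_cst.
apply: smooth_at_det => i' j'.
by under eq_fun do rewrite !mxE; exact: sA.
Unshelve. all: by end_near. Qed.

(** Cramer's rule: [hi] is the adjugate divided by the determinant, which is nonzero at [p] by the
    injectivity assumption and hence near [p]. The solution formula is pointwise in [q], for
    arbitrary [a] and [K], because it is applied to Christoffel symbols that are controlled only at
    interior points. *)
Lemma smooth_linear_solve p (I : finType) (h : I -> I -> M -> R) :
  (forall i j, smooth_at p (h i j)) ->
  (forall a : I -> R, (forall l, \sum_k a k * h k l p = 0) -> forall k, a k = 0) ->
  exists hi : I -> I -> M -> R, (forall i j, smooth_at p (hi i j)) /\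
    \forall q \near p, forall a K : I -> R,
      (forall l, \sum_k a k * h k l q = K l) ->
      forall m, a m = \sum_l K l * hi l m q.
Proof.
move=> sh h0; pose A q : 'M[R]_#|I| := \matrix_(i, j) h (enum_val i) (enum_val j) q.
have sA i j : smooth_at p (fun q => A q i j).
  by under eq_fun do rewrite mxE; exact: sh.
have sdet := smooth_at_det sA.
have sumE (F : I -> R) : \sum_k F k = \sum_(i < #|I|) F (enum_val i).
  exact: (@big_enum_val _ _ _ I I F).
have d0 : \det (A p) != 0.
  apply/negP => /det0P[v v0 vA]; case/eqP: v0; apply/rowP => i.
  have ev : forall k, v ord0 (enum_rank k) = 0.
    apply: h0 => l; have /rowP/(_ (enum_rank l)) := vA.
    rewrite !mxE sumE => vAl; rewrite -[RHS]vAl; apply: eq_bigr => k _.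
    by rewrite enum_valK mxE enum_rankK.
  by rewrite -[i in LHS]enum_valK ev mxE.
exists (fun l m q => (\adj (A q)) (enum_rank l) (enum_rank m) * (\det (A q))^-1).
split=> [i j|].
  by apply: smooth_atM; [exact: smooth_at_adj|exact: smooth_atV].
apply: filterS (smooth_at_neq0 sdet d0) => q dq a K HK m.
pose v : 'rV[R]_#|I| := \row_i a (enum_val i).
pose w : 'rV[R]_#|I| := \row_i K (enum_val i).
have vA : v *m A q = w.
  apply/rowP => l; rewrite !mxE -HK sumE; apply: eq_bigr => i _.
  by rewrite !mxE.
have vd : \det (A q) *: v = w *m \adj (A q).
  by rewrite -vA -mulmxA mul_mx_adj mul_mx_scalar.
have /rowP/(_ (enum_rank m)) := vd.
rewrite !mxE enum_rankK => e.
apply: (mulfI dq); rewrite e mulr_sumr sumE; apply: eq_bigr => l _.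
rewrite !mxE enum_valK; field.
exact: dq.
Qed.

End SmoothMatrices.

(** * The Koszul formula and brackets of rescaled fields *)

Section Koszul.
Context {R : realType} {n : nat} {H : set 'rV[R]_n} {M : manifold H}.
Variables (O : set M) (G : M -> tvec R M -> tvec R M -> R)
  (D : covariant_derivative M).
Hypotheses (sH : solid H) (LC : levi_civita O G D).
Hypothesis GC : forall q u v, O q -> tangent q u -> tangent q v -> G q u v = G q v u.
Hypothesis GL : forall q (k : R) u v w, O q -> tangent q u -> tangent q v ->
  tangent q w -> G q (k *: u + v) w = k * G q u w + G q v w.

Implicit Types X Y Z : M -> tvec R M.

Lemma levi_civita_connection : connection O D.
Proof. by case: LC. Qed.

(** Vanishing torsion writes the bracket as a difference of covariant derivatives, which are
    tangent. This discharges the tangency premise in [af_bracket]. *)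
Lemma lie_bracket_tangent q X Y : O q -> vfield_near q X -> vfield_near q Y ->
  tangent q (lie_bracket X Y q).
Proof.
case: LC => cD T _ Oq vX vY; rewrite -T //.
have tD := connection_tangent cD sH Oq.
by apply: tangentB; apply: tD => //; exact: vfield_tangent.
Qed.

(** Metric compatibility expands the three derivatives, vanishing torsion expands the three
    brackets, and symmetry of [G] cancels everything except two equal terms. *)
Lemma koszul q X Y Z : O q -> vfield_near q X -> vfield_near q Y -> vfield_near q Z ->
  2 * G q (D q (X q) Y) (Z q) =
  X q (fun q' => G q' (Y q') (Z q')) + Y q (fun q' => G q' (Z q') (X q'))
  - Z q (fun q' => G q' (X q') (Y q'))
  + G q (lie_bracket X Y q) (Z q) - G q (lie_bracket X Z q) (Y q)
  - G q (lie_bracket Y Z q) (X q).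
Proof.
case: LC => cD T C Oq vX vY vZ.
have tX := vfield_tangent vX; have tY := vfield_tangent vY; have tZ := vfield_tangent vZ.
have tD A B : vfield_near q A -> vfield_near q B -> tangent q (D q (A q) B).
  by move=> vA vB; apply: (connection_tangent cD sH) => //; exact: vfield_tangent.
have GB u v w : tangent q u -> tangent q v -> tangent q w ->
    G q (u - v) w = G q u w - G q v w.
  move=> tu tv tw; rewrite (_ : u - v = (-1) *: v + u); last by rewrite scaleN1r addrC.
  by rewrite GL // mulN1r addrC.
rewrite (C q _ Y Z Oq tX vY vZ) (C q _ Z X Oq tY vZ vX) (C q _ X Y Oq tZ vX vY).
rewrite -!T // !GB //; try exact: tD.
rewrite [G q (Y q) (D q (X q) Z)]GC //; last exact: tD.
rewrite [G q (Z q) (D q (Y q) X)]GC //; last exact: tD.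
rewrite [G q (X q) (D q (Z q) Y)]GC //; last exact: tD.
ring.
Qed.

Lemma lie_bracketZr q X f Y : O q -> vfield_near q X -> vfield_near q Y ->
  smooth_at q f ->
  lie_bracket X (fun q' => f q' *: Y q') q = f q *: lie_bracket X Y q + X q f *: Y q.
Proof.
move=> Oq vX vY sf; have tX := vfield_tangent vX.
have tY := vfield_tangent vY.
apply/funext => g.
rewrite -[RHS]/(f q * lie_bracket X Y q g + X q f * Y q g).
rewrite /lie_bracket /on_germs; case: asboolP => [sg|nsg]; last first.
  by rewrite (tangent0 tY nsg) !mulr0 addr0.
rewrite -[X in X - _ = _]/(X q (fun q' => f q' * Y q' g)).
rewrite (tangent_mul tX sf (vfield_smooth vY sg)).
rewrite -[X in _ - X = _]/(f q * Y q (fun q' => X q' g)).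
ring.
Qed.

Lemma lie_bracketC q X Y : lie_bracket X Y q = - lie_bracket Y X q.
Proof.
apply/funext => g; rewrite /lie_bracket /on_germs fctE.
by case: asboolP => // _; rewrite ?opprB ?oppr0.
Qed.

Lemma lie_bracketZl q X f Y : O q -> vfield_near q X -> vfield_near q Y ->
  smooth_at q f ->
  lie_bracket (fun q' => f q' *: X q') Y q = f q *: lie_bracket X Y q - Y q f *: X q.
Proof.
move=> Oq vX vY sf; rewrite lie_bracketC lie_bracketZr // opprD.
by rewrite -scalerN -(lie_bracketC q X Y).
Qed.

End Koszul.

Section FrameKoszul.
Context {R : realType} {n b : nat} {E : edge_manifold R n b}.
Variables (gV : em_N E -> tvec R (em_N E) -> tvec R (em_N E) -> R)
  (gB : em_B E -> tvec R (em_B E) -> tvec R (em_B E) -> R).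
Local Notation r := (em_r E).
Implicit Types (q : E).
Variables (p : E) (I : finType) (i0 : I) (vt : pred I)
    (e : I -> E -> tvec R E) (th : I -> E -> tvec R E -> R)
    (c : I -> I -> I -> E -> R).
Hypotheses (cp : collar E p) (AF : adapted_frame gV gB p i0 vt e th c).

Let sH := @solid_halfspace R n.

(** [phi] multiplies [e i] by [frame_scale i]. *)
Definition frame_scale i q : R := if vt i then r q else 1.

(** The derivative of [frame_scale j] along [e i]. *)
Definition frame_scale_deriv (i j : I) : R := (vt j && (i == i0))%:R.

Definition bracket_form (h : I -> I -> E -> R) i j l q : R :=
  \sum_(k | vt k) c i j k q * h k l q.

(** Twice the covariant derivative of [e j] along [e i], paired with [e l], for
    the connection conjugated by [phi], when the metric conjugated by [phi] has
    coefficients [h]. *)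
Definition koszul_form (h : I -> I -> E -> R) i j l q : R :=
  e i q (h j l)
  + (frame_scale j q)^-1 * (frame_scale i q * e j q (h l i) + frame_scale_deriv j i * h l i q)
  - (frame_scale l q)^-1 * (frame_scale i q * e l q (h i j) + frame_scale_deriv l i * h i j q)
  + ((frame_scale j q)^-1 * r q * bracket_form h i j l q - (frame_scale j q)^-1 * frame_scale_deriv i j * h j l q)
  - ((frame_scale l q)^-1 * r q * bracket_form h i l j q - (frame_scale l q)^-1 * frame_scale_deriv i l * h l j q)
  - ((frame_scale j q)^-1 * (frame_scale l q)^-1 * r q * frame_scale i q * bracket_form h j l i q
     - (frame_scale j q)^-1 * (frame_scale l q)^-1 * frame_scale_deriv j l * frame_scale i q * h l i q
     + (frame_scale l q)^-1 * (frame_scale j q)^-1 * frame_scale_deriv l j * frame_scale i q * h j i q).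

Lemma frame_vfield_near : \forall q \near p, forall i, vfield_near q (e i).
Proof.
apply: (@filter_forall _ _ (fun i q => vfield_near q (e i)) (nbhs p)) => i.
exact/section_near_near/(af_vfield AF).
Qed.

Lemma frame_tangent_near : \forall q \near p, forall i, tangent q (e i q).
Proof. by apply: filterS frame_vfield_near => q H i; exact: vfield_tangent. Qed.

Lemma frame_scale_neq0 i q : collar_interior E q -> frame_scale i q != 0.
Proof.
by move=> /collar_interiorP[_ rq]; rewrite /frame_scale; case: ifP; rewrite ?oner_neq0 ?lt_eqF.
Qed.

Lemma frame_scale_smooth i q : collar E q -> smooth_at q (frame_scale i).
Proof.
move=> cq; rewrite /frame_scale; case: (vt i); [exact: r_smooth|exact: smooth_at_cst].
Qed.

Lemma frame_scaleE : \forall q \near p, forall i j, e i q (frame_scale j) = frame_scale_deriv i j.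
Proof.
apply: filterS2 (af_r AF) frame_tangent_near => q er te i j; rewrite /frame_scale /frame_scale_deriv.
by case: (vt j); [exact: er|exact: tangent_cst (te i)].
Qed.

Lemma frame_phi_inv : \forall q \near p, collar_interior E q -> forall i,
  phi_inv q (e i q) = (frame_scale i q)^-1 *: e i q.
Proof.
apply: filterS2 (af_fpart AF) frame_tangent_near => q fe te iq i.
rewrite /phi_inv /frame_scale fe; case: ifP => _; first by rewrite subrr addr0.
by rewrite scaler0 add0r subr0 invr1 scale1r.
Qed.

Lemma phiK q v : collar_interior E q -> tangent q v -> phi_inv q (phi q v) = v.
Proof.
move=> /collar_interiorP[cq rq] tv; rewrite phi_invE phiE.
by rewrite -{2}[em_r E q]invrK fscaleK // invr_neq0 // lt_eqF.
Qed.

Section Metric.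
Variables (G : E -> tvec R E -> tvec R E -> R) (D : covariant_derivative E).
Hypothesis LC : levi_civita (collar_interior E) G D.
Hypothesis GC : forall q u v, collar_interior E q -> tangent q u -> tangent q v ->
  G q u v = G q v u.
Hypothesis GL : forall q (k : R) u v w, collar_interior E q -> tangent q u ->
  tangent q v -> tangent q w -> G q (k *: u + v) w = k * G q u w + G q v w.
Variable h : I -> I -> E -> R.
Hypothesis sh : forall i j, smooth_at p (h i j).
Hypothesis Gh : \forall q \near p, collar_interior E q -> forall i j,
  phi_form G q (e i q) (e j q) = h i j q.

(** Put [ep i = e i / s_i], so that [G] has coefficients [h] on the fields [ep]. Undoing the
    conjugation, the left side is [2 G (D_(e i) (ep j)) (ep l)], and the Koszul formula is applied
    to [e i], [ep j], [ep l]. Only the last two fields are rescaled, whence the factors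
    [frame_scale i] in the result. *)
Lemma koszul_formE : \forall q \near p, collar_interior E q -> forall i j l,
  2 * phi_form G q (phi_conj D q (e i q) (e j)) (e l q) = koszul_form h i j l q.
Proof.
have cD := levi_civita_connection LC.
have n1 := frame_vfield_near; have n2 := frame_scaleE.
have n3 := near_join frame_phi_inv; have n4 := near_join Gh.
have n5 := af_bracket AF.
have n6 := smooth_at_near2 sh.
near=> q => iq i j l.
have cq : collar E q by case: iq.
have ve i' : vfield_near q (e i') by move: i'; near: q.
have te i' : tangent q (e i' q) by exact: vfield_tangent.
have shq i' j' : smooth_at q (h i' j') by move: i' j'; near: q.
have es i' j' : e i' q (frame_scale j') = frame_scale_deriv i' j' by move: i' j'; near: q.
have ni := collar_interior_near iq.
have s0 i' := frame_scale_neq0 i' iq.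
have ss i' := frame_scale_smooth i' cq.
have ssV i' := smooth_atV (s0 i') (ss i').
pose ep i' q' := (frame_scale i' q')^-1 *: e i' q'.
have vep i' : vfield_near q (ep i') by exact: vfieldZ.
have tep i' : tangent q (ep i' q) by exact: vfield_tangent.
have pe : \forall q' \near q, forall i', phi_inv q' (e i' q') = ep i' q'.
  have h3 : \forall q' \near q, collar_interior E q' -> forall i,
      phi_inv q' (e i q') = (frame_scale i q')^-1 *: e i q' by near: q.
  by apply: filterS2 ni h3 => q' iq'; exact.
have Gep : \forall q' \near q, forall i' j', G q' (ep i' q') (ep j' q') = h i' j' q'.
  have h4 : \forall q' \near q, collar_interior E q' -> forall i j,
      phi_form G q' (e i q') (e j q') = h i j q' by near: q.
  by apply: filterS3 ni h4 pe => q' iq' H4 Hp i' j'; rewrite -H4 // /phi_form !Hp.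
have te' : \forall q' \near q, forall i', tangent q' (e i' q').
  apply: (@filter_forall _ _ (fun i q => tangent q (e i q)) (nbhs q)) => i'.
  exact: vfield_tangent_near.
have eE : \forall q' \near q, forall i', e i' q' = frame_scale i' q' *: ep i' q'.
  by apply: filterS ni => q' iq' i'; rewrite /ep scalerA mulfV ?scale1r // frame_scale_neq0.
have tep' : \forall q' \near q, forall i', tangent q' (ep i' q').
  by apply: filterS te' => q' t i'; exact: tangentZ.
have Gr : \forall q' \near q, forall i' j', G q' (e i' q') (ep j' q') = frame_scale i' q' * h i' j' q'.
  near=> q' => i' j'; rewrite (near eE q') //.
  have iq' : collar_interior E q' by near: q'.
  have t' i2 : tangent q' (ep i2 q') by move: i2; near: q'.
  rewrite (formZl (tangent_zero q') (fun k u v w => @GL q' k u v w iq')) //.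
  by rewrite (near Gep q').
have Gl : \forall q' \near q, forall i' j', G q' (ep i' q') (e j' q') = frame_scale j' q' * h i' j' q'.
  near=> q' => i' j'; rewrite (near eE q') //.
  have iq' : collar_interior E q' by near: q'.
  have t' i2 : tangent q' (ep i2 q') by move: i2; near: q'.
  rewrite (formZr (tangent_zero q') (@tangent_linear _ _ _ _ q')
    (fun u v => @GC q' u v iq') (fun k u v w => @GL q' k u v w iq')) //.
  by rewrite (near Gep q').
have Gll : forall i' j', G q (e i' q) (e j' q) = frame_scale i' q * (frame_scale j' q * h i' j' q).
  move=> i' j'; rewrite {1}(nbhs_singleton eE i').
  rewrite (formZl (tangent_zero q) (fun k u v w => @GL q k u v w iq)) //.
  by rewrite (nbhs_singleton Gl).
have tb X Y : vfield_near q X -> vfield_near q Y -> tangent q (lie_bracket X Y q).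
  exact: (lie_bracket_tangent sH LC).
have eb i' j' : lie_bracket (e i') (e j') q = \sum_(k | vt k) c i' j' k q *: e k q.
  by apply: (near n5 q) => //; exact: tb.
have eV i' j' : e i' q (fun q' => (frame_scale j' q')^-1) = - (frame_scale j' q)^-1 ^+ 2 * frame_scale_deriv i' j'.
  by rewrite (tangent_inv (te i') (ss j') (s0 j')) es.
have Gsum i' j' w : tangent q w -> G q (lie_bracket (e i') (e j') q) w =
    \sum_(k | vt k) c i' j' k q * G q (e k q) w.
  move=> tw; rewrite eb.
  by rewrite (form_suml (tangent_zero q) (@tangent_linear _ _ _ _ q) (fun k u v w => @GL q k u v w iq)).
(* Brackets are combinations of vertical [e k = r ep k]; the resulting factor [r] offsets one
   inverse scale. *)
have Gbr i' j' l' : G q (lie_bracket (e i') (e j') q) (ep l' q) = r q * bracket_form h i' j' l' q.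
  rewrite Gsum // /bracket_form mulr_sumr; apply: eq_bigr => k vk.
  by rewrite (nbhs_singleton Gr) /frame_scale vk; ring.
have Gbl i' j' l' : G q (lie_bracket (e i') (e j') q) (e l' q) = r q * frame_scale l' q * bracket_form h i' j' l' q.
  rewrite Gsum // /bracket_form mulr_sumr; apply: eq_bigr => k vk.
  by rewrite Gll {1}/frame_scale vk; ring.
have GZD (k1 k2 : R) u v w : tangent q u -> tangent q v -> tangent q w ->
    G q (k1 *: u + k2 *: v) w = k1 * G q u w + k2 * G q v w.
  move=> tu tv tw; rewrite GL //; last exact: tangentZ.
  by rewrite (formZl (tangent_zero q) (fun k u v w => @GL q k u v w iq)).
have tD i' : tangent q (D q (e i q) (ep i')) by exact: (connection_tangent cD).
have vinv : vfield_near q (fun q' => phi_inv q' (e j q')).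
  by apply: section_near_eq (vep j); apply: filterS pe => q' ->.
rewrite /phi_form /phi_conj phiK //; last first.
  exact: (connection_tangent cD).
rewrite (@connection_eq _ _ _ _ _ _ cD q (e i q) _ (ep j)) //; last first.
  by apply: filterS pe => q' ->.
rewrite (nbhs_singleton pe) (koszul sH LC GC GL) //.
rewrite (@tangent_eq _ _ _ _ q (e i q) _ (h j l)) //; last first.
  by apply: filterS Gep => q' ->.
rewrite (@tangent_eq _ _ _ _ q (ep j q) _ (fun q' => frame_scale i q' * h l i q')) //; last first.
  by apply: filterS Gl => q' ->.
rewrite (@tangent_eq _ _ _ _ q (ep l q) _ (fun q' => frame_scale i q' * h i j q')) //; last first.
  by apply: filterS Gr => q' ->.
rewrite (tangent_mul (tep j) (ss i) (shq l i)) (tangent_mul (tep l) (ss i) (shq i j)).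
have epE i' f : ep i' q f = (frame_scale i' q)^-1 * e i' q f by [].
rewrite !epE !es.
(* The Leibniz rule for brackets differentiates the inverse scales; this is the origin of the
   [frame_scale_deriv] terms in the last two lines of brackets of [koszul_form]. *)
rewrite (lie_bracketZr iq (ve i) (ve j) (ssV j)) (lie_bracketZr iq (ve i) (ve l) (ssV l)).
rewrite (lie_bracketZl iq (ve j) (vep l) (ssV j)).
rewrite (lie_bracketZr iq (ve j) (ve l) (ssV l)).
rewrite -scaleNr !GZD //; try exact: tb; last first.
  by apply: tangentD; apply: tangentZ => //; exact: tb.
rewrite !eV !epE !eV !Gbr Gbl !(nbhs_singleton Gr) !Gll /koszul_form.
move: (s0 i) (s0 j) (s0 l) => si sj sl.
by field; rewrite ?sj ?sl.
Unshelve. all: by end_near. Qed.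

End Metric.
End FrameKoszul.

(** * Poles of the Koszul expression *)

Section KoszulRegular.
Context {R : realType} {n b : nat} {E : edge_manifold R n b}.
Variables (gV : em_N E -> tvec R (em_N E) -> tvec R (em_N E) -> R)
  (gB : em_B E -> tvec R (em_B E) -> tvec R (em_B E) -> R).
Local Notation r := (em_r E).
Implicit Types (q : E).
Variables (p : E) (I : finType) (i0 : I) (vt : pred I)
    (e : I -> E -> tvec R E) (th : I -> E -> tvec R E -> R)
    (c : I -> I -> I -> E -> R).
Hypotheses (cp : collar E p) (AF : adapted_frame gV gB p i0 vt e th c).
Local Notation fs := (@frame_scale R n b E I vt).
Local Notation dfs := (@frame_scale_deriv R I i0 vt).
Local Notation cform := (@bracket_form R n b E I vt c).
Local Notation K := (@koszul_form R n b E I i0 vt e c).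

(** This is [r / s_i] in smooth form; writing [1 / s_i] as [ga i / r] isolates the pole. *)
Let ga i q : R := if vt i then 1 else r q.

Let ga_fs i q : collar_interior E q -> (fs i q)^-1 = ga i q / r q.
Proof.
move=> /collar_interiorP[_ rq]; rewrite /frame_scale /ga; case: ifP => _.
  by rewrite mul1r.
by rewrite mulfV ?invr1 // lt_eqF.
Qed.

(** A scale has nonzero derivative only along [e i0], whose own scale is 1 because [i0] is not
    vertical. This reduces the apparent double poles to simple ones. *)
Let dfs_fs i j q : (fs i q)^-1 * dfs i j = dfs i j.
Proof.
rewrite /frame_scale_deriv /frame_scale; have := af_i0 AF.
case: eqP => [->|_] nv; last by rewrite andbF mulr0.
by rewrite (negbTE nv) invr1 mul1r.
Qed.

Let dfs2 i j q : (fs i q)^-1 * (fs j q)^-1 * dfs i j = (fs j q)^-1 * dfs i j.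
Proof. by rewrite mulrAC dfs_fs mulrC. Qed.

Let ga_smooth i : smooth_at p (ga i).
Proof.
by rewrite /ga; case: (vt i); [exact: smooth_at_cst|exact: r_smooth].
Qed.

Let fs_sm i : smooth_at p (fs i). Proof. exact: frame_scale_smooth. Qed.

Let e_sm i f : smooth_at p f -> smooth_at p (fun q => e i q f).
Proof. exact: vfield_smooth (af_vfield AF i). Qed.

Let cform_smooth h i j l : (forall i j, smooth_at p (h i j)) -> smooth_at p (cform h i j l).
Proof.
move=> sh; apply: smooth_at_sum => k _; apply: smooth_atM; last exact: sh.
exact: (af_c_smooth AF).
Qed.

Let in_near : \forall q \near p, collar_interior E q -> r q != 0.
Proof. by near=> q => /collar_interiorP[_ rq]; rewrite lt_eqF. Unshelve. all: by end_near. Qed.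

Ltac smooth_tac := repeat first [ exact: r_smooth | exact: ga_smooth | exact: fs_sm |
  exact: smooth_at_cst | match goal with H : forall _ _, smooth_at _ _ |- _ => exact: H end |
  apply: cform_smooth | apply: e_sm |
  apply: smooth_atB | apply: smooth_atD | apply: smooth_atN | apply: smooth_atM ].

(** The coefficients of [K] have at most simple poles. *)
Lemma koszul_form_r_regular (h : I -> I -> E -> R) i j l : (forall i j, smooth_at p (h i j)) ->
  regular p (fun q => r q * K h i j l q).
Proof.
move=> sh; apply: (@regular_eq _ _ _ _ p (fun q =>
  r q * e i q (h j l) + ga j q * (fs i q * e j q (h l i) + dfs j i * h l i q)
  - ga l q * (fs i q * e l q (h i j) + dfs l i * h i j q)
  + (ga j q * r q * cform h i j l q - ga j q * dfs i j * h j l q)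
  - (ga l q * r q * cform h i l j q - ga l q * dfs i l * h l j q)
  - (ga j q * ga l q * fs i q * cform h j l i q
     - ga l q * dfs j l * fs i q * h l i q
     + ga j q * dfs l j * fs i q * h j i q))).
  apply: filterS in_near => q rq iq; rewrite /koszul_form.
  rewrite !dfs2 !ga_fs //.
  by field; exact: rq.
apply: regular_smooth; smooth_tac.
Qed.

Lemma koszul_form_add (h h' : I -> I -> E -> R) : (forall i j, smooth_at p (h i j)) ->
  (forall i j, smooth_at p (h' i j)) -> \forall q \near p, forall i j l,
  K (fun i j q => h i j q + h' i j q) i j l q = K h i j l q + K h' i j l q.
Proof.
move=> sh sh'.
apply: filterS3 (frame_tangent_near AF) (smooth_at_near2 sh) (smooth_at_near2 sh')
  => q te s s' i j l.
have ea i' j' l' : e i' q (fun q => h j' l' q + h' j' l' q) = e i' q (h j' l') + e i' q (h' j' l').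
  exact: tangent_add.
have ca i' j' l' : cform (fun i j q => h i j q + h' i j q) i' j' l' q =
    cform h i' j' l' q + cform h' i' j' l' q.
  by rewrite /bracket_form -big_split; apply: eq_bigr => k _; rewrite mulrDr.
rewrite /koszul_form !ea !ca; ring.
Qed.

(** The terms of [K (r a)] in which the factor [r] is differentiated; its derivative along [e i] is
    1 for [i = i0] and 0 otherwise. *)
Definition koszul_corr (a : I -> I -> E -> R) (i j l : I) (q : E) : R :=
  (i == i0)%:R * a j l q + (j == i0)%:R * fs i q * a l i q
  - (l == i0)%:R * fs i q * a i j q.

(** Only the three derivative terms of [K] notice that [r] is not constant. An inverse scale in
    front of one of them belongs to the differentiating field, which must be [e i0] for a correction
    to arise, so the correction has no pole. *)
Lemma koszul_form_scale (a : I -> I -> E -> R) : (forall i j, smooth_at p (a i j)) ->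
  \forall q \near p, forall i j l,
  K (fun i j q => r q * a i j q) i j l q = r q * K a i j l q + koszul_corr a i j l q.
Proof.
move=> sa.
have ns := smooth_at_near2 sa.
have h1 := frame_tangent_near AF; have h2 := collar_near cp; have h3 := af_r AF.
near=> q => i j l.
have te i' : tangent q (e i' q) by move: i'; near: q.
have cq : collar E q by near: q.
have s i' j' : smooth_at q (a i' j') by move: i' j'; near: q.
have er i' : e i' q r = (i' == i0)%:R by move: i'; near: q.
have ea i' j' l' : e i' q (fun q => r q * a j' l' q) = r q * e i' q (a j' l') + (i' == i0)%:R * a j' l' q.
  by rewrite (tangent_mul (te i') (r_smooth cq) (s j' l')) er.
have ca i' j' l' : cform (fun i j q => r q * a i j q) i' j' l' q = r q * cform a i' j' l' q.
  by rewrite /bracket_form mulr_sumr; apply: eq_bigr => k _; rewrite mulrCA.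
have sd i' : (fs i' q)^-1 * (i' == i0)%:R = (i' == i0)%:R.
  rewrite /frame_scale; case: eqP => [->|_]; last by rewrite mulr0.
  by rewrite (negbTE (af_i0 AF)) invr1 mul1r.
rewrite /koszul_form /koszul_corr !ea !ca -[in RHS](sd j) -[in RHS](sd l); ring.
Unshelve. all: by end_near. Qed.

Let h0 i j q := model_phi gV gB q (e i q) (e j q).
Hypothesis h0C : \forall q \near p, forall i j, h0 i j q = h0 j i q.

(** The poles cancel for the model metric: either a mixed coefficient or a
    vertical derivative of a horizontal one vanishes, or the two poles have
    opposite residues. *)
Lemma koszul_form_model_regular i j l : regular p (K h0 i j l).
Proof.
have sh : forall i j, smooth_at p (h0 i j) := af_h_smooth AF.
have mixed : \forall q \near p, forall i j, vt i -> ~~ vt j -> h0 i j q = 0 := af_h_mixed AF.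
have mixed' : \forall q \near p, forall i j, vt i -> ~~ vt j -> h0 j i q = 0.
  by apply: filterS2 mixed h0C => q H C i' j' *; rewrite C H.
(* If [l] is vertical, the coefficient is mixed and vanishes near [q]; otherwise [af_h_vert]
   applies. *)
have e0 : \forall q \near p, forall i j l, vt j -> ~~ vt i -> e j q (h0 l i) = 0.
  apply: filterS3 (frame_tangent_near AF) (near_join mixed) (af_h_vert AF).
  move=> q te mx hv i' j' l' vj nvi; case vl : (vt l'); last by apply: hv => //; rewrite vl.
  rewrite (@tangent_eq _ _ _ _ q _ _ (fun=> 0) (te j')) ?(tangent_cst _ (te j')) //.
  by apply: filterS mx => q' ->.
(* Either [s_j'] is 1, or both fields are vertical and the scales cancel, or the derivative vanishes
   by [e0]. *)
have A2 i' j' l' : regular p (fun q => (fs j' q)^-1 * (fs i' q * e j' q (h0 l' i'))).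
  have [vj|nvj] := boolP (vt j'); last first.
    apply: (@regular_eq _ _ _ _ p (fun q => fs i' q * e j' q (h0 l' i'))).
      by near=> q; rewrite /frame_scale (negbTE nvj) invr1 mul1r.
    by apply: regular_smooth; smooth_tac.
  have [vi|nvi] := boolP (vt i').
    apply: (@regular_eq _ _ _ _ p (fun q => e j' q (h0 l' i'))).
      by apply: filterS in_near => q rq iq; rewrite /frame_scale vi vj mulKf // rq.
    by apply: regular_smooth; smooth_tac.
  apply: (@regular_eq _ _ _ _ p (fun=> 0)); last exact/regular_smooth/smooth_at_cst.
  by apply: filterS e0 => q H _; rewrite H // !mulr0.
have A4 i' j' l' : regular p (fun q => (fs j' q)^-1 * r q * cform h0 i' j' l' q).
  apply: (@regular_eq _ _ _ _ p (fun q => ga j' q * cform h0 i' j' l' q)).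
    by apply: filterS in_near => q rq iq; rewrite ga_fs // mulfVK // rq.
  by apply: regular_smooth; smooth_tac.
(* These two terms are regular only together: for [j] and [l] both vertical each may have a pole,
   and symmetry of [h0] makes them equal. In the other cases a scale derivative or a mixed
   coefficient vanishes. *)
have A5 : regular p (fun q => (fs j q)^-1 * dfs i j * h0 j l q - (fs l q)^-1 * dfs i l * h0 l j q).
  have [vj|nvj] := boolP (vt j); have [vl|nvl] := boolP (vt l).
  - apply: (@regular_eq _ _ _ _ p (fun=> 0)); last exact/regular_smooth/smooth_at_cst.
    by apply: filterS h0C => q C _; rewrite /frame_scale_deriv /frame_scale vj vl C subrr.
  - apply: (@regular_eq _ _ _ _ p (fun=> 0)); last exact/regular_smooth/smooth_at_cst.
    by apply: filterS mixed => q H _; rewrite H // /frame_scale_deriv (negbTE nvl) !mulr0 mul0r subrr.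
  - apply: (@regular_eq _ _ _ _ p (fun=> 0)); last exact/regular_smooth/smooth_at_cst.
    by apply: filterS mixed => q H _; rewrite [h0 l j q]H // /frame_scale_deriv (negbTE nvj) !mulr0 mul0r subrr.
  - apply: (@regular_eq _ _ _ _ p (fun=> 0)); last exact/regular_smooth/smooth_at_cst.
    by near=> q; rewrite /frame_scale_deriv (negbTE nvl) (negbTE nvj) !mulr0 !mul0r subrr.
have A6 i' j' l' : regular p (fun q => (fs l' q)^-1 * dfs j' l' * fs i' q * h0 l' i' q).
  have [vl|nvl] := boolP (vt l'); last first.
    apply: (@regular_eq _ _ _ _ p (fun=> 0)); last exact/regular_smooth/smooth_at_cst.
    by near=> q; rewrite /frame_scale_deriv (negbTE nvl) mulr0 !mul0r.
  have [vi|nvi] := boolP (vt i').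
    apply: (@regular_eq _ _ _ _ p (fun q => dfs j' l' * h0 l' i' q)).
      by apply: filterS in_near => q rq iq; have r0 := rq iq; rewrite /frame_scale vi vl; field; exact: r0.
    by apply: regular_smooth; smooth_tac.
  apply: (@regular_eq _ _ _ _ p (fun=> 0)); last exact/regular_smooth/smooth_at_cst.
  by apply: filterS mixed => q H _; rewrite H // mulr0.
(* For vertical [i] the factor [s_i = r] removes the remaining pole. For other [i] the bracket form
   contains only mixed coefficients, since brackets are vertical. *)
have A7 : regular p (fun q => (fs j q)^-1 * (fs l q)^-1 * r q * fs i q * cform h0 j l i q).
  have [vi|nvi] := boolP (vt i).
    apply: (@regular_eq _ _ _ _ p (fun q => ga j q * ga l q * cform h0 j l i q)).
      apply: filterS in_near => q rq iq; have r0 := rq iq; rewrite !ga_fs // /frame_scale vi; field.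
      exact: r0.
    by apply: regular_smooth; smooth_tac.
  apply: (@regular_eq _ _ _ _ p (fun=> 0)); last exact/regular_smooth/smooth_at_cst.
  apply: filterS mixed => q H _; rewrite /bracket_form big1 ?mulr0 // => k vk.
  by rewrite H // mulr0.
apply: (@regular_eq _ _ _ _ p (fun q =>
  (e i q (h0 j l) + dfs j i * h0 l i q - dfs l i * h0 i j q)
  + (fs j q)^-1 * (fs i q * e j q (h0 l i)) - (fs l q)^-1 * (fs i q * e l q (h0 j i))
  + (fs j q)^-1 * r q * cform h0 i j l q - (fs l q)^-1 * r q * cform h0 i l j q
  - ((fs j q)^-1 * dfs i j * h0 j l q - (fs l q)^-1 * dfs i l * h0 l j q)
  - (fs j q)^-1 * (fs l q)^-1 * r q * fs i q * cform h0 j l i q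
  + (fs l q)^-1 * dfs j l * fs i q * h0 l i q
  - (fs j q)^-1 * dfs l j * fs i q * h0 j i q)).
  have hC' := near_join h0C.
  apply: filterS2 hC' (frame_tangent_near AF) => q C te _; rewrite /koszul_form.
  have -> : e l q (h0 j i) = e l q (h0 i j).
    by apply: (tangent_eq (te l)); apply: filterS C => q' ->.
  rewrite !dfs2 -[in LHS](dfs_fs j i q) -[in LHS](dfs_fs l i q).
  ring.
have A0 : regular p (fun q => e i q (h0 j l) + dfs j i * h0 l i q - dfs l i * h0 i j q).
  by apply: regular_smooth; smooth_tac.
do ![apply: regularB => // | apply: regularD => //].
Unshelve. all: by end_near. Qed.

End KoszulRegular.

(** * Conjugation of a connection by [phi] *)

Section ConjugatedConnection.
Context {R : realType} {n b : nat} {E : edge_manifold R n b}.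
Variables (gV : em_N E -> tvec R (em_N E) -> tvec R (em_N E) -> R)
  (gB : em_B E -> tvec R (em_B E) -> tvec R (em_B E) -> R).
Hypotheses (hgV : bundle_metric setT (vertical_bundle (em_pi E)) gV)
  (hgB : riemannian_metric setT gB).
Local Notation r := (em_r E).
Implicit Types (p q : E) (X Y : E -> tvec R E).
Let sH := @solid_halfspace R n.

(** In an adapted frame [fpart] keeps exactly the vertical terms of the expansion, whose
    coefficients are smooth by [af_coef]. *)
Lemma fscale_vfield p (s : E -> R) X : collar E p -> smooth_at p s ->
  vfield_near p X -> vfield_near p (fun q => fscale (s q) q (X q)).
Proof.
move=> cp ss vX.
have [I [i0 [vt [e [th [c AF]]]]]] := adapted_frame_exists hgV hgB cp.
have vF : vfield_near p (fun q => fpart q (X q)).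
  apply: (@section_near_eq _ _ _ _ _ _
    (fun q => \sum_(i | vt i) th i q (X q) *: e i q)); last first.
    by apply: vfield_sum => i _; apply: vfieldZ; [exact: (af_coef AF)|exact: (af_vfield AF)].
  have h1 := af_decomp AF; have h2 := vfield_tangent_near vX.
  have h3 := frame_tangent_near AF; have h4 := af_fpart AF; have h5 := collar_near cp.
  near=> q.
  have cq : collar E q by near: q.
  have te i : tangent q (e i q) by move: i; near: q.
  have fe i : fpart q (e i q) = if vt i then e i q else 0 by move: i; near: q.
  have tX : tangent q (X q) by near: q.
  rewrite [in RHS](near h1 q _ (X q)) // big_mkcond /=.
  suff [-> //] : fpart q (\sum_i th i q (X q) *: e i q) =
     \sum_i (if vt i then th i q (X q) *: e i q else 0) /\
     tangent q (\sum_i th i q (X q) *: e i q).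
  apply: (big_ind2 (fun x y => fpart q x = y /\ tangent q x)).
  - split; last exact: tangent_zero.
    have := fpart_linear (-1) cq (tangent_zero q) (tangent_zero q).
    by rewrite scaler0 addr0 scaleN1r addNr.
  - move=> x1 x2 y1 y2 [<- t1] [<- t2]; split; last exact: tangentD.
    by rewrite -[x1 in LHS]scale1r fpart_linear // scale1r.
  - move=> i _; split; last exact: tangentZ.
    have := fpart_linear (th i q (X q)) cq (te i) (tangent_zero q).
    have := fpart_linear (-1) cq (tangent_zero q) (tangent_zero q).
    rewrite scaler0 !addr0 scaleN1r addNr => -> ->.
    by rewrite fe addr0; case: ifP => // _; rewrite scaler0.
by apply: vfieldD; [exact: vfieldZ|exact: vfieldB].
Unshelve. all: by end_near. Qed.

Lemma phi_vfield p X : collar E p -> vfield_near p X ->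
  vfield_near p (fun q => phi q (X q)).
Proof. by move=> cp; apply: (fscale_vfield cp); exact: r_smooth. Qed.

Lemma phi_inv_vfield p X : collar_interior E p -> vfield_near p X ->
  vfield_near p (fun q => phi_inv q (X q)).
Proof.
move=> /collar_interiorP[cp rp]; apply: (fscale_vfield (s := fun q => (r q)^-1) cp).
by apply: smooth_atV; [rewrite lt_eqF|exact: r_smooth].
Qed.

(** [phi] is linear on fibres, smooth, and invertible off the boundary. The derivative term of the
    Leibniz rule comes out unscaled because [phi] undoes [phi_inv] on it. *)
Lemma phi_conj_connection D : connection (collar_interior E) D ->
  connection (collar_interior E) (phi_conj D).
Proof.
move=> cD; have tD p v Y : collar_interior E p -> tangent p v -> vfield_near p Y ->
    tangent p (D p v (fun q => phi_inv q (Y q))).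
  move=> ip tv vY; apply: (connection_tangent cD sH ip tv).
  exact: phi_inv_vfield.
have cI p : collar_interior E p -> collar E p by case.
split.
- move=> p v Y Z ip tv vY YZ; rewrite /phi_conj.
  rewrite (connection_eq cD ip tv (phi_inv_vfield ip vY)
    (Z := fun q => phi_inv q (Z q))) //.
  by apply: filterS YZ => q ->.
- move=> p k u v Y ip tu tv vY; rewrite /phi_conj.
  rewrite (connection_linear cD) //; last exact: phi_inv_vfield.
  rewrite !phiE fscale_linear //; [exact: cI|exact: tD|exact: tD].
- move=> p v Y Z ip tv vY vZ; rewrite /phi_conj.
  have vYZ := phi_inv_vfield ip (vfieldD vY vZ).
  rewrite (connection_eq cD ip tv vYZ
    (Z := fun q => phi_inv q (Y q) + phi_inv q (Z q))); last first.
    apply: filterS3 (collar_near (cI _ ip)) (vfield_tangent_near vY) (vfield_tangent_near vZ).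
    move=> q cq tY tZ; rewrite !phi_invE.
    by rewrite -[Y q in LHS]scale1r fscale_linear // scale1r.
  rewrite (connection_add cD) //; try exact: phi_inv_vfield.
  rewrite !phiE -[X in fscale _ _ (X + _)]scale1r fscale_linear ?scale1r //.
  + exact: cI.
  + exact: tD.
  + exact: tD.
- move=> p v f Y ip tv sf vY; rewrite /phi_conj.
  have vfY := phi_inv_vfield ip (vfieldZ sf vY).
  have z0 q : collar E q -> fscale (r q)^-1 q 0 = 0.
    move=> cq; have := fscale_linear (r q)^-1 (-1) cq (tangent_zero q) (tangent_zero q).
    by rewrite scaler0 addr0 scaleN1r addNr.
  rewrite (connection_eq cD ip tv vfY
    (Z := fun q => f q *: phi_inv q (Y q))); last first.
    apply: filterS2 (collar_near (cI _ ip)) (vfield_tangent_near vY).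
    move=> q cq tY; rewrite !phi_invE -[f q *: Y q]addr0 fscale_linear //.
      by rewrite z0 // addr0.
    exact: tangent_zero.
  have vi := phi_inv_vfield ip vY.
  rewrite (connection_leibniz cD) // phiE fscale_linear; last 3 first.
  + exact: cI.
  + exact: (vfield_tangent vi).
  + by apply: tangentZ; exact: tD.
  rewrite -phiE phi_invK //; last exact: vfield_tangent.
  congr (_ + _); rewrite -[f p *: D _ _ _]addr0 fscale_linear; last 3 first.
  + exact: cI.
  + exact: tD.
  + exact: tangent_zero.
  have := fscale_linear (r p) (-1) (cI _ ip) (tangent_zero p) (tangent_zero p).
  by rewrite scaler0 addr0 scaleN1r addNr => ->; rewrite addr0.
- move=> p X Y ip vX vY; apply: phi_vfield; first exact: cI.
  by apply: (connection_vfield cD) => //; exact: phi_inv_vfield.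
Qed.

End ConjugatedConnection.

(** * Christoffel symbols near the boundary *)

Section FrameCoefficients.
Context {R : realType} {n b : nat} {E : edge_manifold R n b}.
Variables (gV : em_N E -> tvec R (em_N E) -> tvec R (em_N E) -> R)
  (gB : em_B E -> tvec R (em_B E) -> tvec R (em_B E) -> R).
Hypotheses (hgV : bundle_metric setT (vertical_bundle (em_pi E)) gV)
  (hgB : riemannian_metric setT gB).
Local Notation r := (em_r E).
Implicit Types (q : E).
Variables (p : E) (I : finType) (i0 : I) (vt : pred I)
    (e : I -> E -> tvec R E) (th : I -> E -> tvec R E -> R)
    (c : I -> I -> I -> E -> R).
Hypotheses (bp : boundary E p) (AF : adapted_frame gV gB p i0 vt e th c).
Local Notation K := (@koszul_form R n b E I i0 vt e c).
Local Notation h0 := (fun i j q => model_phi gV gB q (e i q) (e j q)).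
Let sH := @solid_halfspace R n.
Let cp : collar E p. Proof. by have [] := (boundaryP p).1 bp. Qed.

Lemma connection_frame D X Y f : connection (collar_interior E) D ->
  vfield_near p X -> vfield_near p Y ->
  \forall q \near p, collar_interior E q -> D q (X q) Y f =
    \sum_i th i q (X q) * \sum_j (e i q (fun q => th j q (Y q)) * e j q f +
      th j q (Y q) * \sum_k th k q (D q (e i q) (e j)) * e k q f).
Proof.
move=> cD vX vY; pose bb j q := th j q (Y q).
have sb : \forall q \near p, forall j, smooth_at q (bb j).
  apply: (@filter_forall _ _ (fun j q => smooth_at q (bb j)) (nbhs p)) => j.
  by apply: smooth_at_near; exact: (af_coef AF).
have h1 := near_join (af_decomp AF); have h2 := frame_vfield_near AF.
have h3 := section_near_near vX; have h4 := section_near_near vY.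
near=> q => iq.
have vXq : vfield_near q X by near: q.
have vYq : vfield_near q Y by near: q.
have ve i : vfield_near q (e i) by move: i; near: q.
have te i : tangent q (e i q) by exact: vfield_tangent.
have sbq j : smooth_at q (bb j) by move: j; near: q.
have dec : \forall q' \near q, forall v, tangent q' v -> v = \sum_i th i q' v *: e i q'.
  by near: q.
have decq := nbhs_singleton dec.
rewrite {1}(decq (X q)); last exact: vfield_tangent.
rewrite (connection_suml cD) // fct_sumE; apply: eq_bigr => i _.
rewrite -[LHS]/(th i q (X q) * D q (e i q) Y f); congr (_ * _).
rewrite (connection_eq cD iq (te i) vYq (Z := fun q => \sum_j bb j q *: e j q)); last first.
  by apply: filterS2 dec (vfield_tangent_near vYq) => q' H tY; exact: H.
rewrite (connection_sumr cD _ iq (te i) sbq ve) fct_sumE; apply: eq_bigr => j _.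
rewrite -[LHS]/(e i q (bb j) * e j q f + bb j q * D q (e i q) (e j) f).
congr (_ + _ * _).
have tD : tangent q (D q (e i q) (e j)) by exact: (connection_tangent cD sH).
by rewrite {1}(decq _ tD) fct_sumE.
Unshelve. all: by end_near. Qed.

(** All other ingredients of the expansion in [connection_frame] are smooth, so the hypothesis
    needed for [extension] reduces to the Christoffel symbols in a single frame. *)
Lemma connection_frame_regular D X Y f : connection (collar_interior E) D ->
  (forall i j k, regular p (fun q => th k q (D q (e i q) (e j)))) ->
  vfield_near p X -> vfield_near p Y -> smooth_at p f ->
  regular p (fun q => D q (X q) Y f).
Proof.
move=> cD rD vX vY sf.
have se i g : smooth_at p g -> regular p (fun q => e i q g).
  by move=> sg; apply: regular_smooth; exact: vfield_smooth (af_vfield AF i) sg.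
have st i Z : vfield_near p Z -> smooth_at p (fun q => th i q (Z q)).
  by move=> vZ; exact: (af_coef AF).
apply: regular_eq.
  by apply: filterS (connection_frame f cD vX vY) => q H iq; rewrite [RHS]H.
apply: regular_sum => i _; apply: regularM; first exact/regular_smooth/st.
apply: regular_sum => j _; apply: regularD; apply: regularM.
- exact/se/st.
- exact: se.
- exact/regular_smooth/st.
- by apply: regular_sum => k _; apply: regularM => //; exact: se.
Qed.

(** The combination of the [e k] with coefficients [a] is orthogonal to the whole frame, hence to
    itself. It vanishes by definiteness of [model_phi] at the boundary, and the frame is free. *)
Lemma model_form_free (a : I -> R) :
  (forall l, \sum_k a k * h0 k l p = 0) -> forall k, a k = 0.
Proof.
move=> Ha; apply: (af_free AF).
have te i : tangent p (e i p) by exact: vfield_tangent (af_vfield AF i).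
apply: (model_phi_eq0 hgV hgB cp).
  by apply: tangent_sum => i _; exact: tangentZ.
have L k u v w (tu : tangent p u) (tv : tangent p v) (tw : tangent p w) :=
  model_phiL hgV hgB k cp tu tv tw.
have C u v (tu : tangent p u) (tv : tangent p v) := model_phiC hgV hgB cp tu tv.
have tS : tangent p (\sum_i a i *: e i p).
  by apply: tangent_sum => i _; exact: tangentZ.
rewrite (form_suml (tangent_zero p) (@tangent_linear _ _ _ _ p) L) //.
apply: big1 => l _; rewrite C //.
by rewrite (form_suml (tangent_zero p) (@tangent_linear _ _ _ _ p) L) // Ha mulr0.
Qed.

Section Coefficients.
Variables (G : E -> tvec R E -> tvec R E -> R) (D : covariant_derivative E).
Hypothesis LC : levi_civita (collar_interior E) G D.
Hypothesis GC : forall q u v, collar_interior E q -> tangent q u -> tangent q v ->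
  G q u v = G q v u.
Hypothesis GL : forall q (k : R) u v w, collar_interior E q -> tangent q u ->
  tangent q v -> tangent q w -> G q (k *: u + v) w = k * G q u w + G q v w.
Variable a : I -> I -> E -> R.
Hypothesis sa : forall i j, smooth_at p (a i j).
Local Notation h := (fun i j q => h0 i j q + r q * a i j q).
Hypothesis Gh : \forall q \near p, collar_interior E q -> forall i j,
  phi_form G q (e i q) (e j q) = h i j q.

Let cD := levi_civita_connection LC.
Let sh i j : smooth_at p (h i j).
Proof.
apply: smooth_atD; first exact: (af_h_smooth AF).
by apply: smooth_atM => //; exact: r_smooth.
Qed.

(** Expanding the conjugated derivative in the frame turns [koszul_formE] into a linear system for
    the Christoffel symbols with matrix [h]. *)
Lemma coefficients_solve : \forall q \near p, collar_interior E q -> forall i j l,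
  \sum_k th k q (phi_conj D q (e i q) (e j)) * h k l q = 2^-1 * K h i j l q.
Proof.
have h1 := af_decomp AF; have h2 := frame_vfield_near AF.
have h3 := koszul_formE AF LC GC GL sh Gh.
near=> q => iq i j l.
have cq : collar E q by case: iq.
have ve i' : vfield_near q (e i') by move: i'; near: q.
have te i' : tangent q (e i' q) by exact: vfield_tangent.
rewrite -(near h3 q) // mulKf ?pnatr_eq0 //.
set w := phi_conj _ _ _ _.
have tw : tangent q w.
  by apply: (connection_tangent (phi_conj_connection hgV hgB cD) sH).
rewrite [in RHS](near h1 q _ w) //.
rewrite (@form_suml _ _ (tangent q) (phi_form G q)) //.
- by apply: eq_bigr => k _; rewrite (near Gh q).
- exact: tangent_zero.
- exact: tangent_linear.
- move=> k u v w' tu tv tw'; rewrite /phi_form !phi_invE fscale_linear // GL //;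
    exact: fscale_tangent.
Unshelve. all: by end_near. Qed.

Let h0C : \forall q \near p, forall i j, h0 i j q = h0 j i q.
Proof.
apply: filterS2 (collar_near cp) (frame_tangent_near AF) => q cq te i j.
exact: (model_phiC hgV hgB).
Qed.

(** The simple poles of [K a] are absorbed by the factor [r] that [koszul_form_scale] puts in front
    of it. *)
Lemma koszul_form_perturbed i j l : regular p (fun q => K h i j l q).
Proof.
have s1 i' j' : smooth_at p (fun q => r q * a i' j' q).
  by apply: smooth_atM => //; exact: r_smooth.
have A := koszul_form_add AF (af_h_smooth AF) s1.
have S := koszul_form_scale cp AF sa.
apply: regular_eq.
  by apply: filterS2 A S => q HA HS _; rewrite [RHS]HA HS.
apply: regularD; first exact: (koszul_form_model_regular cp AF h0C).
apply: regularD; first exact: (koszul_form_r_regular cp AF).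
apply: regular_smooth; rewrite /koszul_corr.
apply: smooth_atB; first apply: smooth_atD;
  do ?[apply: smooth_atM => //]; try exact: smooth_at_cst; exact: frame_scale_smooth.
Qed.

Lemma coefficients_regular i j k :
  regular p (fun q => th k q (phi_conj D q (e i q) (e j))).
Proof.
have rp0 : r p = 0 by have [] := (boundaryP p).1 bp.
(* At [p] the perturbation [r a] vanishes, so the matrix to invert is that of the model form. *)
have hp u : (forall l, \sum_k u k * h k l p = 0) -> forall k, u k = 0.
  move=> H; apply: model_form_free => l; rewrite -[RHS](H l).
  by apply: eq_bigr => m _; rewrite rp0 mul0r addr0.
have [hi [shi Hi]] := smooth_linear_solve sh hp.
apply: (@regular_eq _ _ _ _ p (fun q => \sum_l (2^-1 * K h i j l q) * hi l k q)).
  apply: filterS2 Hi coefficients_solve => q HH HS iq.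
  rewrite -(HH (fun k => th k q (phi_conj D q (e i q) (e j)))
    (fun l => 2^-1 * K h i j l q)) // => l; exact: HS.
apply: regular_sum => l _; apply: regularM; last exact: regular_smooth.
apply: regularM; last exact: koszul_form_perturbed.
exact/regular_smooth/smooth_at_cst.
Qed.

End Coefficients.
End FrameCoefficients.

(** * Comparison for second-order perturbations *)

Section SecondOrder.
Context {R : realType} {n b : nat} {E : edge_manifold R n b}.
Variables (gV : em_N E -> tvec R (em_N E) -> tvec R (em_N E) -> R)
  (gB : em_B E -> tvec R (em_B E) -> tvec R (em_B E) -> R).
Hypotheses (hgV : bundle_metric setT (vertical_bundle (em_pi E)) gV)
  (hgB : riemannian_metric setT gB).
Local Notation r := (em_r E).
Implicit Types (q : E).
Variables (p : E) (I : finType) (i0 : I) (vt : pred I)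
    (e : I -> E -> tvec R E) (th : I -> E -> tvec R E -> R)
    (c : I -> I -> I -> E -> R).
Hypotheses (bp : boundary E p) (AF : adapted_frame gV gB p i0 vt e th c).
Local Notation K := (@koszul_form R n b E I i0 vt e c).
Local Notation h0 := (fun i j q => model_phi gV gB q (e i q) (e j q)).
Let cp : collar E p. Proof. by have [] := (boundaryP p).1 bp. Qed.
Variables (G Gt : E -> tvec R E -> tvec R E -> R) (D Dt : covariant_derivative E).
Hypotheses (LC : levi_civita (collar_interior E) G D)
  (LCt : levi_civita (collar_interior E) Gt Dt).
Hypothesis GC : forall q u v, collar_interior E q -> tangent q u -> tangent q v ->
  G q u v = G q v u.
Hypothesis GL : forall q (k : R) u v w, collar_interior E q -> tangent q u ->
  tangent q v -> tangent q w -> G q (k *: u + v) w = k * G q u w + G q v w.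
Hypothesis GtC : forall q u v, collar_interior E q -> tangent q u -> tangent q v ->
  Gt q u v = Gt q v u.
Hypothesis GtL : forall q (k : R) u v w, collar_interior E q -> tangent q u ->
  tangent q v -> tangent q w -> Gt q (k *: u + v) w = k * Gt q u w + Gt q v w.
Variable a : I -> I -> E -> R.
Hypothesis sa : forall i j, smooth_at p (a i j).
Hypothesis Gh : \forall q \near p, collar_interior E q -> forall i j,
  phi_form G q (e i q) (e j q) = h0 i j q.
Hypothesis Gth : \forall q \near p, collar_interior E q -> forall i j,
  phi_form Gt q (e i q) (e j q) = h0 i j q + r q ^+ 2 * a i j q.

Local Notation ra := (fun i j q => r q * a i j q).
Let sra i j : smooth_at p (ra i j).
Proof. by apply: smooth_atM => //; exact: r_smooth. Qed.
Let Gh' : \forall q \near p, collar_interior E q -> forall i j,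
  phi_form G q (e i q) (e j q) = h0 i j q + r q * 0.
Proof. by apply: filterS Gh => q H iq i j; rewrite H // mulr0 addr0. Qed.
Let Gth' : \forall q \near p, collar_interior E q -> forall i j,
  phi_form Gt q (e i q) (e j q) = h0 i j q + r q * ra i j q.
Proof. by apply: filterS Gth => q H iq i j; rewrite H // expr2 mulrA. Qed.
Local Notation Gam D := (fun i j k q => th k q (phi_conj D q (e i q) (e j))).

(** A second-order perturbation is a first-order one with coefficients [ra], so the symbols of [Dt]
    are regular. Subtracting the two linear systems gives, for the difference of the symbols paired
    with [h0], half of [K (r ra)] minus the symbols of [Dt] paired with [r ra]. Both terms contain a
    factor [r], and [h0] is smoothly invertible. *)
Lemma coefficients_difference : exists Q : I -> I -> I -> E -> R,
  (forall i j k, regular p (Q i j k)) /\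
  \forall q \near p, collar_interior E q -> forall i j k,
    Gam Dt i j k q - Gam D i j k q = r q * Q i j k q.
Proof.
pose z : I -> I -> E -> R := fun _ _ _ => 0.
have sz i j : smooth_at p (z i j) by exact: smooth_at_cst.
have h0z : (fun i j q => h0 i j q + r q * z i j q) = h0.
  by apply/funext => i; apply/funext => j; apply/funext => q; rewrite mulr0 addr0.
have sh0 : forall i j, smooth_at p (h0 i j) := af_h_smooth AF.
have rGt i j k := coefficients_regular hgV hgB bp AF LCt GtC GtL sra Gth' i j k.
have solve := coefficients_solve hgV hgB bp AF LC GC GL sz Gh'.
have {}solve : \forall q \near p, collar_interior E q -> forall i j l,
    \sum_k Gam D i j k q * h0 k l q = 2^-1 * K h0 i j l q.
  by apply: filterS solve => q H iq i j l; rewrite -[in RHS]h0z -H //;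
    apply: eq_bigr => k _; rewrite mulr0 addr0.
have solvet := coefficients_solve hgV hgB bp AF LCt GtC GtL sra Gth'.
have [hi [shi Hi]] := smooth_linear_solve sh0 (model_form_free hgV hgB bp AF).
have srra i j : smooth_at p (fun q => r q * ra i j q).
  by apply: smooth_atM => //; exact: r_smooth.
have addK := koszul_form_add AF sh0 srra.
have scK := koszul_form_scale cp AF sra.
have scK' := koszul_form_scale cp AF sa.
(* The quotient by [r] of the right-hand side. The correction occurs twice because [r] is split off
   twice from [r^2 a], each time leaving one copy after division by [r]. *)
pose T i j l q := 2^-1 * (r q * K a i j l q + koszul_corr i0 vt a i j l q
  + koszul_corr i0 vt a i j l q) - \sum_k Gam Dt i j k q * ra k l q.
have rT i j l : regular p (T i j l).
  have rc : regular p (koszul_corr i0 vt a i j l).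
    apply: regular_smooth; rewrite /koszul_corr.
    apply: smooth_atB; first apply: smooth_atD;
      do ?[apply: smooth_atM => //]; try exact: smooth_at_cst; exact: frame_scale_smooth.
  apply: regularB.
    apply: regularM; first exact/regular_smooth/smooth_at_cst.
    by do 2![apply: regularD => //]; exact: (koszul_form_r_regular cp AF).
  apply: regular_sum => k _; apply: regularM; first exact: rGt.
  exact: regular_smooth.
exists (fun i j m q => \sum_l T i j l q * hi l m q); split.
  move=> i j k; apply: regular_sum => l _; apply: regularM => //.
  exact: regular_smooth.
near=> q => iq i j m.
rewrite (near Hi q _ (fun m => Gam Dt i j m q - Gam D i j m q) (fun l => r q * T i j l q)) //.
  by rewrite mulr_sumr; apply: eq_bigr => l _; rewrite mulrA.
move=> l; have e1 : \sum_k Gam D i j k q * h0 k l q = 2^-1 * K h0 i j l q.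
  by rewrite (near solve q).
have e2 : \sum_k Gam Dt i j k q * (h0 k l q + r q * ra k l q) =
    2^-1 * (K h0 i j l q + (r q * (r q * K a i j l q + koszul_corr i0 vt a i j l q)
      + r q * koszul_corr i0 vt a i j l q)).
  rewrite (near solvet q) // (near addK q) // (near scK q) // (near scK' q) //.
  by congr (_ * (_ + (_ + _))); rewrite /koszul_corr; ring.
have e3 : \sum_k Gam Dt i j k q * (h0 k l q + r q * ra k l q) =
    \sum_k Gam Dt i j k q * h0 k l q + r q * \sum_k Gam Dt i j k q * ra k l q.
  by rewrite mulr_sumr -big_split; apply: eq_bigr => k _ /=; ring.
have e4 : \sum_k (Gam Dt i j k q - Gam D i j k q) * h0 k l q =
    \sum_k Gam Dt i j k q * h0 k l q - \sum_k Gam D i j k q * h0 k l q.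
  by rewrite -sumrB; apply: eq_bigr => k _; rewrite mulrBl.
have e5 : \sum_k Gam Dt i j k q * h0 k l q = 2^-1 * (K h0 i j l q
    + (r q * (r q * K a i j l q + koszul_corr i0 vt a i j l q)
      + r q * koszul_corr i0 vt a i j l q)) - r q * \sum_k Gam Dt i j k q * ra k l q.
  by rewrite -e2 e3 addrK.
by rewrite e4 e1 e5 /T; ring.
Unshelve. all: by end_near. Qed.

End SecondOrder.

(** The connection of [gt] is given off the boundary in all of [M], while the comparison with the
    model takes place in the interior of the collar. *)
Lemma levi_civita_sub (R : realType) (n : nat) (H : set 'rV[R]_n) (M : manifold H)
    (O O' : set M) g D : O' `<=` O -> levi_civita O g D -> levi_civita O' g D.
Proof.
move=> sO [[c1 c2 c3 c4 c5] T C]; split; last 2 first.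
- by move=> p X Y /sO; exact: T.
- by move=> p v Y Z /sO; exact: C.
by split=> [p v Y Z|p k u v Y|p v Y Z|p v f Y|p X Y] /sO; [exact: c1|exact: c2|
  exact: c3|exact: c4|exact: c5].
Qed.

(** * The model metric and its perturbations *)

Section Main.
Context {R : realType} {n b : nat} {E : edge_manifold R n b}.
Variables (gV : em_N E -> tvec R (em_N E) -> tvec R (em_N E) -> R)
  (gB : em_B E -> tvec R (em_B E) -> tvec R (em_B E) -> R).
Hypotheses (hgV : bundle_metric setT (vertical_bundle (em_pi E)) gV)
  (hgB : riemannian_metric setT gB).
Local Notation r := (em_r E).
Let sH := @solid_halfspace R n.
Local Notation g := (model_metric gV gB).

Let interior_nb : collar_interior E `<=` ~` boundary E. Proof. by move=> p []. Qed.
Let cI (p : E) : collar_interior E p -> collar E p. Proof. by case. Qed.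

Let gC q u v : collar_interior E q -> tangent q u -> tangent q v -> g q u v = g q v u.
Proof. by move=> /cI; exact: model_metricC. Qed.

Let gL q (k : R) u v w : collar_interior E q -> tangent q u -> tangent q v ->
  tangent q w -> g q (k *: u + v) w = k * g q u w + g q v w.
Proof. by move=> /cI; exact: model_metricL. Qed.

Section Perturbed.
Variable gt : E -> tvec R E -> tvec R E -> R.
Hypothesis hgt : riemannian_metric (~` boundary E) gt.

Lemma perturbed_sym q u v : collar_interior E q -> tangent q u -> tangent q v ->
  gt q u v = gt q v u.
Proof. by move=> /interior_nb nb; case: hgt => -[+ _ _] _; apply. Qed.

Lemma perturbed_linear q (k : R) u v w : collar_interior E q -> tangent q u ->
  tangent q v -> tangent q w -> gt q (k *: u + v) w = k * gt q u w + gt q v w.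
Proof. by move=> /interior_nb nb; case: hgt => -[_ + _] _; apply. Qed.

Lemma perturbation_frame k p I i0 vt e th c :
  @adapted_frame R n b E gV gB p I i0 vt e th c -> collar E p ->
  perturbation k g gt -> exists a : I -> I -> E -> R,
  (forall i j, smooth_at p (a i j)) /\
  \forall q \near p, collar_interior E q -> forall i j,
  phi_form gt q (e i q) (e j q) =
    model_phi gV gB q (e i q) (e j q) + r q ^+ k * a i j q.
Proof.
move=> AF cp [_ [alpha [_ _ salpha] Ha]].
exists (fun i j q => alpha q (e i q) (e j q)); split.
  by move=> i j; apply: salpha => //; exact: (af_vfield AF).
apply: filterS (frame_tangent_near AF) => q te iq i j.
by rewrite Ha // phi_form_model.
Qed.

End Perturbed.

Lemma model_frame p I i0 vt e th c :
  @adapted_frame R n b E gV gB p I i0 vt e th c ->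
  \forall q \near p, collar_interior E q -> forall i j,
  phi_form g q (e i q) (e j q) = model_phi gV gB q (e i q) (e j q).
Proof.
move=> AF; apply: filterS (frame_tangent_near AF) => q te iq i j.
exact: phi_form_model.
Qed.

Lemma model_extension D : levi_civita (collar_interior E) g D ->
  exists D', smooth_extension (phi_conj D) D'.
Proof.
move=> LC; have cD := phi_conj_connection hgV hgB (levi_civita_connection LC).
exists (extension (phi_conj D)); apply: extension_smooth => // p X Y f bp vX vY sf.
have [cp _] := (boundaryP p).1 bp.
have [I [i0 [vt [e [th [c AF]]]]]] := adapted_frame_exists hgV hgB cp.
apply: (connection_frame_regular AF cD) => // i j k.
(* The model metric is treated as the perturbation with zero coefficients. *)
apply: (coefficients_regular hgV hgB bp AF LC gC gL (a := fun _ _ _ => 0)).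
  by move=> *; exact: smooth_at_cst.
by apply: filterS (model_frame AF) => q H iq i' j'; rewrite H // mulr0 addr0.
Qed.

Lemma perturbed_extension gt D : perturbation 1 g gt ->
  levi_civita (~` boundary E) gt D -> exists D', smooth_extension (phi_conj D) D'.
Proof.
move=> hgt /(levi_civita_sub interior_nb) LC.
have cD := phi_conj_connection hgV hgB (levi_civita_connection LC).
exists (extension (phi_conj D)); apply: extension_smooth => // p X Y f bp vX vY sf.
have [cp _] := (boundaryP p).1 bp.
have [I [i0 [vt [e [th [c AF]]]]]] := adapted_frame_exists hgV hgB cp.
have [a [sa Ha]] := perturbation_frame AF cp hgt.
apply: (connection_frame_regular AF cD) => // i j k.
exact: (coefficients_regular hgV hgB bp AF LC (perturbed_sym hgt.1)
  (perturbed_linear hgt.1) sa Ha).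
Qed.

(** In the interior, [coefficients_difference] gives [Dt = D + r S] with [S] regular. All terms have
    smooth extensions, so the identity reaches [p] by density, and there [r] vanishes. *)
Lemma second_order_boundary gt D0 Dt0 D Dt : perturbation 2 g gt ->
  levi_civita (collar_interior E) g D0 -> levi_civita (~` boundary E) gt Dt0 ->
  smooth_extension (phi_conj D0) D -> smooth_extension (phi_conj Dt0) Dt ->
  forall p v Y, boundary E p -> tangent p v -> vfield_near p Y ->
  D p v Y = Dt p v Y.
Proof.
move=> hgt LC /(levi_civita_sub interior_nb) LCt [cD eD] [cDt eDt] p v Y bp tv vY.
have [cp rp] := (boundaryP p).1 bp.
have [X vX Xp] := tangent_extend sH tv.
apply/funext => f; have [sf|nsf] := pselect (smooth_at p f); last first.
  have tD := connection_tangent cD sH cp tv vY.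
  have tDt := connection_tangent cDt sH cp tv vY.
  by rewrite (tangent0 tD nsf) (tangent0 tDt nsf).
have [I [i0 [vt [e [th [c AF]]]]]] := adapted_frame_exists hgV hgB cp.
have [a [sa Ha]] := perturbation_frame AF cp hgt.
have [Q [rQ HQ]] := coefficients_difference hgV hgB bp AF LC LCt gC gL
  (perturbed_sym hgt.1) (perturbed_linear hgt.1) sa (model_frame AF) Ha.
have c0 := phi_conj_connection hgV hgB (levi_civita_connection LC).
have c1 := phi_conj_connection hgV hgB (levi_civita_connection LCt).
have sth i Z : vfield_near p Z -> smooth_at p (fun q => th i q (Z q)).
  by move=> vZ; exact: (af_coef AF).
have [S sS HS] : regular p (fun q => \sum_i th i q (X q) * \sum_j (th j q (Y q) *
    \sum_k Q i j k q * e k q f)).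
  apply: regular_sum => i _; apply: regularM; first exact/regular_smooth/sth.
  apply: regular_sum => j _; apply: regularM; first exact/regular_smooth/sth.
  apply: regular_sum => k _; apply: regularM => //; apply: regular_smooth.
  exact: vfield_smooth (af_vfield AF k) sf.
have sD := vfield_smooth (connection_vfield cD cp vX vY) sf.
have sDt := vfield_smooth (connection_vfield cDt cp vX vY) sf.
rewrite -Xp; apply/esym.
suff : Dt p (X p) Y f = D p (X p) Y f + r p * S p.
  by rewrite rp mul0r addr0.
apply: (@boundary_dense _ _ _ _ p (fun q => Dt q (X q) Y f)
  (fun q => D q (X q) Y f + r q * S q)) => //.
  by apply: smooth_atD => //; apply: smooth_atM => //; exact: r_smooth.
have f0 := connection_frame AF f c0 vX vY.
have f1 := connection_frame AF f c1 vX vY.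
have h1 := vfield_tangent_near vX; have h2 := section_near_near vY.
near=> q => iq.
have tX : tangent q (X q) by near: q.
have vYq : vfield_near q Y by near: q.
rewrite eD // eDt // (near f0 q) // (near f1 q) // -(near HS q) //.
rewrite mulr_sumr -big_split; apply: eq_bigr => i _ /=.
rewrite mulrCA -mulrDr; congr (_ * _).
rewrite mulr_sumr -big_split; apply: eq_bigr => j _ /=.
rewrite mulrCA -addrA -mulrDr; congr (_ + _ * _).
rewrite mulr_sumr -big_split; apply: eq_bigr => k _ /=.
have dQ : th k q (phi_conj Dt0 q (e i q) (e j)) - th k q (phi_conj D0 q (e i q) (e j)) = r q * Q i j k q.
  by rewrite (near HQ q).
by rewrite mulrA -dQ; ring.
Unshelve. all: by end_near. Qed.

End Main.

Theorem theorem1p4 (R : realType) (n b : nat) (E : edge_manifold R n b)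
    (gV : em_N E -> tvec R (em_N E) -> tvec R (em_N E) -> R)
    (gB : em_B E -> tvec R (em_B E) -> tvec R (em_B E) -> R)
    (gt : E -> tvec R E -> tvec R E -> R)
    (nabla nablat : covariant_derivative E)
    (hgV : bundle_metric setT (vertical_bundle (em_pi E)) gV)
    (hgB : riemannian_metric setT gB)
    (hgt : perturbation 1 (model_metric gV gB) gt)
    (hnabla : levi_civita (collar_interior E) (model_metric gV gB) nabla)
    (hnablat : levi_civita (~` boundary E) gt nablat) :
  ((exists D, smooth_extension (phi_conj nabla) D) /\
   (exists Dt, smooth_extension (phi_conj nablat) Dt)) /\
  (perturbation 2 (model_metric gV gB) gt ->
   forall D Dt : covariant_derivative E,
     smooth_extension (phi_conj nabla) D ->
     smooth_extension (phi_conj nablat) Dt ->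
     forall p v Y, boundary E p -> tangent p v -> vfield_near p Y ->
       D p v Y = Dt p v Y).
Proof.
split; first split.
- exact: model_extension hgV hgB _ hnabla.
- exact: perturbed_extension hgV hgB _ _ hgt hnablat.
- move=> hgt2 D Dt sD sDt.
  exact: second_order_boundary hgV hgB _ _ _ _ _ hgt2 hnabla hnablat sD sDt.
Qed.
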